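(* Suppose $X=\emptyset$, so that $\mathcal B$ is the Borel subalgebra of $\mathcal G$ associated to $P(\dot\Sigma,\emptyset)$, and let $\lambda\in\mathcal H^*$. Then $M_{\mathcal B}(\lambda)$ is a simple $\mathcal G$-module if and only if $\lambda(K)\neq 0$.
   Context: All objects are over $\mathbb C$. $\mathfrak g=\mathfrak g_{\bar 0}\oplus\mathfrak g_{\bar 1}$ is one of the Lie superalgebras $\mathfrak{gl}(m,n)$, $\mathfrak{sl}(m,n)$ with $m\ne n$, $\mathfrak{osp}(m,n)$, $D(2,1;a)$ ($a\neq 0,-1$), $G(3)$, $F(4)$. $(\cdot|\cdot)$ is an even non-degenerate supersymmetric invariant bilinear form on $\mathfrak g$; $\mathfrak h$ is a Cartan subalgebra of $\mathfrak g$ (i.e. of $\mathfrak g_{\bar 0}$), and $\mathfrak g=\mathfrak h\oplus\bigoplus_{\alpha\in\dot\Delta}\mathfrak g_\alpha$ is the root space decomposition. A base (system of simple roots) of $\dot\Delta$ is a linearly independent $\dot\Sigma\subseteq\dot\Delta$ for which there are $x_\alpha\in\mathfrak g_\alpha$, $y_\alpha\in\mathfrak g_{-\alpha}$ ($\alpha\in\dot\Sigma$) such that $\{x_\alpha,y_\alpha\}_{\alpha\in\dot\Sigma}\cup\mathfrak h$ generates $\mathfrak g$ and $[x_\alpha,y_\beta]=0$ for $\alpha\ne\beta$. $\dot\Delta^{+}(\dot\Sigma)$ denotes the set of roots that are non-negative integer combinations of $\dot\Sigma$. Fix a base $\dot\Sigma$. The affine Lie superalgebra is $\mathcal G=(\mathfrak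 g\otimes\mathbb C[t,t^{-1}])\oplus\mathbb CK\oplus\mathbb Cd$ with $[x(m),y(n)]=[x,y](m+n)+m\delta_{m,-n}(x|y)K$, $[d,x(m)]=-m\,x(m)$, $[K,\mathcal G]=0$, where $x(m)=x\otimes t^m$. Its Cartan subalgebra is $\mathcal H=\mathfrak h\oplus\mathbb CK\oplus\mathbb Cd$; its roots are $\Delta=\{\alpha+n\delta\mid\alpha\in\dot\Delta\cup\{0\},n\in\mathbb Z\}\setminus\{0\}$, with $\mathcal G_{\alpha+n\delta}=\mathfrak g_\alpha\otimes t^n$ for $\alpha\in\dot\Delta$ and $\mathcal G_{n\delta}=\mathfrak h\otimes t^n$ for $n\neq0$. $P(\dot\Sigma,\emptyset)=\{\alpha+n\delta\mid\alpha\in\dot\Delta^+(\dot\Sigma),n\in\mathbb Z\}\cup\{k\delta\mid k\in\mathbb Z_{>0}\}$ (the natural parabolic partition); $\mathcal N^+=\bigoplus_{\alpha\in P(\dot\Sigma,\emptyset)}\mathcal G_\alpha$ and $\mathcal B=\mathcal H\oplus\mathcal N^+=\mathcal H\oplus(\mathfrak h\otimes t\mathbb C[t])\oplus(\mathfrak n^+\otimes\mathbb C[t,t^{-1}])$ with $\mathfrak n^+=\bigoplus_{\alpha\in\dot\Delta^+(\dot\Sigma)}\mathfrak g_\alpha$. $M_{\mathcal B}(\lambda)=\mathrm{Ind}_{\mathcal B}^{\mathcal G}\mathbb C_\lambda$, where $\mathbb C_\lambda$ is one-dimensional, $\mathcal H$ acting by $\lambda$ and $\mathcal N^+$ by $0$.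 *)

(* Defs.v *)
From HB Require Import structures.
From mathcomp Require Import all_boot all_order all_algebra.
From mathcomp Require Import finmap monalg complex ring_quotient.
From mathcomp Require Import boolp reals.

Set Implicit Arguments.
Unset Strict Implicit.
Unset Printing Implicit Defensive.

Import GRing.Theory.
Local Open Scope ring_scope.
Local Open Scope quotient_scope.

Section LinearSpan.
Variables (F : fieldType) (V : lmodType F).

Definition lspan (P : V -> Prop) (v : V) : Prop :=
  exists s : seq (F * V),
    (forall p, p \in s -> P p.2) /\ v = \sum_(p <- s) p.1 *: p.2.

Lemma lspan_gen (P : V -> Prop) v : P v -> lspan P v.
Proof.
move=> Pv; exists [:: (1, v)]; split; first by move=> p; rewrite inE => /eqP->.
by rewrite big_seq1 scale1r.
Qed.

Lemma lspan0 (P : V -> Prop) : lspan P 0.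
Proof. by exists [::]; rewrite big_nil. Qed.

Lemma lspanD (P : V -> Prop) u v : lspan P u -> lspan P v -> lspan P (u + v).
Proof.
move=> [s [Ps ->]] [t [Pt ->]]; exists (s ++ t); split; last by rewrite big_cat.
by move=> p; rewrite mem_cat => /orP[/Ps|/Pt].
Qed.

Lemma lspanZ (P : V -> Prop) c v : lspan P v -> lspan P (c *: v).
Proof.
move=> [s [Ps ->]]; exists [seq (c * p.1, p.2) | p <- s]; split.
  by move=> _ /mapP[p /Ps ? ->].
by rewrite big_map scaler_sumr; apply: eq_bigr => p _; rewrite scalerA.
Qed.

Definition span_pred (P : V -> Prop) : {pred V} := fun v => `[< lspan P v >].

Lemma span_predE (P : V -> Prop) v : (v \in span_pred P) = `[< lspan P v >].
Proof. by []. Qed.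

Lemma span_predP (P : V -> Prop) v : reflect (lspan P v) (v \in span_pred P).
Proof. exact: asboolP. Qed.

Fact span_zmod_closed (P : V -> Prop) : zmod_closed (span_pred P).
Proof.
split=> [|u v /span_predP Pu /span_predP Pv]; apply/span_predP.
  exact: lspan0.
by rewrite -scaleN1r; apply: lspanD => //; apply: lspanZ.
Qed.

HB.instance Definition _ (P : V -> Prop) :=
  GRing.isZmodClosed.Build V (span_pred P) (span_zmod_closed P).

End LinearSpan.

Lemma lspan_image (F : fieldType) (V W : lmodType F) (f : {linear V -> W})
    (P : V -> Prop) (Q : W -> Prop) :
  (forall v, P v -> Q (f v)) -> forall v, lspan P v -> lspan Q (f v).
Proof.
move=> PQ v [s [Ps ->]]; exists [seq (p.1, f p.2) | p <- s]; split.
  by move=> _ /mapP[p /Ps ? ->]; apply: PQ.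
by rewrite big_map linear_sum; apply: eq_bigr => p _; rewrite linearZ.
Qed.

(* V / span(P); ring_quotient only provides the zmodType structure. *)
Section QuotientModule.
Variables (F : fieldType) (V : lmodType F) (P : V -> Prop).

Definition quot_span : Type := {ideal_quot (span_pred P)}.
HB.instance Definition _ := GRing.Zmodule.on quot_span.

Definition quot_pi (v : V) : quot_span := \pi_{ideal_quot (span_pred P)} v.
Definition quot_repr (x : quot_span) : V :=
  repr (x : {ideal_quot (span_pred P)}).

Lemma quot_reprK : cancel quot_repr quot_pi.
Proof. exact: reprK. Qed.

Lemma quot_piP u v : quot_pi u = quot_pi v <-> lspan P (u - v).
Proof.
have H : (quot_pi u == quot_pi v) = `[< lspan P (u - v) >].
  by rewrite -span_predE Quotient.idealrBE.
split=> [uv|uv]; first by apply/asboolP; rewrite -H uv.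
by apply/eqP; rewrite H; apply/asboolP.
Qed.

Fact quot_pi_zmod : zmod_morphism quot_pi.
Proof. by move=> u v; rewrite /quot_pi raddfB. Qed.
HB.instance Definition _ :=
  GRing.isZmodMorphism.Build V quot_span quot_pi quot_pi_zmod.

Definition quot_scale (c : F) (x : quot_span) : quot_span :=
  quot_pi (c *: quot_repr x).

Lemma quot_scale_pi c v : quot_scale c (quot_pi v) = quot_pi (c *: v).
Proof.
by apply/quot_piP; rewrite -scalerBr; apply/lspanZ/quot_piP; rewrite quot_reprK.
Qed.

Fact quot_scaleA a b x : quot_scale a (quot_scale b x) = quot_scale (a * b) x.
Proof. by rewrite -[x]quot_reprK !quot_scale_pi scalerA. Qed.

Fact quot_scale1 : left_id 1 quot_scale.
Proof. by move=> x; rewrite -[x]quot_reprK quot_scale_pi scale1r. Qed.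

Fact quot_scaleDr : right_distributive quot_scale +%R.
Proof.
move=> c x y; rewrite -[x]quot_reprK -[y]quot_reprK.
by rewrite -raddfD !quot_scale_pi -raddfD scalerDr.
Qed.

Fact quot_scaleDl x : {morph quot_scale^~ x : a b / a + b}.
Proof.
by move=> a b; rewrite -[x]quot_reprK !quot_scale_pi -raddfD scalerDl.
Qed.

HB.instance Definition _ := GRing.Zmodule_isLmodule.Build F quot_span
  quot_scaleA quot_scale1 quot_scaleDr quot_scaleDl.

Fact quot_pi_scalable : scalable quot_pi.
Proof. by move=> c v; rewrite -quot_scale_pi. Qed.
HB.instance Definition _ :=
  GRing.isScalable.Build F V quot_span *:%R quot_pi quot_pi_scalable.

End QuotientModule.

(* Z/2-grading: homog i x says that x is homogeneous of parity i (true = odd). *)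
Record superBracket (F : fieldType) (L : lmodType F) := SuperBracket {
  lie : L -> L -> L;
  homog : bool -> L -> Prop
}.

Section Superalgebra.
Variables (F : fieldType) (L : lmodType F) (S : superBracket L).
Local Notation br := (lie S).

Record lie_superalgebra : Prop := LieSuperalgebra {
  hom0 : forall i, homog S i 0;
  homP : forall i c x y, homog S i x -> homog S i y -> homog S i (c *: x + y);
  hom_sum : forall x, exists x0 x1, [/\ homog S false x0, homog S true x1 & x = x0 + x1];
  hom_direct : forall x, homog S false x -> homog S true x -> x = 0;
  lie_linearl : forall c x y z, br (c *: x + y) z = c *: br x z + br y z;
  lie_linearr : forall c x y z, br z (c *: x + y) = c *: br z x + br z y;
  lie_hom : forall i j x y,
    homog S i x -> homog S j y -> homog S (i (+) j) (br x y);
  lie_skew : forall i j x y, homog S i x -> homog S j y ->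
    br x y = - ((-1) ^+ (i && j) *: br y x);
  lie_jacobi : forall i j x y z, homog S i x -> homog S j y ->
    br x (br y z) = br (br x y) z + (-1) ^+ (i && j) *: br y (br x z)
}.

Record invariant_form (form : L -> L -> F) : Prop := InvariantForm {
  form_linearl : forall c x y z, form (c *: x + y) z = c * form x z + form y z;
  form_linearr : forall c x y z, form z (c *: x + y) = c * form z x + form z y;
  form_even : forall i j x y, homog S i x -> homog S j y -> i != j -> form x y = 0;
  form_supersym : forall i j x y, homog S i x -> homog S j y ->
    form x y = (-1) ^+ (i && j) * form y x;
  form_invariant : forall x y z, form (br x y) z = form x (br y z);
  form_nondegenerate : forall x, (forall y, form x y = 0) -> x = 0
}.

End Superalgebra.

Section GeneralLinear.
Variable F : fieldType.

Definition idx_parity m n (i : 'I_(m + n)) : bool := (m <= i)%N.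

Definition mx_part m n (c : bool) (X : 'M[F]_(m + n)) : 'M[F]_(m + n) :=
  \matrix_(i, j) (X i j *+ (idx_parity i (+) idx_parity j == c)).

Definition gl_hom m n (c : bool) (X : 'M[F]_(m + n)) : Prop := mx_part c X = X.

Definition gl_lie m n (X Y : 'M[F]_(m + n)) : 'M[F]_(m + n) :=
  \sum_(a : bool) \sum_(b : bool)
    (mx_part a X *m mx_part b Y
       - (-1) ^+ (a && b) *: (mx_part b Y *m mx_part a X)).

Definition gl m n : superBracket 'M[F]_(m + n) :=
  SuperBracket (@gl_lie m n) (@gl_hom m n).

Definition supertrace m n (X : 'M[F]_(m + n)) : F :=
  \sum_i (-1) ^+ idx_parity i * X i i.

(* Gram matrix of the even supersymmetric form defining osp(m,2k): the identity
   on the even part, the standard symplectic matrix on the odd part. *)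
Definition osp_gram m k : 'M[F]_(m + (k + k)) :=
  block_mx 1%:M 0 0 (block_mx 0 1%:M (- 1%:M) 0).

(* (X e_i, e_j) + (-1)^(c |e_i|) (e_i, X e_j) = 0 for the part X of parity c. *)
Definition in_osp m k (X : 'M[F]_(m + (k + k))) : Prop :=
  forall c i j,
    ((mx_part c X)^T *m osp_gram m k) i j
      + (-1) ^+ (c && idx_parity i) * (osp_gram m k *m mx_part c X) i j = 0.

End GeneralLinear.

Section Isomorphism.
Variables (F : fieldType) (L L' : lmodType F).

(* S is isomorphic to the subalgebra of T with underlying set P *)
Definition iso_subalgebra (S : superBracket L) (T : superBracket L')
    (P : L' -> Prop) : Prop :=
  exists phi : {linear L -> L'},
    [/\ injective phi,
        forall y, P y <-> exists x, phi x = y,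
        forall x y, phi (lie S x y) = lie T (phi x) (phi y) &
        forall i x, homog S i x <-> homog T i (phi x)].

End Isomorphism.

Section FiniteDimensional.
Variables (F : fieldType) (g : vectType F) (S : superBracket g).
Local Notation br := (lie S).

Definition lie_subalgebra (V : {vspace g}) : Prop :=
  {in V &, forall x y, br x y \in V}.

Definition lie_ideal (V : {vspace g}) : Prop :=
  forall x y, y \in V -> br x y \in V /\ br y x \in V.

(* Kac's contragredient Lie superalgebra G(A, tau) for an invertible Cartan
   matrix A, tau = set of odd simple roots: generated by Chevalley generators
   and without nonzero ideal meeting the span of the h_i trivially. *)
Definition contragredient r (A : 'M[F]_r) (tau : pred 'I_r) : Prop :=
  exists e f h : 'I_r -> g,
  [/\ [/\ forall i, homog S (tau i) (e i), forall i, homog S (tau i) (f i),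
          forall i, homog S false (h i) & free [seq h i | i <- enum 'I_r]],
      [/\ forall i j, br (h i) (h j) = 0,
          forall i j, br (e i) (f j) = (if i == j then h i else 0),
          forall i j, br (h i) (e j) = A i j *: e j &
          forall i j, br (h i) (f j) = - (A i j *: f j)],
      forall V, lie_subalgebra V ->
        (forall i, [/\ e i \in V, f i \in V & h i \in V]) -> V = fullv &
      forall I, lie_ideal I ->
        (I :&: <<[seq h i | i <- enum 'I_r]>>)%VS = 0%VS -> I = 0%VS].

Definition seq_mx r (s : seq (seq F)) : 'M[F]_r :=
  \matrix_(i, j) nth 0 (nth [::] s i) j.

Definition cartan_D21 (a : F) : 'M[F]_3 := seq_mx 3
  [:: [:: 0; 1; a]; [:: -1; 2%:R; 0]; [:: -1; 0; 2%:R]].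

Definition cartan_G3 : 'M[F]_3 := seq_mx 3
  [:: [:: 0; 1; 0]; [:: -1; 2%:R; - 3%:R]; [:: 0; -1; 2%:R]].

Definition cartan_F4 : 'M[F]_4 := seq_mx 4
  [:: [:: 0; 1; 0; 0]; [:: -1; 2%:R; - 2%:R; 0];
      [:: 0; -1; 2%:R; -1]; [:: 0; 0; -1; 2%:R]].

(* Apart from m != n for sl, the numerical conditions only exclude the zero
   algebra: m = 0 or n = 0 is allowed. *)
Inductive listed : Prop :=
| Listed_gl m n of (0 < m + n)%N &
    iso_subalgebra S (gl F m n) (fun _ => True)
| Listed_sl m n of m != n & (1 < m + n)%N &
    iso_subalgebra S (gl F m n) (fun X => supertrace X = 0)
| Listed_osp m k of (1 < m + (k + k))%N &
    iso_subalgebra S (gl F m (k + k)) (@in_osp F m k)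
| Listed_D21 a of a != 0 & a != -1 &
    contragredient (cartan_D21 a) (fun i => i == 0%N :> nat)
| Listed_G3 of contragredient cartan_G3 (fun i => i == 0%N :> nat)
| Listed_F4 of contragredient cartan_F4 (fun i => i == 0%N :> nat).

Definition cartan_subalgebra (h : {vspace g}) : Prop :=
  [/\ forall x, x \in h -> homog S false x,
      lie_subalgebra h,
      exists n, forall (s : n.-tuple g) y,
        {subset s <= h} -> y \in h -> foldr (lie S) y s = 0 &
      forall x, homog S false x ->
        (forall y, y \in h -> br x y \in h) -> x \in h].

Variable h : {vspace g}.

Definition hdual := 'Hom(subvs_of h, F^o).

Definition root_space (alpha : hdual) (x : g) : Prop :=
  forall eta : subvs_of h, br (vsval eta) x = (alpha eta : F) *: x.

Definition is_root (alpha : hdual) : Prop :=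
  alpha != 0 /\ exists2 x, x != 0 & root_space alpha x.

(* The sum of h and the root spaces is direct because h is the zero weight
   space. *)
Definition root_decomposition : Prop :=
  (forall x, x \in h <-> root_space 0 x) /\
  forall x, exists (x0 : g) (D : seq hdual) (xs : hdual -> g),
    [/\ x0 \in h,
        forall alpha, alpha \in D -> is_root alpha /\ root_space alpha (xs alpha) &
        x = x0 + \sum_(alpha <- D) xs alpha].

Definition is_base (Sigma : seq hdual) : Prop :=
  [/\ free Sigma,
      forall alpha, alpha \in Sigma -> is_root alpha &
      exists x y : hdual -> g,
      [/\ forall alpha, alpha \in Sigma ->
            root_space alpha (x alpha) /\ root_space (- alpha) (y alpha),
          forall V, lie_subalgebra V -> (h <= V)%VS ->
            (forall alpha, alpha \in Sigma -> x alpha \in V /\ y alpha \in V) ->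
            V = fullv &
          forall alpha beta, alpha \in Sigma -> beta \in Sigma ->
            alpha != beta -> br (x alpha) (y beta) = 0]].

Definition positive_root (Sigma : seq hdual) (alpha : hdual) : Prop :=
  is_root alpha /\
  exists c : 'I_(size Sigma) -> nat, alpha = \sum_(i < size Sigma) Sigma`_i *+ c i.

End FiniteDimensional.

(* g (x) F[t, t^-1]: the element x (x) t^n is << x *g n >>. *)
Definition loop (F : fieldType) (g : lmodType F) : Type := {malg g[int]}.

Section LoopModule.
Variables (F : fieldType) (g : lmodType F).

HB.instance Definition _ := GRing.Zmodule.on (loop g).

Implicit Types (u v : loop g).

Definition loop_scale (c : F) u : loop g :=
  \sum_(k <- msupp u) << c *: u@_k *g k >>.

Lemma loop_scaleE c u k : (loop_scale c u)@_k = c *: u@_k.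
Proof.
rewrite /loop_scale raddf_sum /=; have [ku|ku] := boolP (k \in msupp u).
  rewrite (bigD1_seq k) ?fset_uniq //= mcoeffUU big1 ?addr0 // => i /negPf ik.
  by rewrite mcoeffU ik.
rewrite (mcoeff_outdom ku) scaler0 big_seq big1 // => i iu.
by rewrite mcoeffU; case: eqP => // ik; rewrite ik (negPf ku) in iu.
Qed.

Fact loop_scaleA a b u : loop_scale a (loop_scale b u) = loop_scale (a * b) u.
Proof. by apply/malgP => k; rewrite !loop_scaleE scalerA. Qed.

Fact loop_scale1 : left_id 1 loop_scale.
Proof. by move=> u; apply/malgP => k; rewrite loop_scaleE scale1r. Qed.

Fact loop_scaleDr : right_distributive loop_scale +%R.
Proof.
by move=> c u v; apply/malgP => k; rewrite !(loop_scaleE, mcoeffD) scalerDr.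
Qed.

Fact loop_scaleDl u : {morph loop_scale^~ u : a b / a + b}.
Proof.
by move=> a b; apply/malgP => k; rewrite !(loop_scaleE, mcoeffD) scalerDl.
Qed.

HB.instance Definition _ := GRing.Zmodule_isLmodule.Build F (loop g)
  loop_scaleA loop_scale1 loop_scaleDr loop_scaleDl.

End LoopModule.

(* (u, a, b) stands for u + a K + b d. *)
Definition affine (F : fieldType) (g : lmodType F) : Type :=
  (loop g * F^o * F^o)%type.
HB.instance Definition _ (F : fieldType) (g : lmodType F) :=
  GRing.Lmodule.on (affine g).

Section Affine.
Variables (F : fieldType) (g : vectType F) (S : superBracket g).
Variable form : g -> g -> F.
Implicit Types (u v : loop g) (X Y : affine g).

Definition loop_lie u v : loop g :=
  \sum_(i <- msupp u) \sum_(j <- msupp v) << lie S u@_i v@_j *g (i + j) >>.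

Definition loop_cocycle u v : F :=
  \sum_(i <- msupp u) i%:~R * form u@_i v@_(- i).

Definition loop_degree u : loop g :=
  \sum_(i <- msupp u) << i%:~R *: u@_i *g i >>.

Definition loop_part X : loop g := X.1.1.
Definition K_coef X : F := X.1.2.
Definition d_coef X : F := X.2.

(* [d, x(m)] = - m x(m) *)
Definition affine_lie X Y : affine g :=
  (loop_lie (loop_part X) (loop_part Y)
     - d_coef X *: loop_degree (loop_part Y)
     + d_coef Y *: loop_degree (loop_part X),
   loop_cocycle (loop_part X) (loop_part Y), 0).

Definition affine_hom (i : bool) X : Prop :=
  (forall k, homog S i (loop_part X)@_k) /\ (i -> K_coef X = 0 /\ d_coef X = 0).

Definition affine_superalgebra : superBracket (affine g) :=
  SuperBracket affine_lie affine_hom.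

(* x(n) = x (x) t^n *)
Definition in_loop (x : g) (n : int) : affine g := ((<< x *g n >> : loop g), 0, 0).

Definition affine_K : affine g := (0, 1, 0).
Definition affine_d : affine g := (0, 0, 1).

Lemma loop_lieU (LS : lie_superalgebra S) x y m n :
  loop_lie << x *g m >> << y *g n >> = << lie S x y *g (m + n) >>.
Proof.
have l0 z : lie S 0 z = 0.
  by have := lie_linearl LS (-1) z z z; rewrite scaleN1r addNr scaleN1r addNr.
have r0 z : lie S z 0 = 0.
  by have := lie_linearr LS (-1) z z z; rewrite scaleN1r addNr scaleN1r addNr.
rewrite /loop_lie !msuppU; case: eqP => [->|_].
  by rewrite big_seq_fset0 l0 monalgU0.
rewrite big_seq_fset1 mcoeffUU; case: eqP => [->|_].
  by rewrite big_seq_fset0 r0 monalgU0.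
by rewrite big_seq_fset1 mcoeffUU.
Qed.

Lemma loop_cocycleU (Sf : invariant_form S form) x y m n :
  loop_cocycle << x *g m >> << y *g n >>
    = (if m == - n then m%:~R * form x y else 0).
Proof.
have l0 z : form 0 z = 0.
  by have := form_linearl Sf (-1) z z z; rewrite scaleN1r addNr mulN1r addNr.
have r0 z : form z 0 = 0.
  by have := form_linearr Sf (-1) z z z; rewrite scaleN1r addNr mulN1r addNr.
rewrite /loop_cocycle msuppU; case: eqP => [->|_].
  by rewrite big_seq_fset0 l0 mulr0 if_same.
rewrite big_seq_fset1 mcoeffUU mcoeffU -eqr_oppLR eq_sym.
by case: eqP => _ /=; rewrite ?mulr1n // mulr0n r0 mulr0.
Qed.

Lemma loop_degreeU x m : loop_degree << x *g m >> = << m%:~R *: x *g m >>.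
Proof.
rewrite /loop_degree msuppU; case: eqP => [->|_].
  by rewrite big_seq_fset0 scaler0 monalgU0.
by rewrite big_seq_fset1 mcoeffUU.
Qed.

(* [x(m), y(n)] = [x, y](m + n) + m delta_{m,-n} (x | y) K *)
Lemma affine_lie_loop (LS : lie_superalgebra S) (Sf : invariant_form S form)
    x y m n :
  affine_lie (in_loop x m) (in_loop y n)
    = in_loop (lie S x y) (m + n)
      + (if m == - n then m%:~R * form x y else 0) *: affine_K.
Proof.
rewrite /affine_lie /loop_part /d_coef /= !scale0r subr0 addr0.
rewrite loop_lieU // loop_cocycleU //.
by congr (_, _, _); rewrite /= ?scaler0 ?addr0 // add0r [RHS]mulr1.
Qed.

Lemma affine_lie_d x m :
  affine_lie affine_d (in_loop x m) = in_loop (- (m%:~R *: x)) m.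
Proof.
rewrite /affine_lie /loop_part /d_coef /= scale1r scale0r addr0.
rewrite loop_degreeU /loop_lie /loop_cocycle msupp0 !big_seq_fset0 sub0r.
by rewrite -monalgUN.
Qed.

Variable h : {vspace g}.

Definition affine_cartan : Type := (subvs_of h * F^o * F^o)%type.
HB.instance Definition _ := Vector.on affine_cartan.

Definition cartan_incl (eta : affine_cartan) : affine g :=
  let: (x, a, b) := eta in ((<< vsval x *g 0 >> : loop g), a, b).

Definition cartan_K : affine_cartan := (0, 1, 0).

(* The root alpha + n delta is represented by the pair (alpha, n). *)
Definition affine_root_space (gamma : hdual h * int) (X : affine g) : Prop :=
  exists2 x, (if gamma.1 == 0 then (x \in h : Prop) else root_space S gamma.1 x) &
             X = in_loop x gamma.2.

(* P(Sigma, {}) *)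
Definition natural_partition (Sigma : seq (hdual h)) (gamma : hdual h * int) : Prop :=
  positive_root S Sigma gamma.1 \/ (gamma.1 = 0 /\ (0 < gamma.2)%R).

Definition affine_nplus (Sigma : seq (hdual h)) : affine g -> Prop :=
  lspan (fun X => exists2 gamma,
           natural_partition Sigma gamma & affine_root_space gamma X).

(* Graph of the character of the Borel subalgebra H + N^+ that is lambda on H
   and 0 on N^+. *)
Definition borel_character (Sigma : seq (hdual h))
    (lambda : 'Hom(affine_cartan, F^o)) (b : affine g) (c : F) : Prop :=
  exists (eta : affine_cartan) (n : affine g),
    [/\ affine_nplus Sigma n, b = cartan_incl eta + n & c = lambda eta].

End Affine.

Section Enveloping.
Variables (F : fieldType) (L : lmodType F) (S : superBracket L).

Definition free_algebra : Type := {malg F[{fmonom L}]}.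
HB.instance Definition _ := GRing.Lalgebra.on free_algebra.

Fact free_algebra_scaleAr (c : F) (a b : free_algebra) :
  c *: (a * b) = a * (c *: b).
Proof.
have Cc (u : {malg F[{fmonom L}]}) : u * c%:MP = c%:MP * u.
  apply/malgP => k; rewrite [u * _](fgmulgU c mone u) [_ * u](fgmulUg c mone u).
  by rewrite !raddf_sum; apply: eq_bigr => k' _; rewrite mulrC mul1m mulm1.
change (c *: ((a : {malg F[{fmonom L}]}) * b)
        = (a : {malg F[{fmonom L}]}) * (c *: (b : {malg F[{fmonom L}]}))).
by rewrite -!mul_malgC !mulrA Cc.
Qed.
HB.instance Definition _ :=
  GRing.Lalgebra_isAlgebra.Build F free_algebra free_algebra_scaleAr.

Definition free_gen (x : L) : free_algebra := << fmu x >>.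

Inductive enveloping_relation : free_algebra -> Prop :=
| Env_linear c x y : enveloping_relation
    (free_gen (c *: x + y) - (c *: free_gen x + free_gen y))
| Env_lie i j x y of homog S i x & homog S j y : enveloping_relation
    (free_gen x * free_gen y - (-1) ^+ (i && j) *: (free_gen y * free_gen x)
     - free_gen (lie S x y)).

(* The two-sided ideal generated by the relations is the span of these. *)
Definition enveloping_ideal (a : free_algebra) : Prop :=
  exists b r c, enveloping_relation r /\ a = b * r * c.

Definition enveloping : Type := quot_span enveloping_ideal.
HB.instance Definition _ := GRing.Lmodule.on enveloping.

Definition env_pi (a : free_algebra) : enveloping :=
  quot_pi enveloping_ideal a.

Fact env_pi_zmod : zmod_morphism env_pi.
Proof. exact: quot_pi_zmod. Qed.
HB.instance Definition _ :=
  GRing.isZmodMorphism.Build free_algebra enveloping env_pi env_pi_zmod.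

Fact env_pi_scalable : scalable env_pi.
Proof. exact: quot_pi_scalable. Qed.
HB.instance Definition _ :=
  GRing.isScalable.Build F free_algebra enveloping *:%R env_pi env_pi_scalable.

Definition env_one : enveloping := env_pi 1.
Definition env_mul (u v : enveloping) : enveloping :=
  env_pi (quot_repr u * quot_repr v).

Lemma env_pi_mul a b : env_mul (env_pi a) (env_pi b) = env_pi (a * b).
Proof.
set a' := quot_repr (env_pi a); set b' := quot_repr (env_pi b).
have aa' : lspan enveloping_ideal (a' - a).
  by apply/quot_piP; apply: quot_reprK.
have bb' : lspan enveloping_ideal (b' - b).
  by apply/quot_piP; apply: quot_reprK.
apply/quot_piP; rewrite -/a' -/b'.
have -> : a' * b' - a * b = (a' - a) * b' + a * (b' - b).
  by rewrite mulrBl mulrBr addrA subrK.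
apply: lspanD.
  move: aa' => [s [Ps ->]]; exists [seq (p.1, p.2 * b') | p <- s]; split.
    move=> _ /mapP[p /Ps [c [r [d [rr ->]]]] ->].
    by exists c, r, (d * b'); rewrite mulrA.
  by rewrite big_map mulr_suml; apply: eq_bigr => p _; rewrite scalerAl.
move: bb' => [s [Ps ->]]; exists [seq (p.1, a * p.2) | p <- s]; split.
  move=> _ /mapP[p /Ps [c [r [d [rr ->]]]] ->].
  by exists (a * c), r, d; rewrite !mulrA.
by rewrite big_map mulr_sumr; apply: eq_bigr => p _; rewrite scalerAr.
Qed.

Lemma env_pi_surj u : exists a, u = env_pi a.
Proof. by exists (quot_repr u); rewrite [RHS]quot_reprK. Qed.

Fact env_mulA : associative env_mul.
Proof.
move=> u v w; have [[[a ->] [b ->]] [c ->]] :=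
  (env_pi_surj u, env_pi_surj v, env_pi_surj w).
by rewrite !env_pi_mul mulrA.
Qed.

Fact env_mul1l : left_id env_one env_mul.
Proof. by move=> u; have [a ->] := env_pi_surj u; rewrite env_pi_mul mul1r. Qed.

Fact env_mul1r : right_id env_one env_mul.
Proof. by move=> u; have [a ->] := env_pi_surj u; rewrite env_pi_mul mulr1. Qed.

Fact env_mulDl : left_distributive env_mul +%R.
Proof.
move=> u v w; have [[[a ->] [b ->]] [c ->]] :=
  (env_pi_surj u, env_pi_surj v, env_pi_surj w).
by rewrite -raddfD !env_pi_mul -raddfD mulrDl.
Qed.

Fact env_mulDr : right_distributive env_mul +%R.
Proof.
move=> u v w; have [[[a ->] [b ->]] [c ->]] :=
  (env_pi_surj u, env_pi_surj v, env_pi_surj w).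
by rewrite -raddfD !env_pi_mul -raddfD mulrDr.
Qed.

HB.instance Definition _ := GRing.Zmodule_isPzRing.Build enveloping
  env_mulA env_mul1l env_mul1r env_mulDl env_mulDr.

Lemma env_piM a b : env_pi (a * b) = env_pi a * env_pi b.
Proof. by rewrite -env_pi_mul. Qed.

Lemma env_piZ c a : c *: env_pi a = env_pi (c *: a).
Proof. by rewrite linearZ. Qed.

Lemma env_scaleAl (c : F) (u v : enveloping) : c *: (u * v) = (c *: u) * v.
Proof.
have [[a ->] [b ->]] := (env_pi_surj u, env_pi_surj v).
by rewrite -env_piM !env_piZ -env_piM scalerAl.
Qed.

Lemma env_scaleAr (c : F) (u v : enveloping) : c *: (u * v) = u * (c *: v).
Proof.
have [[a ->] [b ->]] := (env_pi_surj u, env_pi_surj v).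
by rewrite -env_piM !env_piZ -env_piM scalerAr.
Qed.

Definition env_gen (x : L) : enveloping := env_pi (free_gen x).

Inductive env_monomial : bool -> enveloping -> Prop :=
| Env_monomial1 : env_monomial false 1
| Env_monomialM i j x u of homog S i x & env_monomial j u :
    env_monomial (i (+) j) (env_gen x * u).

Definition env_hom (i : bool) : enveloping -> Prop := lspan (env_monomial i).

End Enveloping.

Record superModule (F : fieldType) (L M : lmodType F) := SuperModule {
  mact : L -> M -> M;
  mhomog : bool -> M -> Prop
}.

Section Simplicity.
Variables (F : fieldType) (L M : lmodType F) (T : superModule L M).

Definition submodule (N : M -> Prop) : Prop :=
  [/\ N 0,
      forall c x y, N x -> N y -> N (c *: x + y),
      forall a x, N x -> N (mact T a x) &
      forall x, N x -> exists x0 x1,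
        [/\ N x0, N x1, mhomog T false x0, mhomog T true x1 & x = x0 + x1]].

Definition simple_module : Prop :=
  (exists x : M, x != 0) /\
  forall N, submodule N -> (forall x, N x -> x = 0) \/ (forall x, N x).

End Simplicity.

Section Induced.
Variables (F : fieldType) (L : lmodType F) (S : superBracket L).
(* rho is the graph of the character of a subalgebra B: rho b c means that
   b is in B and acts on the (even) line F_rho by c. *)
Variable rho : L -> F -> Prop.

(* The relations of the tensor product over U(B) of U(L) and F_rho, with
   u (x) z in the tensor product over F identified with z *: u. *)
Definition induced_relation (w : enveloping S) : Prop :=
  exists u b c, rho b c /\ w = u * env_gen S b - c *: u.

Definition induced : Type := quot_span induced_relation.
HB.instance Definition _ := GRing.Lmodule.on induced.

Definition induced_pi (u : enveloping S) : induced :=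
  quot_pi induced_relation u.

Definition induced_act (x : L) (m : induced) : induced :=
  induced_pi (env_gen S x * quot_repr m).

Lemma induced_act_pi x u :
  induced_act x (induced_pi u) = induced_pi (env_gen S x * u).
Proof.
apply/quot_piP; rewrite -mulrBr.
have : lspan induced_relation (quot_repr (induced_pi u) - u).
  by apply/quot_piP; apply: quot_reprK.
move=> [s [Ps ->]]; exists [seq (p.1, env_gen S x * p.2) | p <- s]; split.
  move=> _ /mapP[p /Ps [v [b [c [bc ->]]]] ->].
  by exists (env_gen S x * v), b, c; rewrite mulrBr mulrA -env_scaleAr.
by rewrite big_map mulr_sumr; apply: eq_bigr => p _; rewrite env_scaleAr.
Qed.

Definition induced_hom (i : bool) (m : induced) : Prop :=
  exists2 u, env_hom i u & m = induced_pi u.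

Definition induced_module : superModule L induced :=
  SuperModule induced_act induced_hom.

End Induced.

Section Verma.
Variables (F : fieldType) (g : vectType F) (S : superBracket g).
Variables (form : g -> g -> F) (h : {vspace g}) (Sigma : seq (hdual h)).
Variable lambda : 'Hom(affine_cartan h, F^o).

Definition verma :
    superModule (affine g)
      (induced (affine_superalgebra S form) (borel_character S Sigma lambda)) :=
  induced_module (affine_superalgebra S form) (borel_character S Sigma lambda).

End Verma.

(* Main.v *)
Require Import Defs.
From HB Require Import structures.
From mathcomp Require Import all_boot all_order all_algebra.
From mathcomp Require Import complex reals.
From mathcomp Require Import finmap monalg boolp.
From mathcomp Require Import ring zify.

Set Implicit Arguments.
Unset Strict Implicit.
Unset Printing Implicit Defensive.

Import Order.TTheory GRing.Theory Num.Theory.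
Local Open Scope ring_scope.

(** A basis of [g] is chosen which consists of negative root vectors, of elements of [h]
    and of positive root vectors ([triangular_basis]). By the Poincare-Birkhoff-Witt
    theorem, sorted words [y_1 ... y_p h_1 ... h_q v] then form a basis of the Verma
    module, where the [y_i] are negative root vectors times powers of [t], the [h_j] are
    elements of [h] times negative powers of [t] (creation operators), and [v] is the
    vacuum vector. The words without any [y_i] span the Fock space of the Heisenberg
    algebra of loops in [h].

    If [lambda K] is zero, the Heisenberg algebra acts on the Fock space through
    commuting operators, and nothing can remove a creation operator from a word: the
    words with at least one creation operator span a proper nonzero submodule
    ([excited_submodule_act], [excited_submodule_vac]).

    If [lambda K] is not zero, every nonzero submodule contains [v]. Take a nonzero
    vector of it, in its expansion a word [y_1 ... y_p h_1 ... h_q v] with [p] maximal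
    and positive, and let [x] be dual to the root vector in [y_1]. The bracket of [x t^r]
    and [y_1] is a nonzero element of [h] times a power of [t]; for [r] negative enough it
    is a creation operator which occurs nowhere else, so that the coordinate of
    the transformed vector on [y_2 ... y_p] followed by this operator and the [h_j] is
    not zero ([lower_step]). As [x t^r] raises the height, a nonzero vector of the Fock
    space is reached ([fock_reach]). There the annihilation operators act as derivations,
    scaled by [lambda K], and lead to the vacuum vector ([vac_reach]).

    The linear independence of sorted words is proved in dual form: a linear form on
    words in letters, with prescribed values on sorted words, is defined by exchanging
    the first two letters in the wrong order, and the diamond lemma shows that it
    respects all relations ([pbw_form_exists]); hence it descends to the induced module
    ([induced_form_exists]).

    The basis of [g] is extracted from the iterated brackets of the root vectors attached
    to the base, which span [g] together with [h] ([triangular_span]). It has to be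
    homogeneous for the parity, so that no root space may contain both even and odd
    vectors ([no_mixed]). This follows from root strings and from a property of the
    listed superalgebras: unless the odd part is zero, a central element which is the
    commutator of two even elements is zero ([listed_commutator_center]). *)

(** * Linear functionals on words in a basis of a Lie superalgebra *)

Definition linear_form (F : fieldType) (L : lmodType F) (T : L -> F) : Prop :=
  forall c u v, T (c *: u + v) = c * T u + T v.

(** A homogeneous basis [e] of [L], given by its universal property: [ext phi] is
    the linear form with prescribed values [phi] on the letters. This form of the
    data suits an infinite-dimensional [L], where coordinates would have to
    carry their finite supports. *)
Record letter_basis (F : fieldType) (L : lmodType F) (S : superBracket L)
    (I : Type) (e : I -> L) (par : I -> bool) (ext : (I -> F) -> L -> F) : Prop :=
  LetterBasis {
    letter_homog : forall k, homog S (par k) (e k);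
    ext_linear : forall phi, linear_form (ext phi);
    ext_letter : forall phi k, ext phi (e k) = phi k;
    ext_span : forall T, linear_form T -> forall u, ext (fun k => T (e k)) u = T u;
    ext_parity : forall i u phi, homog S i u ->
      (forall k, par k = i -> phi k = 0) -> ext phi u = 0 }.

(** The axioms on letters: bilinearity extends them to all of [L]. *)
Record letter_bracket (F : fieldType) (L : lmodType F) (S : superBracket L)
    (I : Type) (e : I -> L) (par : I -> bool) : Prop :=
  LetterBracket {
    bracket_linearl : forall c x y z,
      lie S (c *: x + y) z = c *: lie S x z + lie S y z;
    bracket_linearr : forall c x y z,
      lie S z (c *: x + y) = c *: lie S z x + lie S z y;
    bracket_homog : forall x y,
      homog S (par x (+) par y) (lie S (e x) (e y));
    bracket_skew : forall x y,
      lie S (e x) (e y) = - ((-1) ^+ (par x && par y) *: lie S (e y) (e x));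
    bracket_jacobi : forall x y z,
      lie S (e x) (lie S (e y) (e z)) =
        lie S (lie S (e x) (e y)) (e z)
          + (-1) ^+ (par x && par y) *: lie S (e y) (lie S (e x) (e z)) }.

Section Letters.
Variables (F : fieldType) (L : lmodType F) (S : superBracket L).
Variables (I : Type) (e : I -> L) (par : I -> bool) (ext : (I -> F) -> L -> F).
Hypothesis lbP : letter_basis S e par ext.
Hypothesis brP : letter_bracket S e par.

Lemma linear_form0 (T : L -> F) : linear_form T -> T 0 = 0.
Proof. by move=> lT; have := lT (-1) 0 0; rewrite scaler0 addr0 mulN1r addNr. Qed.

Lemma linear_formZ (T : L -> F) c u : linear_form T -> T (c *: u) = c * T u.
Proof. by move=> lT; have := lT c u 0; rewrite addr0 (linear_form0 lT) addr0. Qed.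

Lemma linear_formD (T : L -> F) u v : linear_form T -> T (u + v) = T u + T v.
Proof. by move=> lT; have := lT 1 u v; rewrite scale1r mul1r. Qed.

Lemma linear_formN (T : L -> F) u : linear_form T -> T (- u) = - T u.
Proof. by move=> lT; rewrite -scaleN1r linear_formZ // mulN1r. Qed.

Lemma ext_sub c phi psi u :
  ext (fun k => phi k - c * psi k) u = ext phi u - c * ext psi u.
Proof.
rewrite -(ext_span lbP (T := fun v => ext phi v - c * ext psi v)).
  congr (ext _ u); apply/boolp.funext => k; by rewrite !(ext_letter lbP).
move=> d v w; rewrite !(ext_linear lbP); ring.
Qed.

Lemma ext_scale c phi u : ext (fun k => c * phi k) u = c * ext phi u.
Proof.
rewrite -(ext_span lbP (T := fun v => c * ext phi v)).
  by congr (ext _ u); apply/boolp.funext => k; rewrite (ext_letter lbP).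
by move=> d v w; rewrite (ext_linear lbP); ring.
Qed.

Lemma eq_ext_parity i u phi psi : homog S i u ->
  (forall k, par k = i -> phi k = psi k) -> ext phi u = ext psi u.
Proof.
move=> hu E; apply/eqP; rewrite -subr_eq0 -[ext psi u]mul1r -ext_sub.
by rewrite (ext_parity lbP hu) // => k /E->; rewrite mul1r subrr.
Qed.

(** Both sides are bilinear in [u] and [v]. *)
Lemma ext_exchange (g : I -> I -> F) u v :
  ext (fun k => ext (g k) u) v = ext (fun l => ext (fun k => g k l) v) u.
Proof.
rewrite -(ext_span lbP (T := fun v => ext (fun l => ext (fun k => g k l) v) u)).
  congr (ext _ v); apply/boolp.funext => k; congr (ext _ u).
  by apply/boolp.funext => l; rewrite (ext_letter lbP).
move=> c x y.
rewrite -[RHS](ext_span lbP (T := fun u => c * ext (fun l => ext (g^~ l) x) u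
   + ext (fun l => ext (g^~ l) y) u)); last first.
  by move=> d a b; rewrite !(ext_linear lbP); ring.
congr (ext _ u); apply/boolp.funext => k.
by rewrite !(ext_letter lbP) (ext_linear lbP).
Qed.

Local Notation sgn x y := ((-1) ^+ (par x && par y) : F).
Local Notation "[< x , y >]" := (lie S (e x) (e y)).

Implicit Types (a b : seq I) (tau : seq I -> F).

(** The value of [tau] on a word in which one letter is replaced by an arbitrary
    element of [L]. *)
Definition word_lin tau a b (u : L) : F := ext (fun k => tau (a ++ k :: b)) u.

(** The failure of [tau] to respect the commutation relation of [x] and [y]
    inside a word. *)
Definition defect tau a x y b : F :=
  tau (a ++ x :: y :: b) - sgn x y * tau (a ++ y :: x :: b)
    - word_lin tau a b [<x, y>].

Definition commutes_at tau n : Prop :=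
  forall a x y b, size (a ++ x :: y :: b) = n -> defect tau a x y b = 0.

Lemma word_lin_linear tau a b : linear_form (word_lin tau a b).
Proof. exact: ext_linear lbP _. Qed.

Lemma defect_skew tau a x y b :
  defect tau a y x b = - sgn x y * defect tau a x y b.
Proof.
rewrite /defect (bracket_skew brP x y) linear_formN ?linear_formZ;
  try exact: word_lin_linear.
rewrite andbC; case: (_ && _); rewrite ?expr1 ?expr0; ring.
Qed.

(** The exchange relation of two letters, made linear in one of them. *)
Lemma word_lin_swapr tau n a b q u z : commutes_at tau n ->
    size (a ++ z :: z :: b) = n -> homog S q u ->
  word_lin tau a (z :: b) u - (-1) ^+ (q && par z) * word_lin tau (rcons a z) b u
    = word_lin tau a b (lie S u (e z)).
Proof.
move=> tauP sz hu.
rewrite -[RHS](ext_span lbP (T := fun u => word_lin tau a b (lie S u (e z)))).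
  rewrite -ext_sub; apply: eq_ext_parity hu _ => k pk.
  have := tauP a k z b; rewrite /defect pk cat_rcons => /(_ _)/eqP.
  by rewrite subr_eq0 => /(_ _)/eqP; apply; rewrite -sz !size_cat.
by move=> c v w; rewrite (bracket_linearl brP) word_lin_linear.
Qed.

Lemma word_lin_swapl tau n a b q u z : commutes_at tau n ->
    size (a ++ z :: z :: b) = n -> homog S q u ->
  word_lin tau (rcons a z) b u - (-1) ^+ (par z && q) * word_lin tau a (z :: b) u
    = word_lin tau a b (lie S (e z) u).
Proof.
move=> tauP sz hu.
rewrite -[RHS](ext_span lbP (T := fun u => word_lin tau a b (lie S (e z) u))).
  rewrite -ext_sub; apply: eq_ext_parity hu _ => k pk.
  have := tauP a z k b; rewrite /defect pk cat_rcons => /(_ _)/eqP.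
  by rewrite subr_eq0 => /(_ _)/eqP; apply; rewrite -sz !size_cat.
by move=> c v w; rewrite (bracket_linearr brP) word_lin_linear.
Qed.

(** Two ways of reversing [x y z] by adjacent exchanges; the bracket terms cancel
    by the Jacobi identity, once shorter words respect the relations. *)
Lemma defect_braid tau a x y z b :
    commutes_at tau (size a + size b + 2) ->
  defect tau a x y (z :: b) + sgn x y * defect tau (rcons a y) x z b
    + sgn x y * sgn x z * defect tau a y z (x :: b)
  = defect tau (rcons a x) y z b + sgn y z * defect tau a x z (y :: b)
    + sgn y z * sgn x z * defect tau (rcons a z) x y b.
Proof.
move=> tauP.
have sz k : size (a ++ k :: k :: b) = (size a + size b + 2)%N.
  by rewrite size_cat /= !addnS addn0.
have := word_lin_swapr tauP (sz z) (bracket_homog brP x y).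
have := word_lin_swapl tauP (sz y) (bracket_homog brP x z).
have := word_lin_swapl tauP (sz x) (bracket_homog brP y z).
rewrite (bracket_jacobi brP) (linear_formD _ _ (word_lin_linear tau a b)).
rewrite (linear_formZ _ _ (word_lin_linear tau a b)).
move=> E1 E2 E3; move: E1; rewrite -E2 -E3 /defect !cat_rcons.
case: (par x); case: (par y); case: (par z); rewrite /= ?expr1 ?expr0 => E;
  move/eqP: E; rewrite -subr_eq0 => /eqP E; apply/eqP; rewrite -subr_eq0;
  apply/eqP; rewrite -[RHS]E; ring.
Qed.

(** Exchanges at two disjoint places commute, up to bracket terms which agree once
    shorter words respect the relations. *)
Lemma defect_far tau a u v c x y b :
    commutes_at tau (size a + size c + size b + 3) ->
  defect tau a u v (c ++ x :: y :: b)
    + sgn u v * defect tau (a ++ v :: u :: c) x y b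
  = defect tau (a ++ u :: v :: c) x y b
    + sgn x y * defect tau a u v (c ++ y :: x :: b).
Proof.
move=> tauP.
have E1 : word_lin tau a (c ++ x :: y :: b) [<u, v>]
    - sgn x y * word_lin tau a (c ++ y :: x :: b) [<u, v>]
  = ext (fun k => word_lin tau (a ++ k :: c) b [<x, y>]) [<u, v>].
  rewrite -ext_sub; congr (ext _ _); apply/boolp.funext => k; apply/eqP.
  rewrite -subr_eq0 -!cat_cons !catA.
  by apply/eqP; apply: tauP; rewrite !size_cat /= ?size_cat /=; lia.
have E2 : word_lin tau (a ++ u :: v :: c) b [<x, y>]
    - sgn u v * word_lin tau (a ++ v :: u :: c) b [<x, y>]
  = ext (fun l => word_lin tau a (c ++ l :: b) [<u, v>]) [<x, y>].
  rewrite -ext_sub; congr (ext _ _); apply/boolp.funext => k; apply/eqP.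
  rewrite -subr_eq0 -!catA !cat_cons.
  by apply/eqP; apply: tauP; rewrite !size_cat /= ?size_cat /=; lia.
have E3 : ext (fun k => word_lin tau (a ++ k :: c) b [<x, y>]) [<u, v>]
  = ext (fun l => word_lin tau a (c ++ l :: b) [<u, v>]) [<x, y>].
  rewrite /word_lin ext_exchange; congr (ext _ _); apply/boolp.funext => k.
  by congr (ext _ _); apply/boolp.funext => l; rewrite -catA cat_cons.
move: E3; rewrite -E1 -E2 /defect -!catA !cat_cons => E3.
move/eqP: E3; rewrite -subr_eq0 => /eqP E; apply/eqP; rewrite -subr_eq0.
by apply/eqP; rewrite -[RHS]oppr0 -[in RHS]E; ring.
Qed.

End Letters.

(** * The Poincare-Birkhoff-Witt theorem for a module induced from a character *)

(** The letters in [J] span a subalgebra [B] and [chi] is a character of it; they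
    come last in the order, so that the words without letter in [J] which
    are sorted index a basis of the induced module. *)
Record borel_letters (F : fieldType) (L : lmodType F) (S : superBracket L)
    (I : eqType) (e : I -> L) (par : I -> bool) (ext : (I -> F) -> L -> F)
    (lt : rel I) (J : pred I) (chi : I -> F) : Prop := BorelLetters {
  order_irr : irreflexive lt;
  order_trans : transitive lt;
  order_total : forall x y, x != y -> lt x y || lt y x;
  J_last : forall x y, J x -> ~~ J y -> lt y x;
  chi_bracket : forall x y phi, J x -> J y ->
    (exists c, forall k, J k -> phi k = chi k * c) ->
    ext phi (lie S (e x) (e y)) = 0;
  chi_even : forall x, J x -> par x -> chi x = 0 }.

Section Words.
Variables (I : eqType) (par : I -> bool) (lt : rel I) (J : pred I).

(** An adjacent pair which is not allowed in a sorted word: odd letters must not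
    be repeated, since the square of an odd element is half its bracket. *)
Definition bad x y := lt y x || ((x == y) && par x).

Definition normal (w : seq I) :=
  sorted (fun x y => ~~ bad x y) w && all (fun k => ~~ J k) w.

Fixpoint inversions (w : seq I) : nat :=
  if w is x :: w' then (count (lt^~ x) w' + inversions w')%N else 0%N.

Lemma inversions_swap a x y b : lt y x -> ~~ lt x y ->
  inversions (a ++ x :: y :: b) = (inversions (a ++ y :: x :: b)).+1.
Proof.
move=> yx xy; elim: a => [|z a IH] /=.
  by rewrite yx (negPf xy); lia.
by rewrite IH !count_cat /=; lia.
Qed.

(** [Some (a, x, y, b)] stands for the decomposition [a ++ x :: y :: b] of the word. *)
Fixpoint first_bad (w : seq I) : option (seq I * I * I * seq I) :=
  if w is x :: w' then
    if w' is y :: b then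
      if bad x y then Some ([::], x, y, b)
      else if first_bad w' is Some (a, u, v, c) then Some (x :: a, u, v, c)
      else None
    else None
  else None.

Lemma first_badP w : match first_bad w with
  | Some (a, x, y, b) => w = a ++ x :: y :: b /\ bad x y
  | None => sorted (fun x y => ~~ bad x y) w
  end.
Proof.
elim: w => //= x [|y b] //= IH; case: ifP => // xy.
move: IH; rewrite -/(first_bad (y :: b)).
by case: (first_bad _) => [[[[a u] v] c] [-> ?]|->].
Qed.

Lemma first_bad_cons x y b : first_bad (x :: y :: b) =
  if bad x y then Some ([::], x, y, b)
  else if first_bad (y :: b) is Some (a, u, v, c) then Some (x :: a, u, v, c)
  else None.
Proof. by []. Qed.

Lemma first_bad_cat a x y b : bad x y ->
  exists a' u v c, first_bad (a ++ x :: y :: b) = Some (a', u, v, c) /\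
    (size a' <= size a)%N.
Proof.
move=> xy; elim: a => [|z a [a' [u [v [c [E le]]]]]].
  by rewrite first_bad_cons xy; exists [::], x, y, b.
case D: (a ++ _) E => [|t s] E; first by case: (a) D.
rewrite cat_cons D first_bad_cons E; case: ifP => _; first by exists [::], z, t, s.
by exists (z :: a'), u, v, c.
Qed.

End Words.

Section Existence.
Variables (F : fieldType) (L : lmodType F) (S : superBracket L).
Variables (I : eqType) (e : I -> L) (par : I -> bool) (ext : (I -> F) -> L -> F).
Variables (lt : rel I) (J : pred I) (chi : I -> F).
Hypothesis lbP : letter_basis S e par ext.
Hypothesis brP : letter_bracket S e par.
Hypothesis boP : borel_letters S e par ext lt J chi.
Hypothesis char0 : forall n, n.+1%:R != 0 :> F.
Variable f : seq I -> F.

Local Notation sgn x y := ((-1) ^+ (par x && par y) : F).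
Local Notation "[< x , y >]" := (lie S (e x) (e y)).
Local Notation bad := (bad par lt).
Local Notation normal := (normal par lt J).
Local Notation first_bad := (first_bad par lt).
Local Notation inversions := (inversions lt).
Local Notation word_lin := (word_lin ext).
Local Notation defect := (defect S e par ext).
Local Notation commutes_at := (commutes_at S e par ext).

(** Evaluation of words of one length, from the evaluation [tau] of the words that
    are shorter by one: a final letter in [J] is evaluated by [chi], and
    otherwise the first bad pair is exchanged. *)
Fixpoint reduce (tau : seq I -> F) (fuel : nat) (w : seq I) : F :=
  if fuel is n.+1 then
    let step := if first_bad w is Some (a, x, y, b) then
        if x == y then 2%:R^-1 * word_lin tau a b [<x, y>]
        else sgn x y * reduce tau n (a ++ y :: x :: b) + word_lin tau a b [<x, y>]
      else f w in
    if rev w is k :: ra then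
      if J k then chi k * tau (rev ra) else step
    else step
  else 0.

Fixpoint pbw_form_at n (w : seq I) : F :=
  if n is m.+1 then reduce (pbw_form_at m) (inversions w).+1 w else f [::].

Definition pbw_form (w : seq I) : F := pbw_form_at (size w) w.

Lemma bad_trichotomy x y : [\/ lt x y, lt y x | x = y].
Proof.
have [->|xy] := eqVneq x y; first by constructor 3.
by have /orP[] := order_total boP xy; [constructor 1|constructor 2].
Qed.

Lemma lt_asym x y : lt x y -> ~~ lt y x.
Proof.
move=> xy; apply/negP => /(order_trans boP xy).
by rewrite (order_irr boP).
Qed.

Lemma badE x y : bad x y -> lt y x \/ (x = y /\ par x).
Proof. by case/orP=> [|/andP[/eqP]]; [left|right]. Qed.

Lemma pbw_form_rcons a k : J k -> pbw_form (rcons a k) = chi k * pbw_form a.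
Proof.
by move=> Jk; rewrite /pbw_form size_rcons /= rev_rcons Jk revK.
Qed.

Lemma pbw_form_lin n a b u : (size a + size b)%N = n ->
  word_lin (pbw_form_at n.+1) a b u = word_lin pbw_form a b u.
Proof.
move=> sz; congr (ext _ u); apply/boolp.funext => k.
by rewrite /pbw_form (_ : size _ = n.+1) // size_cat /= addnS sz.
Qed.

Lemma pbw_form_first_bad w a x y b : (forall k c, w = rcons c k -> ~~ J k) ->
    first_bad w = Some (a, x, y, b) ->
  pbw_form w = if x == y then 2%:R^-1 * word_lin pbw_form a b [<x, y>]
    else sgn x y * pbw_form (a ++ y :: x :: b) + word_lin pbw_form a b [<x, y>].
Proof.
move=> nJ E; have := first_badP par lt w; rewrite E => -[wE xy].
have szw : size w = (size a + size b)%N.+2 by rewrite wE size_cat /= !addnS.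
rewrite {1}/pbw_form szw.
case/lastP: w nJ E wE szw => [_ _|c k nJ E wE szw]; first by case: (a).
rewrite [LHS]/= rev_rcons (negPf (nJ k c erefl)) E.
case: eqP => [_|nxy]; first by rewrite -(pbw_form_lin _ (erefl (size a + size b)%N)).
rewrite -(pbw_form_lin _ (erefl (size a + size b)%N)).
congr (_ * _ + _); rewrite /pbw_form size_cat /= !addnS /=.
by case/badE: xy => [xy|[//]]; rewrite wE inversions_swap ?lt_asym.
Qed.

(** By construction; the relation of an odd letter with itself determines twice the
    value of the word, whence the factor 1/2 in [reduce]. *)
Lemma pbw_form_bad w a x y b : (forall k c, w = rcons c k -> ~~ J k) ->
  first_bad w = Some (a, x, y, b) -> defect pbw_form a x y b = 0.
Proof.
move=> nJ E; have := first_badP par lt w; rewrite E => -[wE xy].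
rewrite /defect -wE (pbw_form_first_bad nJ E); case: eqP => [exy|_]; last by ring.
subst y; case/badE: xy => [|[_ px]]; first by rewrite (order_irr boP).
rewrite px expr1 -wE (pbw_form_first_bad nJ E) eqxx.
rewrite -[X in _ - X](mulfVK (char0 1)); ring.
Qed.

Lemma pbw_form_normal w : normal w -> pbw_form w = f w.
Proof.
case/andP=> sw /allP nJ; case/lastP: w sw nJ => // w k sw nJ.
rewrite /pbw_form size_rcons /= rev_rcons (negPf (nJ k _)) ?mem_rcons ?mem_head //.
have := first_badP par lt (rcons w k); case: first_bad => // -[[[a x] y] b] [E xy].
by move: sw; rewrite E => /cat_sorted2[_] /=; rewrite xy.
Qed.

(** A word ending in [J] inherits the relations from the shorter word, except at
    its very end, where two letters in [J] commute up to the kernel of [chi]. *)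
Lemma pbw_form_J n a x y b : commutes_at pbw_form n ->
    size (a ++ x :: y :: b) = n.+1 -> J (last y b) -> (b = [::] -> J x) ->
  defect pbw_form a x y b = 0.
Proof.
move=> IH; case/lastP: b => [|b l] sz; rewrite ?last_rcons /= => Jl Jx.
  have {}Jx := Jx erefl.
  rewrite /defect -!cat_rcons !cats0 !pbw_form_rcons //.
  rewrite (_ : word_lin _ _ _ _ = 0) ?subr0.
    case: (boolP (par x && par y)) => [/andP[px py]|_]; last by rewrite expr0; ring.
    by rewrite !(chi_even boP) //; ring.
  apply: (chi_bracket boP) => //; exists (pbw_form a) => h Jh.
  by rewrite cats1 pbw_form_rcons.
have -> : defect pbw_form a x y (rcons b l) = chi l * defect pbw_form a x y b.
  rewrite /defect -!rcons_cons -!rcons_cat !pbw_form_rcons // !mulrBr.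
  congr (_ - _); first by rewrite mulrCA.
  rewrite /word_lin -(ext_scale lbP); congr (ext _ _); apply/boolp.funext => h.
  by rewrite -pbw_form_rcons // -rcons_cons -rcons_cat.
by rewrite IH ?mulr0 //; move: sz; rewrite !size_cat /= size_rcons; lia.
Qed.

Lemma double_eq0 (z : F) : z + z = 0 -> z = 0.
Proof. by rewrite -mulr2n -mulr_natl => /eqP; rewrite mulf_eq0 (negPf (char0 1)) => /eqP. Qed.

(** The diamond lemma. At the first bad pair of a word the relation holds by
    construction. Another bad pair is compared with the first one, by [defect_braid]
    when they overlap and by [defect_far] when they do not; the other words which appear
    have fewer inversions. *)
Lemma pbw_form_commutes n : commutes_at pbw_form n.
Proof.
elim/ltn_ind: n => n IHn.
(* It suffices to treat bad pairs, by induction on the number of inversions. *)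
suff D m a x y b : size (a ++ x :: y :: b) = n -> bad x y ->
    (inversions (a ++ x :: y :: b) < m)%N -> defect pbw_form a x y b = 0.
  move=> a x y b sz; have [xy|yx|exy] := bad_trichotomy x y; last subst y.
  - rewrite (defect_skew lbP brP) (D (inversions (a ++ y :: x :: b)).+1) ?mulr0 //; last by rewrite /bad xy.
    by rewrite -sz !size_cat.
  - by apply: (D (inversions (a ++ x :: y :: b)).+1) => //; rewrite /bad yx.
  have [px|/negPf px] := boolP (par x).
    by apply: (D (inversions (a ++ x :: x :: b)).+1) => //; rewrite /bad eqxx px orbT.
  apply: double_eq0; rewrite -{1}[defect _ _ _ _ _]opprK.
  by rewrite {1}(defect_skew lbP brP) px /= expr0; ring.
elim: m a x y b => // m IHm a x y b sz xy.
rewrite ltnS => le_m.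
have small a' u v b' : size (a' ++ u :: v :: b') = n -> bad u v ->
    (inversions (a' ++ u :: v :: b') < inversions (a ++ x :: y :: b))%N ->
    defect pbw_form a' u v b' = 0.
  by move=> sz' uv lt'; apply: IHm => //; apply: leq_trans lt' le_m.
have n2 : (1 < n)%N by rewrite -sz size_cat /=; lia.
have [Jl|nJl] := boolP (J (last y b)).
  apply: (pbw_form_J (n := n.-1)) => //; first by apply: IHn; lia.
    by rewrite sz; lia.
  case: b Jl sz {le_m small} => //= Jy _ _.
  case/badE: xy => [yx|[->//]].
  apply: contraT => nJx; have := J_last boP Jy nJx.
  by rewrite (negPf (lt_asym yx)).
have [a' [u [v [c [E le_a]]]]] := first_bad_cat a b xy.
have D0 : defect pbw_form a' u v c = 0.
  apply: pbw_form_bad E => k d wE; move: nJl.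
  have -> : last y b = last x (a ++ [:: x, y & b]) by rewrite last_cat.
  by rewrite wE last_rcons.
have := first_badP par lt (a ++ x :: y :: b); rewrite E => -[wE uv].
have aE : a = a' ++ drop (size a') a.
  rewrite -{1}(cat_take_drop (size a') a); congr (_ ++ _).
  by rewrite -(takel_cat (x :: y :: b) le_a) wE take_size_cat.
have dE : drop (size a') a ++ x :: y :: b = u :: v :: c.
  by apply/eqP; move/eqP: wE; rewrite {1}aE -catA eqseq_cat // eqxx.
(* The first bad pair [u v] is [x y], or is [u x], or ends before [x]. *)
move: aE dE; case: (drop _ a) => [|u' [|v' c']]; rewrite ?cats0 ?cats1.
- by move=> -> [-> -> ->].
- move=> aE [eu ev ec]; subst u' v c.
  rewrite aE cat_rcons in sz small *.
  have sz3 p q r : size (a' ++ [:: p, q, r & b]) = n by rewrite -sz !size_cat.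
  have sm1 p q r : bad p q ->
      (inversions (a' ++ [:: p, q, r & b]) < inversions (a' ++ [:: u, x, y & b]))%N ->
      defect pbw_form a' p q (r :: b) = 0 by apply: small.
  have sm2 p q r : bad q r ->
      (inversions (a' ++ [:: p, q, r & b]) < inversions (a' ++ [:: u, x, y & b]))%N ->
      defect pbw_form (rcons a' p) q r b = 0.
    by move=> qr lt_m; apply: small; rewrite ?cat_rcons.
  have := defect_braid lbP brP (tau := pbw_form) (a := a') u x y (b := b).
  rewrite D0 => /(_ (IHn _ _)); rewrite -sz size_cat /= => /(_ ltac:(lia)) B.
  have i1 p q r : lt q p -> inversions (a' ++ [:: p, q, r & b]) =
      (inversions (a' ++ [:: q, p, r & b])).+1.
    by move=> qp; apply: inversions_swap => //; apply: lt_asym.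
  have i2 p q r : lt r q -> inversions (a' ++ [:: p, q, r & b]) =
      (inversions (a' ++ [:: p, r, q & b])).+1.
    by move=> rq; rewrite -!(cat_rcons p); apply: inversions_swap => //; apply: lt_asym.
  have lb p q : lt q p -> bad p q by rewrite /bad => ->.
  case/badE: uv B => [xu|[eux pu]]; case/badE: (xy) => [yx|[exy px]].
  - have yu := order_trans boP yx xu.
    have [[[[j1 j2] j3] j4] j5] :=
      (i1 u x y xu, i2 x u y yu, i1 x y u yx, i2 u x y yx, i1 u y x yu).
    have j6 := i2 y u x xu.
    rewrite (sm2 x u y) ?(sm1 x y u) ?(sm1 u y x) ?(sm2 y u x) ?lb //; try lia.
    by rewrite !mulr0 !addr0.
  - subst y; have [j1 j2] := (i1 u x x xu, i2 x u x xu).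
    have bx : bad x x by rewrite /bad eqxx px orbT.
    rewrite (sm2 x u x) ?(sm1 x x u bx) ?lb //; try lia.
    by rewrite !mulr0 !addr0 D0 mulr0 !addr0.
  - subst u; have [j1 j2] := (i2 x x y yx, i1 x y x yx).
    have bx : bad x x by rewrite /bad eqxx pu orbT.
    rewrite (sm1 x y x) ?(sm2 y x x bx) ?lb //; try lia.
    rewrite pu expr1 !mulr0 !addr0 add0r mulN1r => B.
    by apply: double_eq0; rewrite -{1}B addNr.
  subst u y; rewrite D0 px expr1 => B.
  apply: (mulfI (char0 2)); rewrite mulr0.
  apply/eqP; rewrite -[X in _ == X](subrr (0 + -1 * defect pbw_form (rcons a' x) x x b
    + -1 * -1 * 0)) {1}B; apply/eqP; ring.
move=> aE [eu ev ec]; subst u' v' c.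
rewrite aE -catA !cat_cons in sz small *.
have := defect_far lbP (tau := pbw_form) (a := a') u v (c := c') x y (b := b).
rewrite D0 => /(_ (IHn _ _)); rewrite -sz !size_cat /= size_cat /= => /(_ ltac:(lia)).
have -> : sgn x y * defect pbw_form a' u v (c' ++ [:: y, x & b]) = 0.
  case/badE: (xy) => [yx|[exy _]]; last by subst y; rewrite D0 mulr0.
  rewrite small ?mulr0 //; first by rewrite -sz !size_cat /= !size_cat.
  by rewrite -!cat_cons !catA (inversions_swap _ _ yx (lt_asym yx)).
rewrite add0r addr0; case/badE: uv => [vu|[ <- pu]].
  rewrite small ?mulr0 //; rewrite -?catA ?cat_cons.
    by rewrite -sz !size_cat /= !size_cat.
  by rewrite (inversions_swap _ _ vu (lt_asym vu)).
by rewrite pu expr1 mulN1r => B; apply: double_eq0; rewrite -{1}B addNr.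
Qed.

(** Poincare-Birkhoff-Witt, in dual form: a form on words which respects the relations
    and the character will descend to the induced module, so that sorted words are
    linearly independent there. *)
Theorem pbw_form_exists : exists sigma : seq I -> F,
  [/\ forall a x y b, defect sigma a x y b = 0,
      forall a k, J k -> sigma (rcons a k) = chi k * sigma a &
      forall w, normal w -> sigma w = f w].
Proof.
exists pbw_form; split; first by move=> a x y b; apply: pbw_form_commutes.
  exact: pbw_form_rcons.
exact: pbw_form_normal.
Qed.

End Existence.

Section WordForms.
Variables (F : fieldType) (L : lmodType F) (S : superBracket L).
Variables (I : Type) (e : I -> L) (par : I -> bool) (ext : (I -> F) -> L -> F).
Hypothesis lbP : letter_basis S e par ext.
Hypothesis brP : letter_bracket S e par.

(** The multilinear extension of [sigma] to words in elements of [L]. *)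
Fixpoint word_form (sigma : seq I -> F) (s : seq L) : F :=
  if s is u :: s' then ext (fun k => word_form (fun w => sigma (k :: w)) s') u
  else sigma [::].

Implicit Types sigma : seq I -> F.

Lemma word_form_letters sigma w : word_form sigma (map e w) = sigma w.
Proof. by elim: w sigma => //= k w IH sigma; rewrite (ext_letter lbP) IH. Qed.

Lemma word_form_sub c sigma tau b :
  word_form (fun w => sigma w - c * tau w) b = word_form sigma b - c * word_form tau b.
Proof.
elim: b sigma tau => //= u b IH sigma tau; rewrite -(ext_sub lbP).
by congr (ext _ u); apply/boolp.funext => k; rewrite IH.
Qed.

Lemma word_form_ext (Q : I -> seq I -> F) u b :
  word_form (fun w => ext (fun m => Q m w) u) b = ext (fun m => word_form (Q m) b) u.
Proof.
elim: b Q => //= v b IH Q; rewrite -(ext_exchange lbP).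
by congr (ext _ v); apply/boolp.funext => k; rewrite IH.
Qed.

Lemma word_form_linear sigma (a b : seq L) c x y :
  word_form sigma (a ++ (c *: x + y) :: b) =
    c * word_form sigma (a ++ x :: b) + word_form sigma (a ++ y :: b).
Proof.
elim: a sigma => [|u a IH] sigma /=; first exact: (ext_linear lbP).
rewrite [RHS]addrC -[c in RHS]opprK mulNr -(ext_sub lbP).
by congr (ext _ u); apply/boolp.funext => k; rewrite IH; ring.
Qed.

(** By multilinearity it suffices to treat two letters, where this says that the defect
    vanishes. *)
Lemma word_form_lie sigma (a b : seq L) i j x y :
    (forall c z t d, defect S e par ext sigma c z t d = 0) ->
    homog S i x -> homog S j y ->
  word_form sigma (a ++ x :: y :: b) - (-1) ^+ (i && j) * word_form sigma (a ++ y :: x :: b)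
    = word_form sigma (a ++ lie S x y :: b).
Proof.
move=> sigmaP hx hy; elim: a sigma sigmaP => [|u a IH] sigma sigmaP /=; last first.
  rewrite -(ext_sub lbP); congr (ext _ u); apply/boolp.funext => k.
  by apply: IH => c z t d; apply: (sigmaP (k :: c)).
pose G k l := word_form (fun w => sigma [:: k, l & w]) b.
pose T := ext (fun m => word_form (fun w => sigma (m :: w)) b).
have lT : linear_form T := ext_linear lbP _.
have GE k l : G k l = (-1) ^+ (par k && par l) * G l k + T (lie S (e k) (e l)).
  suff -> : T (lie S (e k) (e l)) = G k l - (-1) ^+ (par k && par l) * G l k by ring.
  rewrite /G /T -word_form_ext -word_form_sub; congr (word_form _ b).
  apply/boolp.funext => w; apply/esym/eqP; rewrite -subr_eq0; apply/eqP.
  exact: (sigmaP [::]).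
rewrite -/G -/(T _) -[RHS](ext_span lbP (T := fun x => T (lie S x y))); last first.
  by move=> c u v; rewrite (bracket_linearl brP) lT.
rewrite [X in _ - _ * X](ext_exchange lbP) -(ext_sub lbP).
apply: (eq_ext_parity lbP) hx _ => k pk.
rewrite -[RHS](ext_span lbP (T := fun y => T (lie S (e k) y))); last first.
  by move=> c u v; rewrite (bracket_linearr brP) lT.
rewrite -(ext_sub lbP).
by apply: (eq_ext_parity lbP) hy _ => l pl; rewrite -/(G k l) -/(G l k) GE pk pl; ring.
Qed.

(** The linear form on the free algebra which is [sigma] on words in letters. *)
Definition free_form sigma (a : free_algebra L) : F :=
  mmap idfun (fun m : {fmonom L} => word_form sigma m) a.

Lemma free_formZ sigma c (a : free_algebra L) : free_form sigma (c *: a) = c * free_form sigma a.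
Proof.
rewrite /free_form (mmapEw (d := msupp a)) ?msuppZ_le // mmapE mulr_sumr.
by apply: eq_bigr => k _; rewrite mcoeffZ /= mulrA.
Qed.

Lemma free_form_monomial sigma (m : {fmonom L}) :
  free_form sigma << m >> = word_form sigma m.
Proof. by rewrite /free_form mmapU /= mul1r. Qed.

Lemma free_form_linear sigma : linear_form (free_form sigma).
Proof. by move=> c u v; rewrite -free_formZ /free_form raddfD. Qed.

Lemma free_linear_form_eq0 (T : free_algebra L -> F) : linear_form T ->
  (forall m : {fmonom L}, T << m >> = 0) -> forall a, T a = 0.
Proof.
move=> lT T0 a; rewrite [a]monalgE; elim: (enum_fset _) => [|k s IH].
  by rewrite big_nil (linear_form0 lT).
rewrite big_cons (linear_formD _ _ lT) IH addr0.
have -> : << a@_k *g k >> = a@_k *: (<< k >> : free_algebra L).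
  by apply/malgP => l; rewrite mcoeffZ [RHS]/= mcoeffU mcoeffU mulr_natr.
by rewrite (linear_formZ _ _ lT) T0 mulr0.
Qed.

Lemma free_monomialM (m n : {fmonom L}) :
  (<< m >> : free_algebra L) * << n >> = << FMonom (m ++ n) >>.
Proof.
rewrite [LHS]malgM_def fgmulUU mulr1; congr << _ >>.
by apply: val_inj; rewrite /= fmM.
Qed.

(** By linearity the factors [b] and [c] may be taken to be monomials. *)
Lemma free_form_ideal sigma (b r c : free_algebra L) :
    (forall a x y d, defect S e par ext sigma a x y d = 0) ->
  enveloping_relation S r -> free_form sigma (b * r * c) = 0.
Proof.
move=> sigmaP rP; have lf := free_form_linear sigma.
apply: (free_linear_form_eq0 (T := fun b => free_form sigma (b * r * c))) b.
  by move=> d u v; rewrite mulrDl mulrDl -!scalerAl lf.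
move=> m; apply: (free_linear_form_eq0
    (T := fun c => free_form sigma ((<< m >> : free_algebra L) * r * c))) c.
  by move=> d u v; rewrite mulrDr -!scalerAr lf.
move=> n; pose T (r : free_algebra L) :=
  free_form sigma ((<< m >> : free_algebra L) * r * << n >>).
have lT : linear_form T.
  by move=> d u v; rewrite /T mulrDr mulrDl -scalerAr -scalerAl lf.
have T1 u : T (free_gen u) = word_form sigma (m ++ u :: n).
  by rewrite /T /free_gen !free_monomialM free_form_monomial /= fmU -catA.
have T2 u v : T (free_gen u * free_gen v) = word_form sigma (m ++ [:: u, v & n]).
  rewrite /T /free_gen !free_monomialM free_form_monomial /=.
  by rewrite !fmU -!catA.
rewrite -/(T r); case: rP => {r} [c x y|i j x y hx hy].
  by rewrite (linear_formD _ _ lT) (linear_formN _ lT) lT !T1 word_form_linear subrr.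
have E := word_form_lie m n sigmaP hx hy.
rewrite -(T1 (lie S x y)) -(T2 x y) -(T2 y x) in E.
rewrite (linear_formD (_ - _) (- free_gen _) lT) (linear_formN (free_gen _) lT) -E.
rewrite (linear_formD (_ * _) (- (_ *: _)) lT) (linear_formN (_ *: _) lT).
by rewrite (linear_formZ _ _ lT) subrr.
Qed.

End WordForms.

Lemma lspan_ind (F : fieldType) (V : lmodType F) (P Q : V -> Prop) :
  Q 0 -> (forall c u v, P u -> Q v -> Q (c *: u + v)) -> forall v, lspan P v -> Q v.
Proof.
move=> Q0 QP v [s [Ps ->]]; elim: s Ps => [|p s IH] Ps; first by rewrite big_nil.
rewrite big_cons; apply: QP; first by apply: Ps; rewrite mem_head.
by apply: IH => q qs; apply: Ps; rewrite inE qs orbT.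
Qed.

Section QuotientForms.
Variables (F : fieldType) (V : lmodType F) (P : V -> Prop) (T : V -> F).
Hypothesis lT : linear_form T.
Hypothesis T0 : forall v, P v -> T v = 0.

Lemma lspan_form0 v : lspan P v -> T v = 0.
Proof.
apply: (lspan_ind (Q := fun v => T v = 0)) => [|c u w Pu E]; first exact: linear_form0.
by rewrite lT T0 // mulr0 add0r.
Qed.

Definition quot_form (x : quot_span P) : F := T (quot_repr x).

Lemma quot_form_pi v : quot_form (quot_pi P v) = T v.
Proof.
have /quot_piP/lspan_form0 := quot_reprK (quot_pi P v).
by rewrite (linear_formD _ _ lT) (linear_formN _ lT) => /eqP; rewrite subr_eq0 => /eqP.
Qed.

Lemma quot_form_linear : linear_form quot_form.
Proof.
move=> c x y; rewrite -[x]quot_reprK -[y]quot_reprK -linearP !quot_form_pi.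
exact: lT.
Qed.

End QuotientForms.

Section InducedForms.
Variables (F : fieldType) (L : lmodType F) (S : superBracket L).
Variables (I : eqType) (e : I -> L) (par : I -> bool) (ext : (I -> F) -> L -> F).
Variables (lt : rel I) (J : pred I) (chi : I -> F) (rho : L -> F -> Prop).
Hypothesis lbP : letter_basis S e par ext.
Hypothesis brP : letter_bracket S e par.
Hypothesis boP : borel_letters S e par ext lt J chi.
Hypothesis char0 : forall n, n.+1%:R != 0 :> F.
Hypothesis rhoP : forall b c, rho b c -> forall phi z,
  (forall k, J k -> phi k = chi k * z) -> ext phi b = c * z.

Local Notation M := (induced S rho).
Local Notation act := (@induced_act F L S rho).
Local Notation vac := (induced_pi rho (1 : enveloping S)).

Lemma word_form_rho sigma (s : seq L) b c : rho b c ->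
    (forall a k, J k -> sigma (rcons a k) = chi k * sigma a) ->
  word_form ext sigma (rcons s b) = c * word_form ext sigma s.
Proof.
move=> bc; elim: s sigma => [|u s IH] sigma sigmaJ /=.
  by apply: rhoP => // k /(sigmaJ [::]).
rewrite -(ext_scale lbP); congr (ext _ u); apply/boolp.funext => k.
by apply: IH => a; apply: (sigmaJ (k :: a)).
Qed.

Lemma word_actE (w : seq I) : foldr (fun k => act (e k)) vac w
  = induced_pi rho (env_pi S << FMonom (map e w) >>).
Proof.
elim: w => [|k w IH] /=.
  congr (induced_pi rho (env_pi S << _ >>)); apply: val_inj; exact: fm1.
rewrite IH induced_act_pi /env_gen -env_piM /free_gen free_monomialM.
by rewrite /= fmU.
Qed.

(** The form on words descends from the free algebra to the enveloping algebra since it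
    respects the relations, and then to the induced module since it absorbs the
    character at the end of words. *)
Theorem induced_form_exists (f : seq I -> F) : exists T : M -> F,
  linear_form T /\ forall w, normal par lt J w ->
    T (foldr (fun k => act (e k)) vac w) = f w.
Proof.
have [sigma [sigmaP sigmaJ sigmaN]] := pbw_form_exists lbP brP boP char0 f.
have lf := free_form_linear ext sigma.
have f0 a : enveloping_ideal S a -> free_form ext sigma a = 0.
  by move=> [b [r [c [rP ->]]]]; apply: (free_form_ideal lbP brP).
pose Tu : enveloping S -> F := quot_form (P := enveloping_ideal S) (free_form ext sigma).
have TuE a : Tu (env_pi S a) = free_form ext sigma a by apply: quot_form_pi.
have lTu : linear_form Tu := quot_form_linear lf f0.
have Tu0 w : induced_relation rho w -> Tu w = 0.
  move=> [u [b [c [bc ->]]]]; have [a ->] := env_pi_surj u.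
  rewrite /env_gen -env_piM (linear_formD _ _ lTu) (linear_formN _ lTu).
  rewrite (linear_formZ _ _ lTu) !TuE.
  pose T' a := free_form ext sigma (a * free_gen b) - c * free_form ext sigma a.
  apply: (free_linear_form_eq0 (T := T')) a => [d x y|m].
    rewrite /T' mulrDl -scalerAl (lf d (x * free_gen b) (y * free_gen b)) (lf d x y).
    have R (p q r t : F) : d * p + q - c * (d * r + t) = d * (p - c * r) + (q - c * t).
      by ring.
    exact: R.
  rewrite /T' free_monomialM !free_form_monomial /= fmU cats1.
  by rewrite (word_form_rho _ bc) // subrr.
exists (quot_form Tu); split; first exact: quot_form_linear.
move=> w nw; rewrite word_actE -(sigmaN w nw) -(word_form_letters lbP).
by rewrite [LHS]quot_form_pi // TuE free_form_monomial.
Qed.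

End InducedForms.

Section InducedModule.
Variables (F : fieldType) (L : lmodType F) (S : superBracket L).
Variable rho : L -> F -> Prop.

Local Notation M := (induced S rho).
Local Notation act := (@induced_act F L S rho).
Local Notation vac := (induced_pi rho (1 : enveloping S)).

Lemma env_gen_relation a : enveloping_relation S a -> env_pi S a = 0.
Proof.
move=> ra; rewrite -(raddf0 (env_pi S)); apply/quot_piP; rewrite subr0.
by apply: lspan_gen; exists 1, a, 1; rewrite mulr1 mul1r.
Qed.

Lemma env_gen_linear c x y : env_gen S (c *: x + y) = c *: env_gen S x + env_gen S y.
Proof.
apply/eqP; rewrite -subr_eq0 /env_gen env_piZ -raddfD -raddfB.
by apply/eqP/env_gen_relation; constructor.
Qed.

Lemma induced_pi_linear c (u v : enveloping S) :
  induced_pi rho (c *: u + v) = c *: induced_pi rho u + induced_pi rho v.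
Proof. exact: linearP. Qed.

Lemma induced_pi_surj (m : M) : exists u, m = induced_pi rho u.
Proof. by exists (quot_repr m); rewrite [RHS]quot_reprK. Qed.

Lemma induced_act_linear x c m n : act x (c *: m + n) = c *: act x m + act x n.
Proof.
have [[u ->] [v ->]] := (induced_pi_surj m, induced_pi_surj n).
apply: (etrans (congr1 (act x) (esym (induced_pi_linear c u v)))).
rewrite (induced_act_pi _ x (c *: u + v)).
rewrite (mulrDr (env_gen S x)) -(env_scaleAr c (env_gen S x) u).
rewrite (induced_act_pi _ x u) (induced_act_pi _ x v).
exact: induced_pi_linear.
Qed.

Lemma induced_act_linearl c x y m : act (c *: x + y) m = c *: act x m + act y m.
Proof.
have [u ->] := induced_pi_surj m.
rewrite !induced_act_pi env_gen_linear mulrDl -env_scaleAl.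
exact: induced_pi_linear.
Qed.

Lemma induced_act_lie i j x y m : homog S i x -> homog S j y ->
  act x (act y m) = (-1) ^+ (i && j) *: act y (act x m) + act (lie S x y) m.
Proof.
move=> hx hy; have [u ->] := induced_pi_surj m.
rewrite !induced_act_pi -!induced_pi_linear !mulrA env_scaleAl -mulrDl.
congr (induced_pi rho (_ * u)); apply/eqP; rewrite -subr_eq0 opprD addrA.
rewrite /env_gen -!env_piM env_piZ -!raddfB.
by apply/eqP/env_gen_relation/Env_lie.
Qed.

Lemma induced_pi0 : induced_pi rho (0 : enveloping S) = 0.
Proof.
apply: (etrans _ (etrans (induced_pi_linear (-1) 0 0) _)).
  by rewrite (scaler0 (enveloping S) (-1)) (addr0 (0 : enveloping S)).
by rewrite (scaleN1r (induced_pi rho 0)) addNr.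
Qed.

Lemma induced_act_rho b c : rho b c -> act b vac = c *: vac.
Proof.
move=> bc; rewrite induced_act_pi.
have E : induced_pi rho (c *: (1 : enveloping S)) = c *: vac.
  by have := induced_pi_linear c 1 0; rewrite induced_pi0 !addr0.
rewrite -E; apply/quot_piP; apply: lspan_gen; exists 1, b, c; split; first exact: bc.
by rewrite mulr1 mul1r.
Qed.

(** A monomial of the enveloping algebra is obtained from [1] by successive left
    multiplications by elements of [L]. *)
Lemma induced_ind (Q : M -> Prop) :
  (forall c m n, Q m -> Q n -> Q (c *: m + n)) -> (forall x m, Q m -> Q (act x m)) ->
  Q 0 -> Q vac -> forall m, Q m.
Proof.
move=> Qlin Qact Q0 Qv m; have [u ->] := induced_pi_surj m.
have [a ->] := env_pi_surj u; rewrite [a]monalgE.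
have Qmon (w : seq L) : Q (induced_pi rho (env_pi S << FMonom w >>)).
  elim: w => [|x w IH].
    rewrite (_ : << FMonom [::] >> = 1 :> free_algebra L) //.
    by congr << _ >>; apply: val_inj; rewrite /= fm1.
  have -> : << FMonom (x :: w) >> = free_gen x * (<< FMonom w >> : free_algebra L).
    by rewrite /free_gen free_monomialM /= fmU.
  by rewrite env_piM -induced_act_pi; apply: Qact.
elim: (enum_fset _) => [|k s IH].
  by rewrite big_nil (raddf0 (env_pi S)) induced_pi0.
have D x y : env_pi S (x + y) = env_pi S x + env_pi S y by apply: (raddfD (env_pi S)).
rewrite big_cons D.
have -> : env_pi S << a@_k *g k >> = a@_k *: env_pi S << FMonom (k : seq L) >>.
  rewrite env_piZ fmK; congr (env_pi S _); apply/malgP => l.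
  by rewrite mcoeffZ [RHS]/= mcoeffU mcoeffU mulr_natr.
by rewrite induced_pi_linear; apply: Qlin.
Qed.

End InducedModule.

(** * The affine Lie superalgebra and its letters *)

Section LinearSums.
Variables (F : fieldType) (g V : lmodType F).

(** Sums over supports are compared by extending them to a common support. *)
Lemma loop_sum_linear (f : int -> g -> V) :
    (forall n c x y, f n (c *: x + y) = c *: f n x + f n y) ->
  forall c (u v : loop g),
    \sum_(n <- msupp (c *: u + v)) f n (c *: u + v)@_n
      = c *: (\sum_(n <- msupp u) f n u@_n) + \sum_(n <- msupp v) f n v@_n.
Proof.
move=> lf c u v.
have f0 n : f n 0 = 0 by have := lf n (-1) 0 0; rewrite scaleN1r addNr scaleN1r addNr.
pose D := (msupp (c *: u + v) `|` (msupp u `|` msupp v))%fset.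
have E (w : loop g) : (msupp w `<=` D)%fset ->
    \sum_(n <- msupp w) f n w@_n = \sum_(n <- D) f n w@_n.
  by move=> sub; apply: big_fset_incl sub _ => n _ nw; rewrite mcoeff_outdom.
have subu : (msupp u `<=` D)%fset by rewrite /D fsetUCA fsubsetUl.
have subv : (msupp v `<=` D)%fset by rewrite /D fsetUA fsubsetUr.
rewrite !E ?fsubsetUl // scaler_sumr -big_split; apply: eq_bigr => n _ /=.
by rewrite mcoeffD -lf; congr (f n (_ + _)); apply: loop_scaleE.
Qed.

End LinearSums.

Lemma scale_comb3 (F : fieldType) (V : lmodType F) (c : F) (p q r s t u : V) :
  c *: p + q - (c *: r + s) + (c *: t + u) = c *: (p - r + t) + (q - s + u).
Proof.
rewrite !scalerDr scalerN opprD -!addrA; congr (_ + _).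
rewrite addrCA; congr (_ + _); rewrite [RHS]addrCA; congr (_ + _).
by rewrite addrCA.
Qed.

Section AffineBracket.
Variables (F : fieldType) (g : vectType F) (S : superBracket g).
Variable form : g -> g -> F.
Hypothesis LS : lie_superalgebra S.
Hypothesis Sf : invariant_form S form.

Local Notation lp := (@in_loop F g).
Local Notation K := (affine_K g).
Local Notation d := (affine_d g).
Local Notation afl := (lie (affine_superalgebra S form)).

Lemma lie0 x : lie S x 0 = 0.
Proof. by have := lie_linearr LS (-1) x x x; rewrite scaleN1r addNr scaleN1r addNr. Qed.

Lemma lie0l x : lie S 0 x = 0.
Proof. by have := lie_linearl LS (-1) x x x; rewrite scaleN1r addNr scaleN1r addNr. Qed.

Lemma lieZ c x y : lie S x (c *: y) = c *: lie S x y.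
Proof. by have := lie_linearr LS c y 0 x; rewrite lie0 !addr0. Qed.

Lemma lieZl c x y : lie S (c *: x) y = c *: lie S x y.
Proof. by have := lie_linearl LS c x 0 y; rewrite lie0l !addr0. Qed.

Lemma form_zeror x : form x 0 = 0.
Proof.
by have := form_linearr Sf (-1) x x x; rewrite scaleN1r addNr mulN1r addNr.
Qed.

Lemma form_zerol x : form 0 x = 0.
Proof.
by have := form_linearl Sf (-1) x x x; rewrite scaleN1r addNr mulN1r addNr.
Qed.

Lemma loop_scaleU c (x : g) n : c *: (<< x *g n >> : loop g) = << c *: x *g n >>.
Proof.
apply/malgP => k; rewrite [LHS]loop_scaleE !mcoeffU.
by case: eqP; rewrite ?mulr1n // !mulr0n scaler0.
Qed.

Lemma in_loop_linear c x y n : lp (c *: x + y) n = c *: lp x n + lp y n.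
Proof.
rewrite /in_loop monalgUD -loop_scaleU; congr (_, _, _) => /=;
  by rewrite scaler0 addr0.
Qed.

Lemma in_loop0 n : lp 0 n = 0.
Proof. by have := in_loop_linear (-1) 0 0 n; rewrite scaleN1r addNr scaleN1r addNr. Qed.

Lemma in_loopZ c x n : lp (c *: x) n = c *: lp x n.
Proof. by have := in_loop_linear c x 0 n; rewrite in_loop0 !addr0. Qed.

Lemma in_loopD x y n : lp (x + y) n = lp x n + lp y n.
Proof. by have := in_loop_linear 1 x y n; rewrite !scale1r. Qed.

Lemma in_loopN x n : lp (- x) n = - lp x n.
Proof. by rewrite -scaleN1r in_loopZ scaleN1r. Qed.

Lemma loop_lie_linearl c (u v w : loop g) :
  loop_lie S (c *: u + v) w = c *: loop_lie S u w + loop_lie S v w.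
Proof.
apply: (loop_sum_linear (f := fun i x => \sum_(j <- msupp w) << lie S x w@_j *g (i + j) >>
  : loop g)) => n a x y.
rewrite scaler_sumr -big_split; apply: eq_bigr => j _ /=.
by rewrite (lie_linearl LS) monalgUD loop_scaleU.
Qed.

Lemma loop_lie_linearr c (u v w : loop g) :
  loop_lie S w (c *: u + v) = c *: loop_lie S w u + loop_lie S w v.
Proof.
rewrite /loop_lie scaler_sumr -big_split; apply: eq_bigr => i _ /=.
apply: (loop_sum_linear (f := fun j x => << lie S w@_i x *g (i + j) >> : loop g)).
by move=> n a x y; rewrite (lie_linearr LS) monalgUD loop_scaleU.
Qed.

Lemma loop_cocycle_linearl c (u v w : loop g) :
  loop_cocycle form (c *: u + v) w = c * loop_cocycle form u w + loop_cocycle form v w.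
Proof.
apply: (loop_sum_linear (V := F^o) (f := fun i x => i%:~R * form x w@_(- i))).
by move=> n a x y; rewrite (form_linearl Sf) mulrDr mulrCA.
Qed.

Lemma loop_cocycle_linearr c (u v w : loop g) :
  loop_cocycle form w (c *: u + v) = c * loop_cocycle form w u + loop_cocycle form w v.
Proof.
rewrite /loop_cocycle mulr_sumr -big_split; apply: eq_bigr => i _ /=.
rewrite mcoeffD [(c *: u)@_ _]loop_scaleE (form_linearr Sf); ring.
Qed.

Lemma loop_degree_linear c (u v : loop g) :
  loop_degree (c *: u + v) = c *: loop_degree u + loop_degree v.
Proof.
apply: (loop_sum_linear (f := fun i x => << i%:~R *: x *g i >> : loop g)).
by move=> n a x y; rewrite scalerDr monalgUD loop_scaleU scalerA mulrC -scalerA.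
Qed.

Lemma affine_linearl c (X Y Z : affine g) : afl (c *: X + Y) Z = c *: afl X Z + afl Y Z.
Proof.
case: X => [[u a] b]; case: Y => [[v a'] b']; case: Z => [[w a''] b''].
congr (_, _, _) => /=; last by rewrite scaler0 addr0.
  rewrite /loop_part /d_coef /= loop_lie_linearl loop_degree_linear.
  rewrite -scale_comb3 scalerDl scalerDr !scalerA [b'' * c]mulrC.
  by rewrite -[(c * b) *: _]scalerA.
exact: loop_cocycle_linearl.
Qed.

Lemma affine_linearr c (X Y Z : affine g) : afl Z (c *: X + Y) = c *: afl Z X + afl Z Y.
Proof.
case: X => [[u a] b]; case: Y => [[v a'] b']; case: Z => [[w a''] b''].
congr (_, _, _) => /=; last by rewrite scaler0 addr0.
  rewrite /loop_part /d_coef /= loop_lie_linearr loop_degree_linear.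
  rewrite -scale_comb3 scalerDl scalerDr !scalerA [b'' * c]mulrC.
  by rewrite -[(c * b) *: _]scalerA.
exact: loop_cocycle_linearr.
Qed.

Lemma affine_K_central X : afl K X = 0 /\ afl X K = 0.
Proof.
rewrite /= /affine_lie /loop_part /d_coef /= !scale0r subr0.
have Z0 : loop_degree (0 : loop g) = 0 by rewrite /loop_degree msupp0 big_seq_fset0.
rewrite Z0 !scaler0 !addr0 subr0; split; congr (_, _, _).
- by rewrite /loop_lie msupp0 big_seq_fset0.
- by rewrite /loop_cocycle msupp0 big_seq_fset0.
- by rewrite /loop_lie msupp0; under eq_bigr do rewrite big_seq_fset0; rewrite big1.
by rewrite /loop_cocycle big1 // => i _; rewrite mcoeff0 form_zeror mulr0.
Qed.

Lemma affine_d_loop x n : afl d (lp x n) = - n%:~R *: lp x n.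
Proof. by rewrite [LHS]affine_lie_d in_loopN in_loopZ scaleNr. Qed.

Lemma affine_loop_d x n : afl (lp x n) d = n%:~R *: lp x n.
Proof.
rewrite /= /affine_lie /loop_part /d_coef /= scale0r subr0 scale1r -in_loopZ.
rewrite loop_degreeU; congr (_, _, _).
  by rewrite /loop_lie msupp0; under eq_bigr do rewrite big_seq_fset0; rewrite big1 ?add0r.
by rewrite /loop_cocycle big1 // => i _; rewrite mcoeff0 form_zeror mulr0.
Qed.

Lemma affine_dd : afl d d = 0.
Proof.
rewrite /= /affine_lie /loop_part /d_coef /=.
have Z0 : loop_degree (0 : loop g) = 0 by rewrite /loop_degree msupp0 big_seq_fset0.
rewrite Z0 !scaler0 addr0 subr0; congr (_, _, _).
  by rewrite /loop_lie msupp0 big_seq_fset0.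
by rewrite /loop_cocycle msupp0 big_seq_fset0.
Qed.

Lemma affine_loop x y m n : afl (lp x m) (lp y n) =
  lp (lie S x y) (m + n) + (if m + n == 0 then m%:~R * form x y else 0) *: K.
Proof. by rewrite [LHS]affine_lie_loop // addr_eq0. Qed.

Lemma affine_lie0 X : afl X 0 = 0.
Proof.
by have := affine_linearr (-1) X X X; rewrite scaleN1r addNr scaleN1r addNr.
Qed.

Lemma affine_lie0l X : afl 0 X = 0.
Proof.
by have := affine_linearl (-1) X X X; rewrite scaleN1r addNr scaleN1r addNr.
Qed.

Lemma affine_lieZ c X Y : afl X (c *: Y) = c *: afl X Y.
Proof. by have := affine_linearr c Y 0 X; rewrite affine_lie0 !addr0. Qed.

Lemma affine_lieZl c X Y : afl (c *: X) Y = c *: afl X Y.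
Proof. by have := affine_linearl c X 0 Y; rewrite affine_lie0l !addr0. Qed.

Lemma affine_lieD X Y Z : afl X (Y + Z) = afl X Y + afl X Z.
Proof. by have := affine_linearr 1 Y Z X; rewrite !scale1r. Qed.

Lemma affine_lieDl X Y Z : afl (X + Y) Z = afl X Z + afl Y Z.
Proof. by have := affine_linearl 1 X Y Z; rewrite !scale1r. Qed.

Lemma affine_skew_loop i j x y m n : homog S i x -> homog S j y ->
  afl (lp x m) (lp y n) = - ((-1) ^+ (i && j) *: afl (lp y n) (lp x m)).
Proof.
move=> hx hy; rewrite !affine_loop scalerDr opprD -in_loopZ -in_loopN.
rewrite -(lie_skew LS hx hy) addrC [n + m]addrC [RHS]addrC; congr (_ + _).
rewrite scalerA -scaleNr; congr (_ *: _); case: eqP => [mn|_]; last by rewrite mulr0 oppr0.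
rewrite (form_supersym Sf hx hy) (_ : m = - n); last first.
  by apply/eqP; rewrite -addr_eq0 mn.
by rewrite mulrNz; ring.
Qed.

(** The central terms are the Jacobi identity of the cocycle, which follows from the
    invariance and the supersymmetry of the form. *)
Lemma affine_jacobi_loop i j x y z m n p : homog S i x -> homog S j y ->
  afl (lp x m) (afl (lp y n) (lp z p)) =
    afl (afl (lp x m) (lp y n)) (lp z p)
      + (-1) ^+ (i && j) *: afl (lp y n) (afl (lp x m) (lp z p)).
Proof.
move=> hx hy; rewrite !affine_loop !affine_lieD affine_lieDl !affine_lieZ affine_lieZl.
rewrite !(affine_K_central _).1 !(affine_K_central _).2 !scaler0 !addr0 !affine_loop.
rewrite (lie_jacobi LS z hx hy) in_loopD in_loopZ !addrA [n + m]addrC.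
rewrite scalerDr !addrA; set A := lp _ _; set B := _ *: lp _ _.
rewrite -!addrA; congr (A + _); rewrite [RHS]addrCA; congr (B + _).
rewrite scalerA -scalerDl; congr (_ *: _); case: eqP => _; last by rewrite mulr0 addr0.
have -> : form y (lie S x z) = - ((-1) ^+ (i && j) * form x (lie S y z)).
  rewrite -(form_invariant Sf) (lie_skew LS hy hx) -scaleNr.
  rewrite -[_ *: _]addr0 (form_linearl Sf) form_zerol addr0 (form_invariant Sf).
  by rewrite mulNr andbC.
by rewrite (form_invariant Sf) intrD; case: (i && j); rewrite ?expr0 ?expr1; ring.
Qed.

Lemma affine_hom_linear i c X Y : affine_hom S i X -> affine_hom S i Y ->
  affine_hom S i (c *: X + Y).
Proof.
case: X => [[u a] t]; case: Y => [[v a'] t'] [hu hK] [hv hK']; split=> [k|ti].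
  by rewrite /loop_part /= mcoeffD [(c *: u)@_k]loop_scaleE; apply: homP LS _ _ _ _ _ _.
have [] := (hK ti, hK' ti); rewrite /K_coef /d_coef /= => -[-> ->] [-> ->].
by rewrite !scaler0 !addr0.
Qed.

Lemma affine_hom_loop i x n : homog S i x -> affine_hom S i (lp x n).
Proof.
move=> hx; split=> // k; rewrite /loop_part /= mcoeffU.
by case: eqP => _; rewrite ?mulr1n ?mulr0n //; apply: hom0 LS _.
Qed.

End AffineBracket.

(** The sign of [ht] separates the negative root vectors, [h] and the positive root
    vectors; [height] is its additive extension to all weights. *)
Record triangular_basis (F : fieldType) (g : vectType F) (S : superBracket g)
    (h : {vspace g}) (Sigma : seq (hdual h)) (N : nat) (b : N.-tuple g)
    (pa : 'I_N -> bool) (wt : 'I_N -> hdual h) (ht : 'I_N -> int)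
    (height : hdual h -> F) : Prop := TriangularBasis {
  tb_basis : basis_of fullv b;
  tb_homog : forall i, homog S (pa i) b`_i;
  tb_root : forall i, root_space S (wt i) b`_i;
  tb_zero : forall i, ht i = 0 -> b`_i \in h;
  tb_positive : forall i, 0 < ht i -> positive_root S Sigma (wt i);
  tb_height : forall i, height (wt i) = (ht i)%:~R;
  tb_heightD : forall alpha beta, height (alpha + beta) = height alpha + height beta;
  tb_height_positive : forall alpha, positive_root S Sigma alpha ->
    exists n, height alpha = n.+1%:R }.

Section AffineLetters.
Variables (F : fieldType) (g : vectType F) (S : superBracket g).
Variables (form : g -> g -> F) (h : {vspace g}) (Sigma : seq (hdual h)).
Variables (N : nat) (b : N.-tuple g) (pa : 'I_N -> bool) (wt : 'I_N -> hdual h).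
Variables (ht : 'I_N -> int) (height : hdual h -> F).
Hypothesis LS : lie_superalgebra S.
Hypothesis Sf : invariant_form S form.
Hypothesis hP : forall x, x \in h <-> root_space S (0 : hdual h) x.
Hypothesis h_even : forall x, x \in h -> homog S false x.
Hypothesis tbP : triangular_basis S Sigma b pa wt ht height.

Local Notation lp := (@in_loop F g).
Local Notation K := (affine_K g).
Local Notation d := (affine_d g).
Local Notation afl := (lie (affine_superalgebra S form)).

Lemma tb_free : free b.
Proof. exact: basis_free (tb_basis tbP). Qed.

Lemma tb_sum x : x = \sum_i coord b i x *: b`_i.
Proof. by apply: coord_basis (memvf x); apply: tb_basis tbP. Qed.

Lemma tb_coord (i j : 'I_N) : coord b j b`_i = (i == j)%:R.
Proof. by rewrite coord_free // tb_free. Qed.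

Lemma tb_neq0 (i : 'I_N) : b`_i != 0.
Proof.
apply/eqP => b0; have := tb_coord i i; rewrite b0 linear0 eqxx => /eqP.
by rewrite eq_sym oner_eq0.
Qed.

Lemma lie_sumr (I : Type) (s : seq I) (f : I -> g) x :
  lie S x (\sum_(i <- s) f i) = \sum_(i <- s) lie S x (f i).
Proof.
elim: s => [|i s IH]; first by rewrite !big_nil (lie0 LS).
by rewrite !big_cons -[in LHS](scale1r (f i)) (lie_linearr LS) IH scale1r.
Qed.

(** The coordinates of a weight vector are supported by the basis vectors of the same
    weight. *)
Lemma coord_root alpha x k : root_space S alpha x -> coord b k x != 0 -> alpha = wt k.
Proof.
move=> rx nz; apply/lfunP => eta.
have := congr1 (coord b k) (rx eta); rewrite linearZ {1}(tb_sum x) lie_sumr.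
rewrite linear_sum (bigD1 k) //= big1 ?addr0; last first.
  move=> i ik; rewrite (lieZ LS) (tb_root tbP) !linearZ /= tb_coord (negPf ik).
  by rewrite mulr0 !mulr0.
rewrite (lieZ LS) (tb_root tbP) !linearZ /= tb_coord eqxx mulr1 mulrC.
by move/(mulIf nz).
Qed.

Lemma homog_coord i x k : homog S i x -> pa k != i -> coord b k x = 0.
Proof.
move=> hx pk.
have hsum j (c : 'I_N -> F) : homog S j (\sum_(k | pa k == j) c k *: b`_k).
  elim/big_rec: _ => [|l y /eqP pl hy]; first exact: hom0 LS j.
  by apply: (homP LS) hy; rewrite -pl; apply: tb_homog tbP l.
pose y := \sum_(l | pa l == ~~ i) coord b l x *: b`_l.
have y0 : y = 0.
  have hy : homog S i y.
    have := tb_sum x; rewrite (bigID (fun l => pa l == i)) /= => E.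
    have -> : y = -1 *: (\sum_(l | pa l == i) coord b l x *: b`_l) + x.
      rewrite {2}E scaleN1r addKr; apply: eq_bigl => l.
      by case: (pa l) (i) => [] [].
    exact: (homP LS).
  have both j z : homog S j z -> homog S (~~ j) z -> z = 0.
    by case: j => *; apply: (hom_direct LS).
  exact: both hy (hsum _ _).
have := congr1 (coord b k) y0; rewrite linear0 /y linear_sum (bigD1 k) /=; last first.
  by case: (pa k) (i) pk => [] [].
rewrite linearZ /= tb_coord eqxx mulr1 big1 ?addr0 // => l /andP[_ lk].
by rewrite linearZ /= tb_coord (negPf lk) mulr0.
Qed.

Lemma root_spaceD i alpha beta x y : homog S i x -> root_space S alpha x ->
  root_space S beta y -> root_space S (alpha + beta : hdual h) (lie S x y).
Proof.
move=> hx rx ry eta.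
rewrite (lie_jacobi LS y (h_even (valP eta)) hx) rx ry.
by rewrite expr0 scale1r (lieZl LS) (lieZ LS) -scalerDl lfunE.
Qed.

Lemma lie_h_skew eta x : eta \in h -> lie S x eta = - lie S eta x.
Proof.
move=> /h_even he; have [x0 [x1 [h0 h1 ->]]] := hom_sum LS x.
rewrite -[x0]scale1r (lie_linearl LS) (lie_linearr LS) !scale1r opprD.
by rewrite (lie_skew LS h0 he) (lie_skew LS h1 he) !andbF expr0 !scale1r.
Qed.

Lemma form_root alpha beta x y : root_space S alpha x ->
  root_space S beta y -> form x y != 0 -> alpha + beta = 0 :> hdual h.
Proof.
move=> rx ry nz; apply/lfunP => eta; rewrite !lfunE /=.
have := form_invariant Sf x (vsval eta) y.
rewrite (lie_h_skew _ (valP eta)) rx ry -scaleNr.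
rewrite -[_ *: x]addr0 (form_linearl Sf) -[_ *: y]addr0 (form_linearr Sf).
rewrite (form_zeror Sf) (form_zerol Sf) !addr0 => /(mulIf nz) <-.
by rewrite subrr.
Qed.

Definition letter : Type := ('I_N * int + bool)%type.

Definition letter_elt (k : letter) : affine g :=
  match k with inl (j, n) => lp b`_j n | inr true => K | inr false => d end.

Definition letter_par (k : letter) : bool := if k is inl (j, _) then pa j else false.

(** The bidegree of a letter: height and power of the loop parameter. *)
Definition letter_ht (k : letter) : int := if k is inl (j, _) then ht j else 0.
Definition letter_mode (k : letter) : int := if k is inl (_, n) then n else 0.

Definition letter_ext (phi : letter -> F) (X : affine g) : F :=
  \sum_(n <- msupp (loop_part X)) \sum_j coord b j (loop_part X)@_n * phi (inl (j, n))
    + K_coef X * phi (inr true) + d_coef X * phi (inr false).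

Local Notation ext := letter_ext.
Local Notation e := letter_elt.

Lemma ext_lp phi x n : ext phi (lp x n) = \sum_j coord b j x * phi (inl (j, n)).
Proof.
rewrite /ext /loop_part /K_coef /d_coef /= !mul0r !addr0 msuppU.
case: eqP => [->|_]; last by rewrite big_seq_fset1 mcoeffUU.
by rewrite big_seq_fset0 big1 // => j _; rewrite linear0 mul0r.
Qed.

Lemma ext_K phi : ext phi K = phi (inr true).
Proof.
by rewrite /ext /loop_part /K_coef /d_coef /= msupp0 big_seq_fset0 mul0r mul1r add0r addr0.
Qed.

Lemma ext_d phi : ext phi d = phi (inr false).
Proof.
by rewrite /ext /loop_part /K_coef /d_coef /= msupp0 big_seq_fset0 mul0r mul1r !add0r.
Qed.

Lemma letter_ext_linear phi : linear_form (ext phi).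
Proof.
move=> c [[u s] t] [[v s'] t']; rewrite /ext /loop_part /K_coef /d_coef /=.
have := loop_sum_linear (V := F^o)
  (f := fun n x => \sum_j coord b j x * phi (inl (j, n))).
move=> /(_ _ c u v) ->; first by rewrite /GRing.scale /=; ring.
move=> n a x y; rewrite /GRing.scale /= mulr_sumr -big_split; apply: eq_bigr => j _ /=.
by rewrite linearP /=; ring.
Qed.

Lemma affine_sum (X : affine g) : X =
  (\sum_(n <- msupp (loop_part X)) lp (loop_part X)@_n n) + K_coef X *: K + d_coef X *: d.
Proof.
case: X => [[u s] t]; rewrite /loop_part /K_coef /d_coef /=.
have -> : \sum_(n <- msupp u) lp u@_n n = (u, 0, 0) :> affine g.
  rewrite {3}[u]monalgE; elim: (enum_fset _) => [|n l IH]; rewrite ?big_nil //.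
  by rewrite !big_cons IH; congr (_, _, _); rewrite /= addr0.
by congr (_, _, _); rewrite /= ?scaler0 ?addr0 ?add0r // /GRing.scale /= mulr1.
Qed.

Lemma letter_ext_span (T : affine g -> F) : linear_form T ->
  forall X, ext (fun k => T (e k)) X = T X.
Proof.
move=> lT X; have lE := letter_ext_linear (fun k => T (e k)).
have E x n : ext (fun k => T (e k)) (lp x n) = T (lp x n).
  rewrite ext_lp {2}(tb_sum x).
  elim/big_rec2: _ => [|j y z _ ->]; first by rewrite in_loop0 (linear_form0 lT).
  by rewrite in_loop_linear lT.
have ED u v : ext (fun k => T (e k)) u = T u -> ext (fun k => T (e k)) v = T v ->
    ext (fun k => T (e k)) (u + v) = T (u + v).
  by move=> Eu Ev; rewrite (linear_formD _ _ lE) (linear_formD _ _ lT) Eu Ev.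
rewrite (affine_sum X); apply: (ED); first apply: (ED).
- elim/big_ind: _ => [|//|n _]; last exact: E.
  by rewrite (linear_form0 lE) (linear_form0 lT).
- by rewrite (linear_formZ _ _ lE) (linear_formZ _ _ lT) ext_K.
by rewrite (linear_formZ _ _ lE) (linear_formZ _ _ lT) ext_d.
Qed.

Lemma letter_basisP : letter_basis (affine_superalgebra S form) e letter_par ext.
Proof.
split.
- case=> [[j n]|[]]; split=> //= k.
  + rewrite /loop_part /= mcoeffU; case: eqP => _; rewrite ?mulr1n ?mulr0n.
      exact: tb_homog tbP j.
    exact: hom0 LS _.
  + by rewrite mcoeff0; apply: hom0 LS _.
  + by rewrite mcoeff0; apply: hom0 LS _.
- exact: letter_ext_linear.
- move=> phi [[j n]|[]]; rewrite ?ext_K ?ext_d //= ext_lp (bigD1 j) //= tb_coord eqxx.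
  by rewrite mul1r big1 ?addr0 // => i ij; rewrite tb_coord eq_sym (negPf ij) mul0r.
- exact: letter_ext_span.
move=> i X phi [hX hKd] phi0; rewrite /ext big1 ?add0r => [|n _].
  case: i hX hKd phi0 => hX hKd phi0; first by case: hKd => // -> ->; rewrite !mul0r addr0.
  by rewrite !phi0 // !mulr0 addr0.
rewrite big1 // => j _; have [pj|pj] := eqVneq (pa j) i; first by rewrite phi0 ?mulr0.
by rewrite (homog_coord (hX n) pj) mul0r.
Qed.

Local Notation hgt := letter_ht.
Local Notation mode := letter_mode.

Lemma letter_bracketP : letter_bracket (affine_superalgebra S form) e letter_par.
Proof.
split.
- exact: affine_linearl LS Sf.
- exact: affine_linearr LS Sf.
- have Kh : affine_hom S false K.
    by split=> // k; rewrite /loop_part /= mcoeff0; apply: hom0 LS _.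
  have Z i : affine_hom S i 0.
    by split=> // k; rewrite /loop_part /= mcoeff0; apply: hom0 LS _.
  have lin := affine_hom_linear LS.
  case=> [[i m]|kx]; case=> [[j n]|ky]; rewrite /letter_elt.
  + rewrite (affine_loop LS Sf) addrC.
    have hl := affine_hom_loop LS (m + n) (lie_hom LS (tb_homog tbP i) (tb_homog tbP j)).
    have [E|NE] := eqVneq (pa i) (pa j).
      move: hl; rewrite /= E addbb => hl; apply: lin Kh hl.
    rewrite (form_even Sf (tb_homog tbP i) (tb_homog tbP j) NE) mulr0 if_same scale0r.
    by rewrite add0r.
  + case: ky; first by rewrite (affine_K_central Sf _).2; apply: Z.
    rewrite (affine_loop_d Sf) -[X in homog _ _ X]addr0 /= addbF.
    exact: lin (affine_hom_loop LS m (tb_homog tbP i)) (Z _).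
  + case: kx; first by rewrite (affine_K_central Sf _).1; apply: Z.
    rewrite (affine_d_loop S form) -[X in homog _ _ X]addr0 /=.
    exact: lin (affine_hom_loop LS n (tb_homog tbP j)) (Z _).
  case: kx ky => [] []; rewrite ?(affine_K_central Sf _).1 ?(affine_K_central Sf _).2
    ?affine_dd; exact: Z.
- case=> [[i m]|kx]; case=> [[j n]|ky]; rewrite /letter_elt.
  + by apply: (affine_skew_loop LS Sf); apply: tb_homog tbP _.
  + rewrite /letter_par andbF expr0 scale1r; case: ky.
      by rewrite (affine_K_central Sf _).2 (affine_K_central Sf _).1 oppr0.
    by rewrite (affine_loop_d Sf) affine_d_loop scaleNr opprK.
  + rewrite expr0 scale1r; case: kx.
      by rewrite (affine_K_central Sf _).2 (affine_K_central Sf _).1 oppr0.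
    by rewrite (affine_loop_d Sf) affine_d_loop scaleNr.
  rewrite expr0 scale1r; case: kx ky => [] [];
    by rewrite ?(affine_K_central Sf _).1 ?(affine_K_central Sf _).2 ?affine_dd oppr0.
have Kl := fun X => (affine_K_central Sf X).1.
have Kr := fun X => (affine_K_central Sf X).2.
have l0 := affine_lie0 LS Sf; have l0l := affine_lie0l LS Sf.
have lZ := affine_lieZ LS Sf; have lZl := affine_lieZl LS Sf.
have lD := affine_lieD LS Sf; have lDl := affine_lieDl LS Sf.
have dl := affine_d_loop S form; have ld := affine_loop_d Sf.
have Z0 (q : int) (f : F) : q%:~R * (if q == 0 then f else 0) = 0.
  by case: eqP => [->|_]; rewrite ?mul0r ?mulr0.
have Fd x y m n : afl (afl (lp x m) (lp y n)) d = (m + n)%:~R *: afl (lp x m) (lp y n).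
  rewrite (affine_loop LS Sf) lDl lZl ld Kl scaler0 addr0 scalerDr scalerA.
  by rewrite Z0 scale0r addr0.
have dF x y m n : afl d (afl (lp x m) (lp y n)) = - (m + n)%:~R *: afl (lp x m) (lp y n).
  rewrite (affine_loop LS Sf) lD lZ dl Kr scaler0 addr0 scalerDr scalerA.
  by rewrite mulNr Z0 oppr0 scale0r addr0.
case=> [[i m]|kx]; case=> [[j n]|ky]; case=> [[k p]|kz]; rewrite /letter_elt /letter_par.
- by apply: (affine_jacobi_loop LS Sf); apply: tb_homog tbP _.
- case: kz; first by rewrite !Kr !l0 scaler0 addr0.
  rewrite Fd !ld !lZ scalerA [_ * m%:~R]mulrC -scalerA.
  have -> : (-1) ^+ (pa i && pa j) *: afl (lp b`_j n) (lp b`_i m)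
      = - afl (lp b`_i m) (lp b`_j n).
    rewrite -[LHS]opprK; congr (- _); apply/esym.
    by apply: (affine_skew_loop LS Sf); apply: tb_homog tbP _.
  by rewrite scalerN -scalerBl intrD addrAC subrr add0r.
- rewrite andbF expr0 scale1r; case: ky; first by rewrite !Kl !Kr !l0 l0l addr0.
  by rewrite dF dl ld lZ lZl -scalerDl intrD opprD addrA subrr add0r.
- rewrite andbF expr0 scale1r; case: ky kz => [] [];
    rewrite ?Kl ?Kr ?affine_dd ?ld ?l0 ?l0l ?Kl ?Kr ?addr0 //.
  by rewrite lZ lZl ld dl -scalerDr scaleNr subrr scaler0.
- rewrite expr0 scale1r; case: kx; first by rewrite !Kl l0l l0 addr0.
  by rewrite dF !dl lZ lZl -scalerDl intrD opprD.
- rewrite expr0 scale1r; case: kx kz => [] [];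
    rewrite ?Kl ?Kr ?affine_dd ?ld ?dl ?l0 ?l0l ?Kl ?Kr ?addr0 //.
  by rewrite lZ lZl ld dl scalerA mulrC scalerA.
- rewrite expr0 scale1r; case: kx ky => [] [];
    rewrite ?Kl ?Kr ?affine_dd ?dl ?l0 ?l0l ?Kl ?Kr ?addr0 ?add0r //.
rewrite expr0 scale1r; case: kx ky kz => [] [] [];
  by rewrite ?Kl ?Kr ?affine_dd ?l0 ?l0l ?Kl ?Kr ?addr0.
Qed.

End AffineLetters.

Section BorelLetters.
Variables (F : fieldType) (g : vectType F) (S : superBracket g).
Variables (form : g -> g -> F) (h : {vspace g}) (Sigma : seq (hdual h)).
Variables (N : nat) (b : N.-tuple g) (pa : 'I_N -> bool) (wt : 'I_N -> hdual h).
Variables (ht : 'I_N -> int) (height : hdual h -> F).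
Hypothesis char0 : forall n, n.+1%:R != 0 :> F.
Hypothesis LS : lie_superalgebra S.
Hypothesis Sf : invariant_form S form.
Hypothesis hP : forall x, x \in h <-> root_space S (0 : hdual h) x.
Hypothesis h_even : forall x, x \in h -> homog S false x.
Hypothesis tbP : triangular_basis S Sigma b pa wt ht height.
Variable lambda : 'Hom(affine_cartan h, F^o).

Local Notation lp := (@in_loop F g).
Local Notation K := (affine_K g).
Local Notation d := (affine_d g).
Local Notation afl := (lie (affine_superalgebra S form)).
Local Notation e := (letter_elt b).
Local Notation par := (letter_par pa).
Local Notation hgt := (letter_ht ht).
Local Notation mode := (@letter_mode N).
Local Notation ext := (letter_ext b).

Lemma int_char0 (n : int) : n%:~R = 0 :> F -> n = 0.
Proof.
case: n => [[|n]|n] //; first by move/eqP; rewrite -pmulrn (negPf (char0 n)).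
by rewrite NegzE mulrNz => /eqP; rewrite oppr_eq0 -pmulrn (negPf (char0 n)).
Qed.

Lemma int_inj_char0 (m n : int) : m%:~R = n%:~R :> F -> m = n.
Proof.
by move/eqP; rewrite -subr_eq0 -intrB => /eqP/int_char0/eqP; rewrite subr_eq0 => /eqP.
Qed.

Lemma height0 : height 0 = 0.
Proof.
have := tb_heightD tbP 0 0; rewrite addr0 => /eqP.
by rewrite -subr_eq0 opprD addNKr oppr_eq0 => /eqP.
Qed.

Lemma ht_bracket (i j k : 'I_N) : coord b k (lie S b`_i b`_j) != 0 -> ht k = ht i + ht j.
Proof.
move=> nz; have rij := root_spaceD LS h_even (tb_homog tbP i) (tb_root tbP i) (tb_root tbP j).
have := coord_root LS tbP rij nz => /(congr1 height).
rewrite (tb_heightD tbP) !(tb_height tbP) -intrD => /int_inj_char0 ->; by [].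
Qed.

Lemma ht_form (i j : 'I_N) : form b`_i b`_j != 0 -> ht i + ht j = 0.
Proof.
move=> nz; have /(congr1 height) := form_root LS Sf h_even (tb_root tbP i) (tb_root tbP j) nz.
by rewrite (tb_heightD tbP) !(tb_height tbP) height0 -intrD => /int_char0.
Qed.

Lemma ht0_commute (i j : 'I_N) : ht i = 0 -> ht j = 0 -> lie S b`_i b`_j = 0.
Proof.
move=> /(tb_zero tbP) bi /(tb_zero tbP)/hP bj.
by have := bj (Subvs bi); rewrite lfunE /= scale0r.
Qed.

Lemma ht0_even (i : 'I_N) : ht i = 0 -> pa i = false.
Proof.
move=> /(tb_zero tbP)/h_even bi; have := tb_homog tbP i.
case: (pa i) => // bi'; have /eqP := hom_direct LS bi bi'.
by rewrite (negPf (tb_neq0 tbP i)).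
Qed.

Lemma wt0_ht0 (i : 'I_N) : wt i = 0 -> ht i = 0.
Proof. by move=> /(congr1 height); rewrite (tb_height tbP) height0 => /int_char0. Qed.

(** The letters spanning, respectively, the negative part, the part of the Heisenberg
    subalgebra which creates, and the Borel subalgebra. *)
Definition letter_class (k : letter N) : nat :=
  if hgt k < 0 then 0%N else if (hgt k == 0) && (mode k < 0) then 1%N else 2%N.

Definition borel_letter (k : letter N) : bool := letter_class k == 2%N.

Definition letter_lt : rel (letter N) := fun x y =>
  (letter_class x < letter_class y)%N
    || ((letter_class x == letter_class y) && (choice.pickle x < choice.pickle y)%N).

Definition letter_chi (k : letter N) : F :=
  match k with
  | inl (j, n) => if (ht j == 0) && (n == 0) then lambda (vsproj h b`_j, 0, 0) else 0
  | inr true => lambda (cartan_K h)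
  | inr false => lambda (0, 0, 1)
  end.

Local Notation lt := letter_lt.
Local Notation J := borel_letter.
Local Notation chi := letter_chi.

Lemma borel_letterE (k : letter N) : J k = (0 < hgt k) || ((hgt k == 0) && (0 <= mode k)).
Proof.
rewrite /borel_letter /letter_class; case: ltgtP => //= _.
by case: leP.
Qed.

Lemma lp_lspan (Q : letter N -> Prop) x n :
  (forall i, coord b i x != 0 -> Q (inl (i, n))) ->
  lspan (fun u => exists k, u = e k /\ Q k) (lp x n).
Proof.
move=> QP; rewrite (tb_sum tbP x).
elim/big_ind: _ => [|u v Hu Hv|i _]; first by rewrite in_loop0; apply: lspan0.
  by rewrite in_loopD; apply: lspanD.
rewrite in_loopZ; have [->|nz] := eqVneq (coord b i x) 0.
  by rewrite scale0r; apply: lspan0.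
by apply: lspanZ; apply: lspan_gen; exists (inl (i, n)); split=> //; apply: QP.
Qed.

(** The central element has bidegree zero, as it must: the form pairs opposite heights,
    and the cocycle opposite modes. *)
Lemma letter_bracket_degree (x y : letter N) :
  lspan (fun u => exists k, u = e k /\
    (hgt k = hgt x + hgt y /\ mode k = mode x + mode y)) (afl (e x) (e y)).
Proof.
case: x => [[i m]|kx]; case: y => [[j n]|ky]; rewrite /letter_elt.
- rewrite (affine_loop LS Sf); apply: lspanD.
    by apply: lp_lspan => k nz; split=> //=; apply: ht_bracket.
  case: eqP => [mn|_]; last by rewrite scale0r; apply: lspan0.
  have [->|nz] := eqVneq (form b`_i b`_j) 0; first by rewrite mulr0 scale0r; apply: lspan0.
  by apply/lspanZ/lspan_gen; exists (inr true); rewrite /= ht_form ?mn.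
- case: ky; first by rewrite (affine_K_central Sf _).2; apply: lspan0.
  rewrite (affine_loop_d Sf); apply/lspanZ/lspan_gen; exists (inl (i, m)).
  by rewrite /= !addr0.
- case: kx; first by rewrite (affine_K_central Sf _).1; apply: lspan0.
  rewrite (affine_d_loop S form); apply/lspanZ/lspan_gen; exists (inl (j, n)).
  by rewrite /= !add0r.
case: kx ky => [] []; rewrite ?(affine_K_central Sf _).1 ?(affine_K_central Sf _).2
  ?affine_dd; exact: lspan0.
Qed.

(** The bracket of two letters in [J] is a combination of letters of positive height, or
    of height zero and nonzero mode, on which the character vanishes: [h] is abelian,
    and the cocycle would need opposite nonzero modes. *)
Lemma borel_lettersP :
  borel_letters (affine_superalgebra S form) e par ext lt J chi.
Proof.
split.
- by move=> k; rewrite /letter_lt ltnn eqxx ltnn.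
- by move=> y x z; rewrite /letter_lt; lia.
- move=> x y xy; have : choice.pickle x != choice.pickle y.
    by apply: contra xy => /eqP/(pcan_inj (@choice.pickleK _))/eqP.
  by rewrite /letter_lt; lia.
- move=> x y; rewrite /borel_letter /letter_lt => /eqP -> ny.
  by rewrite /letter_class in ny *; case: ifP ny => // _; case: ifP.
- move=> x y phi Jx Jy [c phiJ].
  have lE := letter_ext_linear b phi.
  case: x Jx => [[i m]|kx]; case: y Jy => [[j n]|ky]; rewrite !borel_letterE /letter_elt /=.
  + move=> Jj Ji; have hi : 0 <= ht i by case/orP: Ji; lia.
    have hj : 0 <= ht j by case/orP: Jj; lia.
    have [ht0|ht_pos] : (ht i = 0 /\ ht j = 0) \/ 0 < ht i + ht j by lia.
      case: ht0 => i0 j0; rewrite [X in ext _ X](affine_loop LS Sf) ht0_commute //.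
      rewrite in_loop0 add0r (linear_formZ _ _ lE); case: eqP => [mn|_]; last by rewrite mul0r.
      have -> : m = 0 by move: Ji Jj; rewrite i0 j0 /=; lia.
      by rewrite !mul0r.
    rewrite [X in ext _ X](affine_loop LS Sf) (linear_formD _ _ lE) (linear_formZ _ _ lE).
    rewrite (ext_lp b phi) big1 => [|k _].
      have [->|/ht_form] := eqVneq (form b`_i b`_j) 0; last by lia.
      by rewrite mulr0 if_same mul0r addr0.
    have [->|/ht_bracket hk] := eqVneq (coord b k (lie S b`_i b`_j)) 0.
      by rewrite mul0r.
    rewrite phiJ ?borel_letterE /= ?hk ?ht_pos //.
    by rewrite (gt_eqF ht_pos) mul0r mulr0.
  + move=> _ Ji; case: ky; first by rewrite [X in ext _ X](affine_K_central Sf _).2 (linear_form0 lE).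
    rewrite [X in ext _ X](affine_loop_d Sf) (linear_formZ _ _ lE).
    rewrite (ext_letter (letter_basisP form LS tbP) phi (inl (i, m))) phiJ ?borel_letterE //=.
    have [->|m0] := eqVneq m 0; first by rewrite mul0r.
    by rewrite andbF mul0r mulr0.
  + move=> Jj _; case: kx; first by rewrite [X in ext _ X](affine_K_central Sf _).1 (linear_form0 lE).
    rewrite [X in ext _ X](affine_d_loop S form) (linear_formZ _ _ lE).
    rewrite (ext_letter (letter_basisP form LS tbP) phi (inl (j, n))) phiJ ?borel_letterE //=.
    have [->|n0] := eqVneq n 0; first by rewrite oppr0 mul0r.
    by rewrite andbF mul0r mulr0.
  case: kx ky => [] [] _ _; rewrite -[RHS](linear_form0 lE); congr (ext phi _).
  + exact: (affine_K_central Sf _).1.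
  + exact: (affine_K_central Sf _).1.
  + exact: (affine_K_central Sf _).2.
  exact: affine_dd.
move=> [[j n]|//]; rewrite borel_letterE /= => _ pj; case: eqP => //= j0.
by rewrite ht0_even in pj.
Qed.

Local Notation rho := (@borel_character F g S h Sigma lambda).

Lemma ext_nplus phi X : affine_nplus S Sigma X ->
  (forall k, J k -> chi k = 0 -> phi k = 0) -> ext phi X = 0.
Proof.
move=> XP phi0; apply: (lspan_form0 (letter_ext_linear b phi) _ XP) => {XP}X.
move=> [[al n] al_pos [x rx ->]]; rewrite ext_lp big1 // => k _.
have [->|nz] := eqVneq (coord b k x) 0; first by rewrite mul0r.
have [al_root|[/= al0 n0]] := al_pos.
  have [[/negPf al_neq _] _] := al_root; rewrite /= al_neq in rx.
  have [p hp] := tb_height_positive tbP al_root.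
  have := coord_root LS tbP rx nz => /(congr1 height); rewrite /= hp (tb_height tbP) pmulrn.
  move/int_inj_char0 => hk; rewrite phi0 ?mulr0 // ?borel_letterE /= -hk //.
rewrite /= al0 eqxx in rx; have hk : ht k = 0.
  by apply: wt0_ht0; have := coord_root LS tbP ((hP x).1 rx) nz => <-.
by rewrite phi0 ?mulr0 // ?borel_letterE /= hk eqxx /= ?(ltW n0) // (gt_eqF n0).
Qed.

(** An element of the Borel subalgebra is a combination of letters in [J], and [phi] is
    proportional to the character on them. *)
Lemma ext_rho X c : rho X c -> forall phi z,
  (forall k, J k -> phi k = chi k * z) -> ext phi X = c * z.
Proof.
move=> [[[x s] t] [Y [YP -> ->]]] phi z phiE; have lE := letter_ext_linear b phi.
rewrite (linear_formD _ _ lE) (ext_nplus YP) ?addr0; last first.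
  by move=> k Jk chi0; rewrite phiE // chi0 mul0r.
have -> : cartan_incl (x, s, t) = lp (vsval x) 0 + (s : F) *: K + (t : F) *: d.
  by congr (_, _, _); rewrite /= ?scaler0 ?addr0 ?add0r // /GRing.scale /= mulr1.
rewrite !(linear_formD _ _ lE) !(linear_formZ _ _ lE) ext_lp ext_K ext_d.
rewrite (phiE (inr true)) ?(phiE (inr false)) ?borel_letterE // !mulrA.
have lamE (y : subvs_of h) (p q : F) : lambda (y, p : F^o, q : F^o) =
    lambda (y, 0, 0) + p * lambda (cartan_K h) + q * lambda (0, 0, 1).
  have -> : (y, p : F^o, q : F^o) =
      (y, 0, 0) + p *: cartan_K h + q *: ((0, 0, 1) : affine_cartan h).
    by congr (_, _, _); rewrite /= ?scaler0 ?addr0 ?add0r // /GRing.scale /= mulr1.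
  by rewrite !linearD !linearZ.
rewrite (lamE x) !mulrDl; congr (_ + _ + _).
have hx : root_space S (0 : hdual h) (vsval x) by apply/hP; apply: valP.
have ht0 i : coord b i (vsval x) != 0 -> ht i = 0.
  by move=> nz; apply: wt0_ht0; have := coord_root LS tbP hx nz => ->.
have {2}-> : x = \sum_i coord b i (vsval x) *: vsproj h b`_i.
  rewrite -[LHS]vsvalK {1}(tb_sum tbP (vsval x)) linear_sum; apply: eq_bigr => i _.
  by rewrite linearZ.
pose T (y : subvs_of h) := lambda (y, 0, 0).
have lT (q : F) u v : T (q *: u + v) = q * T u + T v.
  apply: etrans (linearP lambda q ((u, 0, 0) : affine_cartan h) (v, 0, 0)).
  by rewrite /T; congr (lambda (_, _, _)); rewrite /= scaler0 addr0.
rewrite -/(T _).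
have -> : T (\sum_i coord b i (vsval x) *: vsproj h b`_i)
    = \sum_i coord b i (vsval x) * T (vsproj h b`_i).
  elim/big_rec2: _ => [|i u v _ <-]; last exact: lT.
  exact: (linear_form0 lT).
rewrite mulr_suml; apply: eq_bigr => i _.
have [->|nz] := eqVneq (coord b i (vsval x)) 0; first by rewrite !mul0r.
by rewrite phiE ?borel_letterE /= ht0 // eqxx /= mulrA.
Qed.

Lemma rho_letter k : J k -> rho (e k) (chi k).
Proof.
have n0 : affine_nplus S Sigma 0 := lspan0 _.
have v0 : vsval (0 : subvs_of h) = 0 := linear0 (@vsval _ _ h).
case: k => [[j n]|[]] Jk.
- rewrite /letter_elt /letter_chi; move: Jk; rewrite borel_letterE /=.
  have i0 : cartan_incl ((0, 0, 0) : affine_cartan h) = 0 by rewrite /cartan_incl v0 monalgU0.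
  have l0 : lambda ((0, 0, 0) : affine_cartan h) = 0 := linear0 lambda.
  case: (ltgtP (ht j) 0) => //= [hj _|hj n_ge].
    exists (0, 0, 0), (lp b`_j n); split; rewrite ?l0 ?i0 ?add0r //.
    apply: lspan_gen; exists (wt j, n); first by left; apply: tb_positive tbP _ hj.
    exists b`_j => //=; case: eqP => [wj|_]; last exact: tb_root tbP j.
    by rewrite (wt0_ht0 wj) ltxx in hj.
  case: eqP => [->|n_neq]; last first.
    exists (0, 0, 0), (lp b`_j n); split; rewrite ?l0 ?i0 ?add0r //.
    apply: lspan_gen; exists (0, n); first by right; split=> //=; lia.
    by exists b`_j => //=; rewrite eqxx; apply: tb_zero tbP _ hj.
  exists (vsproj h b`_j, 0, 0), 0; split=> //; rewrite addr0 /=.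
  by rewrite vsprojK ?(tb_zero tbP).
- exists (cartan_K h), 0; split=> //; rewrite addr0 /cartan_K /cartan_incl.
  by rewrite v0 monalgU0.
exists (0, 0, 1), 0; split=> //; rewrite addr0 /cartan_K /cartan_incl.
by rewrite v0 monalgU0.
Qed.

End BorelLetters.

(** * The module: words of creation letters *)

Section LspanTools.
Variables (F : fieldType) (V : lmodType F).
Implicit Types (P Q : V -> Prop).

Lemma lspan_sub P Q v : (forall u, P u -> lspan Q u) -> lspan P v -> lspan Q v.
Proof.
move=> PQ; apply: (lspan_ind (lspan0 Q)) => c u w Pu Qw.
by apply: lspanD => //; apply/lspanZ/PQ.
Qed.

Lemma lspan_mono P Q v : (forall u, P u -> Q u) -> lspan P v -> lspan Q v.
Proof. by move=> PQ; apply: lspan_sub => u /PQ; apply: lspan_gen. Qed.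

Lemma lspan_false (v : V) : lspan (fun=> False) v -> v = 0.
Proof. by apply: (lspan_ind (Q := fun v => v = 0)). Qed.

Lemma lspan_distinct (A : eqType) (f : A -> V) (Q : A -> Prop) v :
  lspan (fun u => exists2 a, Q a & u = f a) v ->
  exists (W : seq A) (c : A -> F), [/\ uniq W, forall a, a \in W -> Q a /\ c a != 0 &
    v = \sum_(a <- W) c a *: f a].
Proof.
move=> [s [Ps ->]].
suff [W [c [uW QW ->]]] : exists (W : seq A) (c : A -> F), [/\ uniq W,
    forall a, a \in W -> Q a & \sum_(p <- s) p.1 *: p.2 = \sum_(a <- W) c a *: f a].
  exists [seq a <- W | c a != 0], c; split; first exact: filter_uniq.
    by move=> a; rewrite mem_filter => /andP[ca /QW].
  rewrite big_filter [LHS](bigID (fun a => c a != 0)) /= [X in _ + X]big1 ?addr0 //.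
  by move=> a; rewrite negbK => /eqP ->; rewrite scale0r.
elim: s Ps => [|[z u] s IH] Ps.
  by exists [::], (fun=> 0); split=> //; rewrite !big_nil.
have [|W [c [uW QW E]]] := IH _; first by move=> q qs; apply: Ps; rewrite inE qs orbT.
have [a Qa /= ->] : exists2 a, Q a & (z, u).2 = f a by apply: Ps; rewrite mem_head.
rewrite big_cons {}E /=; case: (boolP (a \in W)) => [aW|aW].
  exists W, (fun x => if x == a then z + c a else c x); split=> //.
  rewrite (bigD1_seq a) //= [RHS](bigD1_seq a) //= eqxx scalerDl -addrA.
  by congr (_ + (_ + _)); apply: eq_bigr => x /negPf ->.
exists (a :: W), (fun x => if x == a then z else c x); split.
- by rewrite /= aW.
- by move=> x; rewrite inE => /orP[/eqP ->|/QW].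
rewrite big_cons eqxx; congr (_ + _); rewrite !big_seq; apply: eq_bigr => x xW.
by case: eqP => // xa; rewrite -xa xW in aW.
Qed.

End LspanTools.

Section VermaWords.
Variables (F : fieldType) (g : vectType F) (S : superBracket g).
Variables (form : g -> g -> F) (h : {vspace g}) (Sigma : seq (hdual h)).
Variables (N : nat) (b : N.-tuple g) (pa : 'I_N -> bool) (wt : 'I_N -> hdual h).
Variables (ht : 'I_N -> int) (height : hdual h -> F).
Hypothesis char0 : forall n, n.+1%:R != 0 :> F.
Hypothesis LS : lie_superalgebra S.
Hypothesis Sf : invariant_form S form.
Hypothesis hP : forall x, x \in h <-> root_space S (0 : hdual h) x.
Hypothesis h_even : forall x, x \in h -> homog S false x.
Hypothesis tbP : triangular_basis S Sigma b pa wt ht height.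
Variable lambda : 'Hom(affine_cartan h, F^o).

Local Notation lp := (@in_loop F g).
Local Notation K := (affine_K g).
Local Notation d := (affine_d g).
Local Notation afl := (lie (affine_superalgebra S form)).
Local Notation e := (letter_elt b).
Local Notation par := (letter_par pa).
Local Notation hgt := (letter_ht ht).
Local Notation mode := (@letter_mode N).
Local Notation ext := (letter_ext b).
Local Notation lt := (letter_lt ht).
Local Notation J := (borel_letter ht).
Local Notation chi := (letter_chi b ht lambda).
Local Notation lcl := (letter_class ht).
Local Notation bad := (bad par lt).
Local Notation normal := (normal par lt J).

(** All that is used of the induced module [M] and its vacuum vector. *)
Variables (M : lmodType F) (act : affine g -> M -> M) (vac : M).
Hypothesis act_linear : forall X c m n, act X (c *: m + n) = c *: act X m + act X n.
Hypothesis act_linearl : forall c (X Y : affine g) m, act (c *: X + Y) m = c *: act X m + act Y m.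
Hypothesis act_lie : forall i j X Y m, affine_hom S i X -> affine_hom S j Y ->
  act X (act Y m) = (-1) ^+ (i && j) *: act Y (act X m) + act (afl X Y) m.
Hypothesis act_J : forall k, J k -> act (e k) vac = chi k *: vac.
Hypothesis vac_ind : forall Q : M -> Prop,
  (forall c m n, Q m -> Q n -> Q (c *: m + n)) -> (forall X m, Q m -> Q (act X m)) ->
  Q 0 -> Q vac -> forall m, Q m.

Definition word (w : seq (letter N)) (m : M) : M := foldr (fun k => act (e k)) m w.

Hypothesis word_forms : forall f : seq (letter N) -> F, exists T : M -> F,
  linear_form T /\ forall w, normal w -> T (word w vac) = f w.

Lemma act0 X : act X 0 = 0.
Proof. by have := act_linear X (-1) 0 0; rewrite scaleN1r addNr scaleN1r addNr. Qed.

Lemma act0l m : act 0 m = 0.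
Proof. by have := act_linearl (-1) 0 0 m; rewrite scaleN1r addNr scaleN1r addNr. Qed.

Lemma actZ X c m : act X (c *: m) = c *: act X m.
Proof. by have := act_linear X c m 0; rewrite act0 !addr0. Qed.

Lemma actD X m n : act X (m + n) = act X m + act X n.
Proof. by have := act_linear X 1 m n; rewrite !scale1r. Qed.

Lemma actB X c m n : act X (m - c *: n) = act X m - c *: act X n.
Proof. by rewrite -!scaleNr actD actZ. Qed.

Lemma act_sub X m n : act X (m - n) = act X m - act X n.
Proof. by have := actB X 1 m n; rewrite !scale1r. Qed.

Lemma actZl c X m : act (c *: X) m = c *: act X m.
Proof. by have := act_linearl c X 0 m; rewrite act0l !addr0. Qed.

Lemma word_cat u v m : word (u ++ v) m = word u (word v m).
Proof. exact: foldr_cat. Qed.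

Lemma word_linear w c m n : word w (c *: m + n) = c *: word w m + word w n.
Proof. by elim: w => //= k w ->; rewrite act_linear. Qed.

Lemma word0 w : word w 0 = 0.
Proof. by elim: w => //= k w ->; rewrite act0. Qed.

Lemma wordZ w c m : word w (c *: m) = c *: word w m.
Proof. by have := word_linear w c m 0; rewrite word0 !addr0. Qed.

Lemma wordD w m n : word w (m + n) = word w m + word w n.
Proof. by have := word_linear w 1 m n; rewrite !scale1r. Qed.

Lemma act_lspan (P Q : M -> Prop) X v :
  (forall u, P u -> lspan Q (act X u)) -> lspan P v -> lspan Q (act X v).
Proof.
move=> PQ; apply: (lspan_ind (Q := fun v => lspan Q (act X v))) => [|c u w Pu Qw].
  by rewrite act0; apply: lspan0.
by rewrite act_linear; apply: lspanD => //; apply/lspanZ/PQ.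
Qed.

Lemma word_lspan (P Q : M -> Prop) w v :
  (forall u, P u -> lspan Q (word w u)) -> lspan P v -> lspan Q (word w v).
Proof.
move=> PQ; apply: (lspan_ind (Q := fun v => lspan Q (word w v))) => [|c u u' Pu Qu].
  by rewrite word0; apply: lspan0.
by rewrite word_linear; apply: lspanD => //; apply/lspanZ/PQ.
Qed.

Lemma act_lspanl (Q : letter N -> Prop) (G : M -> Prop) X m :
    (forall k, Q k -> lspan G (act (e k) m)) ->
  lspan (fun u => exists k, u = e k /\ Q k) X -> lspan G (act X m).
Proof.
move=> QG; apply: (lspan_ind (Q := fun X => lspan G (act X m))) => [|c Y Z].
  by rewrite act0l; apply: lspan0.
by move=> [k [-> Qk]] GZ; rewrite act_linearl; apply: lspanD => //; apply/lspanZ/QG.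
Qed.

Lemma affine_lspan (X : affine g) : lspan (fun u => exists k, u = e k /\ True) X.
Proof.
rewrite (affine_sum X); apply: lspanD; last first.
  by apply/lspanZ/lspan_gen; exists (inr false).
apply: lspanD; last by apply/lspanZ/lspan_gen; exists (inr true).
elim/big_ind: _ => [|u v|n _]; [exact: lspan0|exact: lspanD|].
exact: (lp_lspan tbP).
Qed.

Lemma letter_affine_hom k : affine_hom S (par k) (e k).
Proof. exact: (letter_homog (letter_basisP form LS tbP) k). Qed.

Lemma act_swap x y m : act (e x) (act (e y) m) =
  (-1) ^+ (par x && par y) *: act (e y) (act (e x) m) + act (afl (e x) (e y)) m.
Proof. by apply: act_lie; apply: letter_affine_hom. Qed.

Definition in_class (i : nat) (w : seq (letter N)) : bool := all (fun k => lcl k == i) w.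

Lemma class0E k : (lcl k == 0%N) = (hgt k < 0).
Proof. by rewrite /letter_class; case: ifP => // _; case: ifP. Qed.

Lemma class1E k : (lcl k == 1%N) = (hgt k == 0) && (mode k < 0).
Proof. by rewrite /letter_class; case: ltgtP => //= _; case: ifP. Qed.

Lemma hgt0_even k : hgt k = 0 -> par k = false.
Proof. by case: k => [[j n]|//] /= /(ht0_even LS h_even tbP). Qed.

Lemma bracket_degree x y : lspan (fun u => exists k, u = e k /\
  (hgt k = hgt x + hgt y /\ mode k = mode x + mode y)) (afl (e x) (e y)).
Proof. exact: (letter_bracket_degree char0 LS Sf h_even tbP). Qed.

(** ** The Fock space *)

Definition fock (v : M) : Prop := exists2 hs, in_class 1 hs & v = word hs vac.

(** Move the operator to the vacuum vector; its brackets with creation operators have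
    height zero again. *)
Lemma fock_hgt0 k hs : hgt k = 0 -> in_class 1 hs ->
  lspan fock (act (e k) (word hs vac)).
Proof.
elim: hs k => [|x hs IH] k k0 /=.
  case: (boolP (lcl k == 1%N)) => k1 _.
    by apply: lspan_gen; exists [:: k]; rewrite //= k1.
  rewrite act_J; first by apply/lspanZ/lspan_gen; exists [::].
  by rewrite borel_letterE; move: k1; rewrite class1E k0 eqxx /= -leNgt.
move=> /andP[x1 hs1].
have [|k1] := boolP (lcl k == 1%N).
  by move=> k1; apply: lspan_gen; exists [:: k, x & hs]; rewrite //= k1 x1.
have x0 : hgt x = 0 by move: x1; rewrite class1E => /andP[/eqP].
rewrite act_swap; apply: lspanD.
  apply/lspanZ; apply: act_lspan (IH k k0 hs1) => u [hs' h1 ->].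
  by apply: lspan_gen; exists (x :: hs'); rewrite //= x1.
apply: act_lspanl (bracket_degree k x) => l [l0 _].
by apply: IH; rewrite // l0 k0 x0.
Qed.

Lemma fock_pos k hs : 0 < hgt k -> in_class 1 hs -> act (e k) (word hs vac) = 0.
Proof.
elim: hs k => [|x hs IH] k k_pos /=.
  rewrite act_J ?borel_letterE ?k_pos //; case: k k_pos => [[j n]|//] /= k_pos _.
  by rewrite (gt_eqF k_pos) scale0r.
move=> /andP[x1 hs1]; rewrite act_swap IH // act0 scaler0 add0r.
have x0 : hgt x = 0 by move: x1; rewrite class1E => /andP[/eqP].
apply: lspan_false; apply: act_lspanl (bracket_degree k x) => l [l0 _].
by rewrite IH ?l0 ?x0 ?addr0 //; apply: lspan0.
Qed.

(** ** The negative part acting on the Fock space *)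

Definition total_ht (w : seq (letter N)) : int := \sum_(k <- w) hgt k.

Definition lowered (B : M -> Prop) (n : int) (v : M) : Prop :=
  exists ys m, [/\ in_class 0 ys, B m, total_ht ys = n & v = word ys m].

(** Brackets preserve the total height, so moving a letter through a word gives words of
    the same total height, until the letter reaches [B]. *)
Lemma act_lowered (B : M -> Prop) k ys m :
    (forall k m, hgt k = 0 -> B m -> lspan B (act (e k) m)) ->
    (forall k m, 0 < hgt k -> B m -> act (e k) m = 0) ->
    in_class 0 ys -> B m ->
  lspan (lowered B (hgt k + total_ht ys)) (act (e k) (word ys m)).
Proof.
move=> B0 Bp ys0 Bm; elim: ys k ys0 => [|y ys IH] k /=.
  move=> _; rewrite /total_ht big_nil addr0.
  have [k_neg|k_pos|k0] := ltgtP (hgt k) 0.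
  - apply: lspan_gen; exists [:: k], m.
    by split=> //; rewrite ?/total_ht ?big_seq1 //= class0E k_neg.
  - by rewrite Bp //; apply: lspan0.
  apply: lspan_mono (B0 k m k0 Bm) => u Bu; exists [::], u.
  by rewrite /total_ht big_nil.
case/andP=> y0 ys0; rewrite act_swap; apply: lspanD.
  apply/lspanZ; apply: act_lspan (IH k ys0) => u [ys' [m' [ys'0 Bm' hts ->]]].
  apply: lspan_gen; exists (y :: ys'), m'; split=> //; first by rewrite /= y0.
  by rewrite /total_ht !big_cons -/(total_ht _) hts addrCA.
apply: act_lspanl (bracket_degree k y) => l [l0 _].
by have := IH l ys0; rewrite /total_ht big_cons addrA -l0.
Qed.

(** ** Sorting words *)

Let boP := borel_lettersP char0 LS Sf hP h_even tbP lambda.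

Lemma letter_trichotomy x y : [\/ lt x y, lt y x | x = y].
Proof.
have [->|xy] := eqVneq x y; first by constructor 3.
by have /orP[] := order_total boP xy; [constructor 1|constructor 2].
Qed.

Lemma letter_lt_asym x y : lt x y -> lt y x = false.
Proof.
move=> xy; apply/negP => /(order_trans boP xy).
by rewrite (order_irr boP).
Qed.

Definition letter_le : rel (letter N) := fun x y => ~~ lt y x.

Lemma letter_le_total : total letter_le.
Proof.
by move=> x y; rewrite /letter_le; case: (letter_trichotomy x y) => [/letter_lt_asym ->|
  /letter_lt_asym ->|->]; rewrite ?orbT // (order_irr boP).
Qed.

Lemma letter_le_trans : transitive letter_le.
Proof.
move=> y x z; rewrite /letter_le => yx zy; apply/negP => zx.
case: (letter_trichotomy x y) => [xy|yx'|xy].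
- by rewrite (order_trans boP zx xy) in zy.
- by rewrite yx' in yx.
by rewrite -xy zx in zy.
Qed.

Lemma letter_le_anti : antisymmetric letter_le.
Proof.
move=> x y /andP[]; rewrite /letter_le => yx xy.
by case: (letter_trichotomy x y) => // H; rewrite H in xy yx.
Qed.

Lemma good_pairE x y : ~~ bad x y = letter_le x y && ~~ ((x == y) && par x).
Proof. by rewrite /bad negb_or. Qed.

Lemma good_pair_trans : transitive (fun x y => ~~ bad x y).
Proof.
move=> y x z; rewrite !good_pairE => /andP[xy nxy] /andP[yz nyz].
rewrite (letter_le_trans xy yz) /=; apply: contraNN nxy => /andP[/eqP xz px].
have -> : x = y by apply: letter_le_anti; rewrite xy /= xz yz.
by rewrite eqxx; move: px; rewrite -{1}(_ : y = x) //; apply: letter_le_anti;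
  rewrite xy /= xz yz.
Qed.

Lemma good_sorted_le w : sorted (fun x y => ~~ bad x y) w -> sorted letter_le w.
Proof. by apply: sub_sorted => x y; rewrite good_pairE => /andP[]. Qed.

Lemma class1_hgt x : lcl x = 1%N -> hgt x = 0.
Proof. by move/eqP; rewrite class1E => /andP[/eqP]. Qed.

Lemma class1_good w : in_class 1 w -> sorted letter_le w ->
  sorted (fun x y => ~~ bad x y) w.
Proof.
elim: w => [|x [|y w] IH] //= /and3P[/eqP x1 y1 w1] /andP[xy yw].
rewrite good_pairE xy hgt0_even ?class1_hgt // andbF /=; apply: IH => //.
by rewrite /= y1.
Qed.

Lemma bracket_class1 x y : lcl x = 1%N -> lcl y = 1%N -> afl (e x) (e y) = 0.
Proof.
move=> /eqP; rewrite class1E => /andP[/eqP x0 x1] /eqP; rewrite class1E => /andP[/eqP y0 y1].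
case: x x0 x1 => [[i m]|//] /= i0 m0; case: y y0 y1 => [[j n]|//] /= j0 n0.
rewrite [LHS](affine_loop LS Sf) (ht0_commute hP tbP) // in_loop0 add0r.
by case: eqP => [mn|_]; rewrite ?scale0r //; lia.
Qed.

Lemma fock_front a x c m : in_class 1 a -> lcl x = 1%N ->
  word (a ++ x :: c) m = word (x :: a ++ c) m.
Proof.
elim: a => //= y a IH /andP[/eqP y1 a1] x1; rewrite IH //= act_swap bracket_class1 //.
by rewrite act0l addr0 hgt0_even ?class1_hgt // expr0 scale1r.
Qed.

Lemma perm_extract (x : letter N) hs a c :
  perm_eq (x :: hs) (a ++ x :: c) -> perm_eq hs (a ++ c).
Proof.
by move=> P; rewrite -(perm_cons x) (perm_trans P) // -[x :: c]cat1s perm_catCA.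
Qed.

(** Creation operators commute: two negative modes are never opposite, so that the
    cocycle vanishes. *)
Lemma fock_perm hs hs' m : in_class 1 hs -> perm_eq hs hs' -> word hs m = word hs' m.
Proof.
elim: hs hs' => [|x hs IH] hs' /=.
  by move=> _; rewrite perm_sym => /perm_nilP ->.
case/andP=> /eqP x1 hs1 P; have xhs' : x \in hs' by rewrite -(perm_mem P) mem_head.
have hs'1 : in_class 1 hs' by rewrite /in_class -(perm_all _ P) /= x1.
case/splitPr: xhs' P hs'1 => a c P; rewrite /in_class all_cat => /andP[a1 _].
by rewrite fock_front //= (IH (a ++ c)) ?(perm_extract P).
Qed.

Definition shorter (m : M) (n : nat) (v : M) : Prop :=
  exists w, [/\ in_class 0 w, (size w < n)%N & v = word w m].

Lemma shorter_cons m n y v : lcl y = 0%N -> lspan (shorter m n) v ->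
  lspan (shorter m n.+1) (act (e y) v).
Proof.
move=> y0; apply: act_lspan => u [w [w0 lt_n ->]]; apply: lspan_gen.
by exists (y :: w); rewrite /= y0 w0.
Qed.

Lemma bracket_class0 x y w m : lcl x = 0%N -> lcl y = 0%N -> in_class 0 w ->
  lspan (shorter m (size w).+2) (act (afl (e x) (e y)) (word w m)).
Proof.
move=> /eqP; rewrite class0E => x0 /eqP; rewrite class0E => y0 w0.
apply: act_lspanl (bracket_degree x y) => l [l0 _]; apply: lspan_gen.
by exists (l :: w); rewrite /= class0E l0 w0; split=> //; lia.
Qed.

Lemma exchange_front a x c m : in_class 0 (a ++ x :: c) -> exists s : F,
  lspan (shorter m (size (a ++ x :: c))) (word (x :: a ++ c) m - s *: word (a ++ x :: c) m).
Proof.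
elim: a => [|y a IH]; first by exists 1; rewrite scale1r subrr; apply: lspan0.
have -> : in_class 0 ((y :: a) ++ x :: c) = (lcl y == 0%N) && in_class 0 (a ++ x :: c).
  by [].
case/andP=> /eqP y0 axc; have [s Hs] := IH axc; move: axc; rewrite /in_class all_cat /=.
case/and3P=> a0 /eqP x0 c0; exists ((-1) ^+ (par x && par y) * s).
have ac0 : in_class 0 (a ++ c) by rewrite /in_class all_cat a0.
have -> : word (x :: (y :: a) ++ c) m - ((-1) ^+ (par x && par y) * s) *: word ((y :: a) ++ x :: c) m
   = (-1) ^+ (par x && par y) *:
       act (e y) (word (x :: a ++ c) m - s *: word (a ++ x :: c) m)
     + act (afl (e x) (e y)) (word (a ++ c) m).
  by rewrite actB scalerBr scalerA addrAC -act_swap.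
apply: lspanD; first exact/lspanZ/shorter_cons.
have := bracket_class0 m x0 y0 ac0.
by rewrite !size_cat /= !addnS.
Qed.

(** Each exchange of neighbours costs a sign and a bracket, and the bracket gives a
    shorter word. *)
Lemma exchange_perm u u' m : in_class 0 u -> perm_eq u u' -> exists s : F,
  lspan (shorter m (size u)) (word u m - s *: word u' m).
Proof.
elim: u u' => [|x u IH] u' /=.
  move=> _; rewrite perm_sym => /perm_nilP ->; exists 1.
  by rewrite scale1r subrr; apply: lspan0.
case/andP=> /eqP x0 u0 P; have xu' : x \in u' by rewrite -(perm_mem P) mem_head.
have u'0 : in_class 0 u' by rewrite /in_class -(perm_all _ P) /= x0.
have := perm_size P; case/splitPr: xu' P u'0 => a c P u'0 sz.
have [s1 H1] := exchange_front m u'0.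
have Puac := perm_extract P; have [s2 H2] := IH (a ++ c) u0 Puac.
exists (s2 * s1).
have -> : act (e x) (word u m) - (s2 * s1) *: word (a ++ x :: c) m =
    act (e x) (word u m - s2 *: word (a ++ c) m)
      + s2 *: (word (x :: a ++ c) m - s1 *: word (a ++ x :: c) m).
  by rewrite actB scalerBr scalerA addrA subrK.
by apply: lspanD; [apply: shorter_cons|apply: lspanZ; rewrite -sz in H1].
Qed.

Definition sorted_neg (w : seq (letter N)) : bool :=
  in_class 0 w && sorted (fun x y => ~~ bad x y) w.

(** A sorted word may still repeat an odd letter; its square is half its bracket with
    itself, which gives a shorter word. *)
Lemma sort_neg ys m : in_class 0 ys ->
  lspan (fun v => exists I, [/\ sorted_neg I, (size I <= size ys)%N & v = word I m])
    (word ys m).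
Proof.
have [n] := ubnP (size ys); elim: n ys => // n IH ys; rewrite ltnS => le_n ys0.
have low k v : (k <= n)%N -> lspan (shorter m k) v ->
    lspan (fun v => exists I, [/\ sorted_neg I, (size I < k)%N & v = word I m]) v.
  move=> kn; apply: lspan_sub => u [w [w0 wk ->]].
  apply: lspan_mono (IH w (leq_trans wk kn) w0) => _ [I [I0 Iw ->]].
  by exists I; split=> //; apply: leq_ltn_trans Iw wk.
pose u' := sort letter_le ys; have P : perm_eq ys u' by rewrite perm_sym perm_sort.
have u'0 : in_class 0 u' by rewrite /in_class -(perm_all _ P).
have [s /(low _ _ le_n) H] := exchange_perm m ys0 P.
rewrite -[word ys m](subrK (s *: word u' m)); apply: lspanD.
  by apply: lspan_mono H => _ [I [I0 Iw ->]]; exists I; split=> //; apply: ltnW.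
apply: lspanZ; have := first_badP par lt u'; case E: (first_bad _ _ _) => [[[[a x] y] c]|].
  case=> u'E xy; have /eqP exy : x == y.
    have := sort_sorted letter_le_total ys; rewrite -/u' u'E => /cat_sorted2[_] /=.
    by case/andP=> xy' _; move: xy; rewrite /bad; move: xy'; rewrite /letter_le => /negPf ->
      /= /andP[].
  subst y; have px : par x by case/orP: xy => [|/andP[]//]; rewrite (order_irr boP).
  have := u'0; rewrite u'E /in_class all_cat /= => /and4P[a0 /eqP x0 _ c0].
  have -> : word (a ++ [:: x, x & c]) m =
      2%:R^-1 *: word a (act (afl (e x) (e x)) (word c m)).
    rewrite word_cat /= -wordZ; congr (word a _).
    apply: (scalerI (char0 1)); rewrite scalerA divff ?char0 // scale1r.
    have := act_swap x x (word c m); rewrite px expr1 scaleN1r => /eqP.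
    by rewrite eq_sym addrC subr_eq eq_sym -mulr2n scaler_nat => /eqP.
  have ac0 : in_class 0 (a ++ c) by rewrite /in_class all_cat a0.
  apply: lspanZ.
  have sz : size ys = (size a + (size c).+2)%N by rewrite -(size_sort letter_le) -/u' u'E size_cat.
  have : lspan (shorter m (size ys)) (word a (act (afl (e x) (e x)) (word c m))).
    apply: word_lspan (bracket_class0 m x0 x0 c0) => _ [w [w0 wc ->]].
    apply: lspan_gen; exists (a ++ w); split; last by rewrite word_cat.
      by rewrite /in_class all_cat; apply/andP.
    by rewrite size_cat sz ltn_add2l.
  by move/(low _ _ le_n); apply: lspan_mono => _ [I [I0 Iw ->]]; exists I; split=> //; apply: ltnW.
move=> su'; apply: lspan_gen; exists u'; split=> //; first by rewrite /sorted_neg u'0.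
by rewrite size_sort.
Qed.

Definition sorted_fock (w : seq (letter N)) : bool := in_class 1 w && sorted letter_le w.

Lemma normal_cat I hs : sorted_neg I -> sorted_fock hs -> normal (I ++ hs).
Proof.
case/andP=> I0 sI /andP[hs1 /(class1_good hs1) shs]; apply/andP; split; last first.
  rewrite all_cat; apply/andP; split; apply/allP => k.
    by move/(allP I0); rewrite /borel_letter => /eqP ->.
  by move/(allP hs1); rewrite /borel_letter => /eqP ->.
move: sI shs; rewrite !(sorted_pairwise good_pair_trans) pairwise_cat => -> ->.
rewrite !andbT; apply/allrelP => x y /(allP I0)/eqP x0 /(allP hs1)/eqP y1.
have xy : lt x y by rewrite /letter_lt x0 y1.
rewrite good_pairE /letter_le letter_lt_asym //=; apply/negP => /andP[/eqP E _].
by rewrite E (order_irr boP) in xy.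
Qed.

(** The coordinate of a vector on a sorted word; creation operators need not be
    sorted since they commute. *)
Lemma coordinate_form I' m1 : in_class 0 I' -> in_class 1 m1 ->
  exists T : M -> F, linear_form T /\
    forall I hs, sorted_neg I -> in_class 1 hs ->
      T (word I (word hs vac)) = ((I == I') && perm_eq hs m1)%:R.
Proof.
move=> I'0 m11; have [T [lT TE]] := word_forms (fun w => (w == I' ++ sort letter_le m1)%:R).
exists T; split=> // I hs sI hs1.
have sh : sorted_fock (sort letter_le hs).
  by rewrite /sorted_fock /in_class all_sort [all _ _]hs1 sort_sorted //; apply: letter_le_total.
rewrite (fock_perm vac hs1 (hs' := sort letter_le hs)) ?perm_sort //; last first.
  by rewrite perm_sym perm_sort.
rewrite -word_cat TE ?normal_cat //; congr (nat_of_bool _)%:R.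
have filt (I1 h1 : seq (letter N)) : in_class 0 I1 -> in_class 1 h1 ->
    [seq k <- I1 ++ h1 | lcl k == 0%N] = I1.
  move=> I10 h11; rewrite filter_cat (all_filterP I10).
  rewrite -[RHS]cats0; congr (_ ++ _); apply/eqP; rewrite -(negbK (_ == _)) -has_filter.
  by rewrite -all_predC; apply: sub_all h11 => k /eqP /= ->.
have sPP := perm_sortP letter_le_total letter_le_trans letter_le_anti hs m1.
apply/eqP/andP => [E|[/eqP -> /sPP -> //]].
have EI : I = I'.
  case/andP: sI => I0 _; rewrite -(filt I (sort letter_le hs)) // ?E ?filt //.
    by rewrite /in_class all_sort.
  by rewrite /in_class all_sort.
split; first by rewrite EI.
by apply/sPP; move/eqP: E; rewrite EI eqseq_cat // eqxx => /eqP.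
Qed.

Lemma fock_stable k m : hgt k = 0 -> fock m -> lspan fock (act (e k) m).
Proof. by move=> k0 [hs hs1 ->]; apply: fock_hgt0. Qed.

Lemma fock_killed k m : 0 < hgt k -> fock m -> act (e k) m = 0.
Proof. by move=> k0 [hs hs1 ->]; apply: fock_pos. Qed.

Lemma lowered_span v : lspan (fun u => exists n, lowered fock n u) v.
Proof.
move: v; apply: vac_ind => [c m n|X m||]; first by move=> *; apply/lspanD => //; apply: lspanZ.
- apply: act_lspan => _ [n [ys [u [ys0 Bu _ ->]]]].
  apply: act_lspanl (affine_lspan X) => k _.
  apply: lspan_mono (act_lowered k fock_stable fock_killed ys0 Bu) => w Hw.
  by exists (hgt k + total_ht ys).
- exact: lspan0.
apply: lspan_gen; exists 0, [::], vac; split; rewrite ?/total_ht ?big_nil //.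
by exists [::].
Qed.

(** The spanning half of the Poincare-Birkhoff-Witt theorem. *)
Lemma sorted_expansion v : exists (W : seq (seq (letter N) * seq (letter N))) (c : _ -> F),
  [/\ uniq W, forall p, p \in W -> (sorted_neg p.1 && sorted_fock p.2) /\ c p != 0 &
    v = \sum_(p <- W) c p *: word p.1 (word p.2 vac)].
Proof.
apply: lspan_distinct (fun p => word p.1 (word p.2 vac)) _ _ _.
apply: lspan_sub (lowered_span v) => _ [n [ys [m [ys0 [hs hs1 ->] _ ->]]]].
apply: lspan_mono (sort_neg (word hs vac) ys0) => _ [I [sI _ ->]].
exists (I, sort letter_le hs) => /=.
  by rewrite sI /sorted_fock /in_class all_sort [all _ _]hs1 sort_sorted //; apply: letter_le_total.
by rewrite -(fock_perm vac hs1 (hs' := sort letter_le hs)) // perm_sym perm_sort.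
Qed.

(** ** Moving an operator through a word of negative letters *)

(** The two kinds of error terms in what follows: words applied to the vector [m]
    itself, without a new creation operator, and words with too few negative letters.
    The coordinates of interest vanish on both ([low_form0]). *)
Definition low (m : M) (n : nat) (v : M) : Prop :=
  (exists2 w, in_class 0 w & v = word w m) \/
  (exists I hs, [/\ in_class 0 I, in_class 1 hs, (size I < n)%N & v = word I (word hs vac)]).

Lemma low_cons m n y v : lcl y = 0%N -> lspan (low m n) v -> lspan (low m n.+1) (act (e y) v).
Proof.
move=> y0; apply: act_lspan => u [[w w0 ->]|[I [hs [I0 hs1 lt_n ->]]]]; apply: lspan_gen.
  by left; exists (y :: w); rewrite //= y0.
by right; exists (y :: I), hs; split=> //=; rewrite y0.
Qed.

Lemma low_mono m n n' v : (n <= n')%N -> lspan (low m n) v -> lspan (low m n') v.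
Proof.
move=> nn'; apply: lspan_mono => u [H|[I [hs [I0 hs1 lt_n ->]]]]; first by left.
by right; exists I, hs; split=> //; apply: leq_trans nn'.
Qed.

Lemma low_hgt0 k ys m n : hgt k = 0 -> in_class 0 ys ->
  lspan (low m n) (act (e k) (word ys m) - word ys (act (e k) m)).
Proof.
move=> k0 ys0; suff : lspan (fun v => exists2 w, in_class 0 w & v = word w m)
    (act (e k) (word ys m) - word ys (act (e k) m)).
  by apply: lspan_mono => u; left.
elim: ys ys0 => [_|y ys IH /andP[y0 ys0]]; first by rewrite subrr; apply: lspan0.
rewrite /= act_swap hgt0_even // expr0 scale1r addrAC -act_sub.
apply: lspanD.
  apply: act_lspan (IH ys0) => u [w w0 ->]; apply: lspan_gen.
  by exists (y :: w); rewrite //= y0.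
apply: act_lspanl (bracket_degree k y) => l [l0 _]; apply: lspan_gen.
by exists (l :: ys); rewrite //= class0E l0 k0 add0r -class0E y0.
Qed.

Lemma low_hgt0l X ys m n : lspan (fun u => exists k, u = e k /\ hgt k = 0) X ->
  in_class 0 ys -> lspan (low m n) (act X (word ys m) - word ys (act X m)).
Proof.
move=> XP ys0; move: X XP.
apply: (lspan_ind (Q := fun X => lspan _ (act X _ - word ys (act X m)))) => [|c u w].
  by rewrite !act0l word0 subrr; apply: lspan0.
move=> [k [-> k0]] Qw; rewrite !act_linearl word_linear opprD addrACA -scalerBr.
by apply: lspanD => //; apply/lspanZ/low_hgt0.
Qed.

Lemma low_pos k ys hs : 0 < hgt k -> in_class 0 ys -> in_class 1 hs ->
  lspan (low (word hs vac) (size ys)) (act (e k) (word ys (word hs vac))).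
Proof.
elim: ys k => [|y ys IH] k k_pos /=; first by move=> _ hs1; rewrite fock_pos //; apply: lspan0.
case/andP=> /eqP y0 ys0 hs1; rewrite act_swap; apply: lspanD.
  by apply/lspanZ/low_cons => //; apply: IH.
apply: act_lspanl (bracket_degree k y) => l [l0 _].
have [l_neg|l_pos|lz] := ltgtP (hgt l) 0.
- by apply: lspan_gen; left; exists (l :: ys); rewrite //= class0E l_neg.
- by apply: low_mono (IH l l_pos ys0 hs1).
rewrite -[act _ _](subrK (word ys (act (e l) (word hs vac)))).
apply: lspanD; first exact: low_hgt0.
apply: word_lspan (fock_stable lz _) => [_ [hs' h1 ->]|]; last by exists hs.
by apply: lspan_gen; right; exists ys, hs'.
Qed.

(** The terms of [X ys m] in which [X] is contracted with one letter of opposite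
    height, the resulting element of the Heisenberg subalgebra acting on [m]. *)
Fixpoint contract (X : affine g) (q : bool) (j : int) (ys : seq (letter N)) (m : M) : M :=
  if ys is y :: ys' then
    (-1) ^+ (q && par y) *: act (e y) (contract X q j ys' m)
      + (if j + hgt y == 0 then word ys' (act (afl X (e y)) m) else 0)
  else 0.

Lemma bracket_degreel X j y : lspan (fun u => exists k, u = e k /\ hgt k = j) X ->
  lspan (fun u => exists k, u = e k /\ hgt k = j + hgt y) (afl X (e y)).
Proof.
apply: (lspan_ind (Q := fun X => lspan _ (afl X (e y)))) => [|c u w].
  by rewrite (affine_lie0l LS Sf); apply: lspan0.
move=> [k [-> <-]] Qw; rewrite [afl _ _](affine_linearl LS Sf); apply: lspanD => //.
by apply/lspanZ; apply: lspan_mono (bracket_degree k y) => _ [l [-> [l0 _]]]; exists l.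
Qed.

(** The bracket of [X] with a letter of the word has negative height, and is then one
    more negative letter, or positive height, and then a second letter is lost, or
    height zero: this is a contraction. *)
Lemma low_contract X q j ys hs : lspan (fun u => exists k, u = e k /\ hgt k = j) X ->
    affine_hom S q X -> 0 < j -> in_class 0 ys -> in_class 1 hs ->
  lspan (low (word hs vac) (size ys).-1)
    (act X (word ys (word hs vac)) - contract X q j ys (word hs vac)).
Proof.
move=> XP hX j_pos ys0 hs1; elim: ys ys0 => [_|y ys IH /andP[/eqP y0 ys0]] /=.
  rewrite subr0; apply: act_lspanl XP => k kj.
  by rewrite fock_pos ?kj //; apply: lspan0.
rewrite (act_lie _ hX (letter_affine_hom y)) opprD addrACA -scalerBr; apply: lspanD.
  rewrite -act_sub; apply: lspanZ.
  case: ys ys0 IH => [|y' ys] ys0 IH; last by apply: low_cons => //; apply: IH.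
  rewrite /= subr0 (_ : act X _ = 0) ?act0; first exact: lspan0.
  apply: lspan_false; apply: act_lspanl XP => k kj.
  by rewrite fock_pos ?kj //; apply: lspan0.
have XyP := bracket_degreel y XP; case: eqP => [jy|jy].
  by apply: low_hgt0l => //; rewrite jy in XyP.
rewrite subr0; apply: act_lspanl XyP => l lj.
have [l_neg|l_pos|l0] := ltgtP (hgt l) 0.
- by apply: lspan_gen; left; exists (l :: ys); rewrite //= class0E l_neg.
- exact: low_pos.
by case: jy; rewrite -lj.
Qed.

(** ** Dual vectors *)

Lemma form_coord x : (forall i : 'I_N, form x b`_i = 0) -> x = 0.
Proof.
move=> x0; apply: (form_nondegenerate Sf) => y; rewrite (tb_sum tbP y).
elim/big_rec: _ => [|i u _ E]; first exact: form_zeror Sf x.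
by rewrite (form_linearr Sf) x0 E mulr0 addr0.
Qed.

(** The Gram matrix of the basis is invertible. A vector is determined by its pairings
    with the basis, so the dual vector is a homogeneous weight vector. *)
Lemma dual_vector j0 : exists x, [/\ forall i : 'I_N, form x b`_i = (i == j0)%:R,
  root_space S (- wt j0 : hdual h) x & homog S (pa j0) x].
Proof.
have form_sum (c : 'I_N -> F) y : form (\sum_k c k *: b`_k) y = \sum_k c k * form b`_k y.
  elim/big_rec2: _ => [|k u v _ <-]; first exact: form_zerol Sf y.
  exact: (form_linearl Sf).
pose G : 'M[F]_N := \matrix_(k, i) form b`_k b`_i.
have G_unit : G \in unitmx.
  rewrite -row_free_unit; apply: inj_row_free => u uG.
  have u0 : \sum_k u 0 k *: b`_k = 0.
    apply: form_coord => i; rewrite form_sum; have := congr1 (fun A : 'rV_N => A 0 i) uG.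
    by rewrite !mxE => E; rewrite -[RHS]E; apply: eq_bigr => k _; rewrite mxE.
  apply/rowP => k; rewrite mxE.
  by have := congr1 (coord b k) u0; rewrite coord_sum_free ?(tb_free tbP) // linear0.
pose x := \sum_k (invmx G) j0 k *: b`_k.
have xE (i : 'I_N) : form x b`_i = (i == j0)%:R.
  rewrite form_sum; have := congr1 (fun A : 'M_N => A j0 i) (mulVmx G_unit).
  rewrite !mxE eq_sym => E; rewrite -[RHS]E; apply: eq_bigr => k _; by rewrite mxE.
exists x; split=> // [eta|].
  apply/eqP; rewrite -subr_eq0; apply/eqP; apply: form_coord => i.
  rewrite lfunE /= -scaleNr opprK addrC (form_linearl Sf).
  have -> : lie S (vsval eta) x = - lie S x (vsval eta).
    by rewrite (lie_h_skew LS h_even x (valP eta)) opprK.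
  rewrite -[- _]addr0 -scaleN1r (form_linearl Sf) (form_zerol Sf) addr0 (form_invariant Sf).
  rewrite (tb_root tbP) -[_ *: _]addr0 (form_linearr Sf) (form_zeror Sf) addr0 xE.
  by case: eqP => [->|_]; rewrite mulN1r ?mulr0 subrr.
have [x0 [x1 [h0 h1 E]]] := hom_sum LS x.
have [y [z [hy hz Ex]]] : exists y z, [/\ homog S (pa j0) y, homog S (~~ pa j0) z & x = y + z].
  case: (pa j0); first by exists x1, x0; rewrite E addrC.
  by exists x0, x1.
suff z0 : z = 0 by rewrite Ex z0 addr0.
apply: form_coord => i; have [pi|pi] := eqVneq (pa i) (~~ pa j0); last first.
  by rewrite (form_even Sf hz (tb_homog tbP i)) // eq_sym.
have := xE i; rewrite Ex -[y]scale1r (form_linearl Sf) mul1r.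
rewrite (form_even Sf hy (tb_homog tbP i)) ?pi; last by case: (pa j0).
rewrite add0r => ->; case: eqP => // ij; by move: pi; rewrite ij; case: (pa j0).
Qed.

(** ** Counting the ways to remove a letter *)

(** The signed number of ways in which removing an occurrence of [y0] in the second
    part of the word [pre ++ suf] leaves the word [I']. *)
Fixpoint removals (sg : letter N -> F) (y0 : letter N) (I' pre suf : seq (letter N)) : F :=
  if suf is y :: suf' then
    sg y * removals sg y0 I' (rcons pre y) suf' + ((y == y0) && (pre ++ suf' == I'))%:R
  else 0.

Lemma removals_perm sg y0 I' pre suf : ~~ perm_eq (pre ++ suf) (y0 :: I') ->
  removals sg y0 I' pre suf = 0.
Proof.
elim: suf pre => //= y suf IH pre nP; rewrite IH ?cat_rcons // mulr0 add0r.
case: andP => // -[/eqP Ey /eqP E]; case/negP: nP.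
by rewrite Ey -E -[y0 :: suf]cat1s perm_catCA.
Qed.

Lemma removals_absent sg y0 I' pre suf : y0 \notin suf -> removals sg y0 I' pre suf = 0.
Proof.
elim: suf pre => //= y suf IH pre; rewrite inE negb_or eq_sym => /andP[/negPf -> /IH ->].
by rewrite mulr0 add0r.
Qed.

Lemma removals_nat sg y0 I' pre suf : (forall y, sg y = 1) ->
  exists n : nat, removals sg y0 I' pre suf = n%:R.
Proof.
move=> sg1; elim: suf pre => [|y suf IH] pre /=; first by exists 0%N.
by have [n ->] := IH (rcons pre y); rewrite sg1 mul1r -natrD; eexists.
Qed.

Lemma removals_self sg y0 I' : y0 \notin I' \/ (forall y, sg y = 1) ->
  removals sg y0 I' [::] (y0 :: I') != 0.
Proof.
rewrite /= !eqxx /=; case=> [nI|sg1].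
  by rewrite removals_absent // mulr0 add0r oner_eq0.
have [n ->] := removals_nat y0 I' [:: y0] I' sg1.
by rewrite sg1 mul1r -natrD addn1 char0.
Qed.

Lemma sorted_neg_subseq I I1 : subseq I1 I -> sorted_neg I -> sorted_neg I1.
Proof.
move=> sub /andP[I0 sI]; apply/andP; split.
  by apply/allP => k /(mem_subseq sub)/(allP I0).
exact: (subseq_sorted good_pair_trans sub sI).
Qed.

Lemma act_lp x n m : act (lp x n) m = \sum_k coord b k x *: act (e (inl (k, n))) m.
Proof.
rewrite {1}(tb_sum tbP x); elim/big_rec2: _ => [|k u v _ <-]; first by rewrite in_loop0 act0l.
by rewrite in_loop_linear act_linearl.
Qed.

Lemma form_sum (T : M -> F) (A : Type) (s : seq A) (c : A -> F) (f : A -> M) :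
  linear_form T -> T (\sum_(a <- s) c a *: f a) = \sum_(a <- s) c a * T (f a).
Proof.
move=> lT; elim/big_rec2: _ => [|a u v _ <-]; first exact: linear_form0.
exact: lT.
Qed.

(** ** From a nonzero vector to a nonzero vector of the Fock space *)

Lemma form_sub (T : M -> F) m n : linear_form T -> T (m - n) = T m - T n.
Proof. by move=> lT; rewrite (linear_formD _ _ lT) (linear_formN _ lT). Qed.

Lemma class0_inl (y : letter N) : lcl y = 0%N ->
  exists i n, [/\ y = inl (i, n), ht i < 0 & hgt y = ht i].
Proof. by move/eqP; rewrite class0E; case: y => [[i n]|] //= hi; exists i, n. Qed.

Lemma lp_degree x r j : (forall k, coord b k x != 0 -> ht k = j) ->
  lspan (fun u => exists k, u = e k /\ hgt k = j) (lp x r).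
Proof. by move=> xj; apply: (lp_lspan tbP) => i /xj. Qed.

(** The form [T] asks for the creation letter of mode [r + s0] and for [m0]. All modes
    [r + mode y] are lower than those of [m0], so that only the contraction of a letter
    of mode [s0] can provide this letter; since [x] kills the other basis vectors of the
    same height, this letter is [y0]. *)
Lemma contract_eval (T : M -> F) I' m0 (j0 k0 : 'I_N) (s0 r : int) x pre suf hs :
    let y0 := inl (j0, s0) : letter N in
    let hx := lie S x b`_j0 in
    linear_form T ->
    (forall I hs, sorted_neg I -> in_class 1 hs ->
      T (word I (word hs vac)) = ((I == I') && perm_eq hs (inl (k0, r + s0) :: m0))%:R) ->
    (forall i, ht i = ht j0 -> i != j0 -> lie S x b`_i = 0) ->
    (forall k, coord b k hx != 0 -> ht k = 0) ->
    sorted_neg (pre ++ suf) -> in_class 1 hs ->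
    (forall y, y \in suf -> r + mode y < 0) ->
    (forall y l, y \in suf -> l \in m0 -> r + mode y < mode l) ->
  T (word pre (contract (lp x r) (pa j0) (- ht j0) suf (word hs vac)))
    = coord b k0 hx * (perm_eq hs m0)%:R *
      removals (fun y => (-1) ^+ (pa j0 && par y)) y0 I' pre suf.
Proof.
move=> y0 hx lT TE x_dual hx0 sI hs1; elim: suf pre sI => [|y suf IH] pre sI r_neg fresh /=.
  by rewrite word0 (linear_form0 lT) mulr0.
rewrite wordD wordZ (linear_formD _ _ lT) (linear_formZ _ _ lT).
have -> : word pre (act (e y) (contract (lp x r) (pa j0) (- ht j0) suf (word hs vac)))
    = word (rcons pre y) (contract (lp x r) (pa j0) (- ht j0) suf (word hs vac)).
  by rewrite -cats1 word_cat.
rewrite IH ?cat_rcons //; last first.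
- by move=> z l zs; apply: fresh; rewrite inE zs orbT.
- by move=> z zs; apply: r_neg; rewrite inE zs orbT.
rewrite mulrDr mulrCA; congr (_ + _).
have sI' : sorted_neg (pre ++ suf).
  by apply: sorted_neg_subseq sI; rewrite cat_subseq // subseq_cons.
have /eqP y_cl : lcl y == 0%N.
  by case/andP: sI => /allP + _; apply; rewrite mem_cat mem_head orbT.
have [i [n [Ey hi hy]]] := class0_inl y_cl.
have y_ne : ht i != ht j0 -> (y == y0) = false.
  by rewrite Ey; apply: contraNF => /eqP [->].
case: eqP => [hij|hij]; last first.
  rewrite word0 (linear_form0 lT) y_ne ?mulr0 //; apply/eqP => E; apply: hij.
  by rewrite hy E addNr.
have {}hij : ht i = ht j0 by move: hij; rewrite hy; lia.
have rn : r + n < 0 by have := r_neg y (mem_head _ _); rewrite Ey.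
have -> : affine_lie S form (lp x r) (e y) = lp (lie S x b`_i) (r + n).
  by rewrite Ey [LHS](affine_loop LS Sf) (lt_eqF rn) scale0r addr0.
have [Ei|ij] := eqVneq i j0; last first.
  rewrite x_dual // in_loop0 act0l !word0 (linear_form0 lT) Ey.
  by rewrite (_ : (inl (i, n) == y0) = false) ?mulr0 //; apply: contraNF ij => /eqP [->].
subst i; rewrite -/hx act_lp.
rewrite (_ : word pre _ = \sum_k coord b k hx *:
    word (pre ++ suf) (word (inl (k, r + n) :: hs) vac)); last first.
  rewrite -word_cat; elim/big_rec2: _ => [|k u v _ <-]; first exact: word0.
  by rewrite word_linear.
have TEk k : coord b k hx != 0 -> T (word (pre ++ suf) (word (inl (k, r + n) :: hs) vac))
    = ((pre ++ suf == I') && perm_eq (inl (k, r + n) :: hs) (inl (k0, r + s0) :: m0))%:R.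
  by move=> nz; apply: TE; rewrite //= class1E /= hx0 // eqxx rn.
have nm0 k : inl (k, r + n) \notin m0.
  by apply/negP => lm; have := fresh y _ (mem_head _ _) lm; rewrite Ey /= ltxx.
rewrite form_sum // (bigD1 k0) // big1 => [|k kk].
  rewrite [LHS]addr0; have [->|nz] := eqVneq (coord b k0 hx) 0; first by rewrite !mul0r.
  rewrite TEk // -mulrA; congr (_ * _); rewrite Ey.
  have -> : (inl (j0, n) == y0) = (n == s0) by rewrite /y0; apply/eqP/eqP => [[->]|->].
  have [->|ns] := eqVneq n s0.
    by rewrite perm_cons /=; case: (_ == _) (perm_eq _ _) => [] []; rewrite ?mulr1 ?mulr0.
  rewrite mulr0 (_ : perm_eq _ _ = false) ?andbF //; apply/negP => P.
  have := mem_head (inl (k0, r + n)) hs; rewrite (perm_mem P) inE (negPf (nm0 _)) orbF.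
  by move=> /eqP[]/addrI/eqP; rewrite (negPf ns).
have [->|nz] := eqVneq (coord b k hx) 0; first by rewrite mul0r.
rewrite TEk // (_ : perm_eq _ _ = false) ?andbF ?mulr0 //; apply/negP => P.
have := mem_head (inl (k, r + n)) hs; rewrite (perm_mem P) inE (negPf (nm0 _)) orbF.
by move=> /eqP[E]; rewrite E eqxx in kk.
Qed.

Lemma mode_bound (w : seq (letter N)) :
  exists E : int, 0 <= E /\ forall l, l \in w -> - E <= mode l <= E.
Proof.
elim: w => [|k w [E [E0 IH]]]; first by exists 0.
exists (E + `|mode k|); split; first by rewrite addr_ge0.
by move=> l; rewrite inE => /orP[/eqP ->|/IH]; lia.
Qed.

Lemma far_below (E m n : int) : - E <= m <= E -> - E <= n <= E -> - (E + E + 1) + m < n.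
Proof. lia. Qed.

Lemma seq_argmax (A : eqType) (f : A -> nat) (W : seq A) : W != [::] ->
  exists2 p, p \in W & forall q, q \in W -> (f q <= f p)%N.
Proof.
elim: W => // p [|q W] IH _.
  by exists p; rewrite ?mem_head // => r; rewrite inE => /eqP ->.
have [//|p' p'W max] := IH; have [le|lt] := leqP (f p) (f p').
  exists p'; first by rewrite inE p'W orbT.
  by move=> r; rewrite inE => /orP[/eqP ->|/max].
exists p; rewrite ?mem_head // => r; rewrite inE => /orP[/eqP ->//|/max le].
exact: leq_trans le (ltnW lt).
Qed.

Lemma low_form0 (T : M -> F) I' m1 hs n v : linear_form T ->
    (forall I hs, sorted_neg I -> in_class 1 hs ->
      T (word I (word hs vac)) = ((I == I') && perm_eq hs m1)%:R) ->
    in_class 1 hs -> ~~ perm_eq hs m1 -> (n <= size I')%N ->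
  lspan (low (word hs vac) n) v -> T v = 0.
Proof.
move=> lT TE hs1 nP nI; apply: (lspan_form0 lT) => _ [[w w0 ->]|[I [hs' [I0 h1 lt_n ->]]]].
  apply: (lspan_form0 lT _ (sort_neg _ w0)) => _ [I [sI _ ->]].
  by rewrite TE // (negPf nP) andbF.
apply: (lspan_form0 lT _ (sort_neg _ I0)) => _ [I1 [sI sz ->]].
rewrite TE //; case: eqP => // E; move: (leq_ltn_trans sz lt_n).
by rewrite E ltnNge nI.
Qed.

(** By invariance, the bracket of [x] and [b`_i] pairs with [eta] in [h] as [x] and
    [b`_i] do, times the value of the weight; and the form is non-degenerate on [h], as
    it pairs opposite heights. *)
Lemma lowering_dual j0 : ht j0 != 0 -> exists x, [/\ homog S (pa j0) x,
  forall k, coord b k x != 0 -> ht k = - ht j0,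
  forall i, ht i = ht j0 -> i != j0 -> lie S x b`_i = 0,
  lie S x b`_j0 != 0 &
  forall k, coord b k (lie S x b`_j0) != 0 -> ht k = 0].
Proof.
move=> j0_nz; have [x [xE rx hx]] := dual_vector j0; exists x.
have hN : height (- wt j0) = - (ht j0)%:~R.
  apply/eqP; rewrite -subr_eq0 opprK addrC -(tb_height tbP) -(tb_heightD tbP) subrr.
  by rewrite (height0 tbP).
have hxE (i k : 'I_N) : ht i = ht j0 -> coord b k (lie S x b`_i) != 0 -> ht k = 0.
  move=> hi nz.
  have := coord_root LS tbP (root_spaceD LS h_even hx rx (tb_root tbP i)) nz.
  move/(congr1 height); rewrite (tb_height tbP) (tb_heightD tbP) (tb_height tbP) hi hN.
  by rewrite addNr => /esym/(int_char0 char0).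
have form_h (i : 'I_N) (eta : subvs_of h) :
    form (lie S x b`_i) (vsval eta) = - (wt i eta * (i == j0)%:R).
  rewrite (form_invariant Sf) (lie_h_skew LS h_even b`_i (valP eta)) (tb_root tbP).
  rewrite -scaleNr -[_ *: _]addr0 (form_linearr Sf) (form_zeror Sf) addr0 xE; ring.
split=> // [k nz|i hi ij||k]; last exact: hxE.
- have := coord_root LS tbP rx nz => /(congr1 height).
  by rewrite hN (tb_height tbP) -mulrNz => /(int_inj_char0 char0).
- apply: form_coord => k; have [k0|k0] := eqVneq (ht k) 0.
    have := form_h i (Subvs (tb_zero tbP k0)); rewrite /= => ->.
    by rewrite (negPf ij) mulr0 oppr0.
  rewrite (tb_sum tbP (lie S x b`_i)).
  elim/big_rec: _ => [|l u _ E]; first exact: (form_zerol Sf).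
  rewrite (form_linearl Sf) E addr0.
  have [->|/(hxE _ _ hi) l0] := eqVneq (coord b l (lie S x b`_i)) 0; first by rewrite mul0r.
  have [->|/(ht_form char0 LS Sf h_even tbP)] := eqVneq (form b`_l b`_k) 0; first by rewrite mulr0.
  by rewrite l0 add0r => /eqP; rewrite (negPf k0).
apply: contra_neq j0_nz => E; apply: (wt0_ht0 char0 tbP); apply/lfunP => eta.
have := form_h j0 eta; rewrite E (form_zerol Sf) eqxx mulr1 => /eqP.
by rewrite eq_sym oppr_eq0 => /eqP ->; rewrite lfunE.
Qed.

(** No vector outside the Fock space is killed by all positive loop elements. Take
    a word [y0 I' m0] with the greatest number of negative letters, and contract
    [y0] with its dual, shifted to a very negative power of the loop parameter: the
    new creation operator is recognizable, so that nothing else contributes to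
    the coordinate on [I'] followed by it and [m0]. *)
Lemma lower_step v : v != 0 -> ~ lspan fock v -> exists X j,
  [/\ 0 < j, lspan (fun u => exists k, u = e k /\ hgt k = j) X & act X v != 0].
Proof.
move=> v0 nfock; have [W [c [uW WP Ev]]] := sorted_expansion v.
have W0 : W != [::] by apply: contraNneq v0 => W0; rewrite Ev W0 big_nil.
have [[I0 m0] pW max_size] := seq_argmax (fun p => size p.1) W0.
have [/andP[/= sI0 /andP[m01 sm0]] c0] := WP _ pW.
case: I0 => [|y0 I'] in pW max_size sI0 c0 *.
  case: nfock; rewrite Ev big_seq; elim/big_ind: _ => [|a b' Ha Hb|p pW'].
  - exact: lspan0.
  - exact: lspanD.
  have := max_size p pW'; rewrite leqn0 size_eq0 => /eqP ->.
  have [/andP[_ /andP[h1 _]] _] := WP p pW'.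
  by apply/lspanZ/lspan_gen; exists p.2.
have /eqP y_cl : lcl y0 == 0%N by case/andP: sI0 => /andP[].
have [j0 [s0 [Ey hj0 hy]]] := class0_inl y_cl.
have [|x [hx x_ht x_dual hx_nz hx0]] := lowering_dual (j0 := j0); first by rewrite lt_eqF.
have [k0 ak0] : exists k0 : 'I_N, coord b k0 (lie S x b`_j0) != 0.
  apply/existsP; apply: contraNT hx_nz; rewrite negb_exists => /forallP z.
  rewrite (tb_sum tbP (lie S x b`_j0)) big1 // => k _.
  by move: (z k); rewrite negbK => /eqP ->; rewrite scale0r.
have [E [E0 bound]] := mode_bound (flatten [seq p.1 ++ p.2 | p <- W]).
have bW p l : p \in W -> l \in p.1 ++ p.2 -> - E <= mode l <= E.
  by move=> pW' lp'; apply: bound; apply/flatten_mapP; exists p.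
(* Modes in [v] lie between [- E] and [E]; a shift by [r] moves them below all of these. *)
pose r := - (E + E + 1).
have fresh p p' y l : p \in W -> p' \in W -> y \in p.1 -> l \in p'.2 -> r + mode y < mode l.
  move=> pW1 pW2 yp lp'.
  apply: far_below; first by apply: (bW p) => //; rewrite mem_cat yp.
  by apply: (bW p') => //; rewrite mem_cat lp' orbT.
have r_neg p y : p \in W -> y \in p.1 -> r + mode y < 0.
  move=> pW1 yp; apply: far_below; first by apply: (bW p) => //; rewrite mem_cat yp.
  by rewrite oppr_le0 E0.
have rs0 : r + s0 < 0 by have := r_neg _ y0 pW (mem_head _ _); rewrite Ey.
have k0_ht := hx0 _ ak0.
pose m1 : seq (letter N) := inl (k0, r + s0) :: m0.
have m11 : in_class 1 m1 by rewrite /= class1E /= k0_ht eqxx rs0.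
have I'0 : in_class 0 I' by case/andP: sI0 => /andP[].
have [T [lT TE]] := coordinate_form I'0 m11.
exists (lp x r), (- ht j0); split; rewrite ?oppr_gt0 //; first exact: lp_degree.
have XP := lp_degree r x_ht.
(* The coordinate of [X v] on [I'] followed by [m1] is a nonzero multiple of the
   coefficient of [y0 I' m0] in [v]. *)
apply: contraTneq c0 => Xv0; rewrite negbK.
have Tp p : p \in W -> T (act (lp x r) (word p.1 (word p.2 vac))) =
    coord b k0 (lie S x b`_j0) * (perm_eq p.2 m0)%:R *
      removals (fun y => (-1) ^+ (pa j0 && par y)) y0 I' [::] p.1.
  move=> pW'; have [/andP[sI /andP[h1 _]] _] := WP p pW'.
  have p10 : in_class 0 p.1 by case/andP: sI.
  rewrite Ey -(contract_eval (pre := [::]) (r := r) lT TE x_dual hx0) //=; first last.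
  - by move=> y l yp lm; exact: (fresh _ _ _ _ pW' pW yp lm).
  - by move=> y; apply: r_neg.
  apply/eqP; rewrite -subr_eq0 -form_sub //; apply/eqP.
  apply: (low_form0 lT TE h1) (low_contract XP (affine_hom_loop LS r hx) _ p10 h1).
  - apply/negP => P; have := mem_head (inl (k0, r + s0)) m0.
    rewrite -(perm_mem P) => lp2.
    have := fresh _ _ y0 _ pW pW' (mem_head _ _) lp2.
    by rewrite Ey /= ltxx.
  - by have := max_size p pW'; case: (p.1) => //= *.
  by rewrite oppr_gt0.
have := congr1 T Xv0; rewrite (linear_form0 lT) Ev.
have -> : act (lp x r) (\sum_(p <- W) c p *: word p.1 (word p.2 vac)) =
    \sum_(p <- W) c p *: act (lp x r) (word p.1 (word p.2 vac)).
  elim/big_rec2: _ => [|p u w _ <-]; first exact: act0.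
  exact: act_linear.
rewrite form_sum // (bigD1_seq (y0 :: I', m0)) // big_seq_cond big1 => [|p /andP[pW' np]].
  rewrite [LHS]addr0 Tp // perm_refl mulr1 => /eqP; rewrite mulf_eq0 => /orP[//|].
  rewrite mulf_eq0 (negPf ak0) /= (negPf (removals_self _)) //.
  case: (boolP (pa j0)) => [pj|/negPf pj]; last by right=> y; rewrite expr0.
  left; case/andP: sI0 => _ /=; rewrite (path_sortedE good_pair_trans).
  case/andP=> /allP no _; apply/negP => /no; rewrite good_pairE eqxx Ey /= pj andbF //.
rewrite Tp //; have [P2|] := boolP (perm_eq p.2 m0); last by rewrite mulr0 mul0r mulr0.
have [P1|/removals_perm -> //] := boolP (perm_eq ([::] ++ p.1) (y0 :: I')); last first.
  by rewrite !mulr0.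
have [/andP[/andP[_ s1] /andP[_ s2]] _] := WP p pW'.
case/negP: np; rewrite (surjective_pairing p) xpair_eqE; apply/andP; split; apply/eqP.
  by apply: (sorted_eq letter_le_trans letter_le_anti) P1; apply: good_sorted_le;
    case/andP: sI0.
exact: (sorted_eq letter_le_trans letter_le_anti).
Qed.

Lemma vac_neq0 : vac != 0.
Proof.
have [T [lT TE]] := coordinate_form (I' := [::]) (m1 := [::]) isT isT.
apply/eqP => v0; have := TE [::] [::] isT isT; rewrite /= v0 (linear_form0 lT) => /eqP.
by rewrite eq_sym oner_eq0.
Qed.

Lemma class0_total_ht w : in_class 0 w -> total_ht w <= - (size w)%:Z.
Proof.
elim: w => [|y w IH]; first by rewrite /total_ht big_nil.
case/andP => y0 /IH; rewrite class0E in y0; rewrite /total_ht big_cons -/(total_ht w) /=.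
by lia.
Qed.

Definition above (k : nat) (v : M) : Prop :=
  lspan (fun u => exists n : int, - k%:Z <= n /\ lowered fock n u) v.

Lemma above_exists v : exists k, above k v.
Proof.
move: v (lowered_span v); apply: lspan_ind => [|c u w [n Hn] [k Hk]].
  by exists 0%N; apply: lspan0.
exists (k + `|n|)%N; apply: lspanD.
  by apply/lspanZ/lspan_gen; exists n; split=> //; lia.
by apply: lspan_mono Hk => x [m [km Hx]]; exists m; split=> //; lia.
Qed.

Lemma above0_fock v : above 0 v -> lspan fock v.
Proof.
apply: lspan_mono => _ [n [n0 [ys [m [ys0 Bm nE ->]]]]].
by case: ys ys0 nE => // y ys /class0_total_ht /= le nE; move: n0; rewrite -nE; lia.
Qed.

Lemma above_act k X j v : 0 < j -> lspan (fun u => exists l, u = e l /\ hgt l = j) X ->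
  above k.+1 v -> above k (act X v).
Proof.
move=> j0 XP; apply: act_lspan => _ [n [kn [ys [m [ys0 Bm nE ->]]]]].
apply: act_lspanl XP => l lj.
apply: lspan_mono (act_lowered l fock_stable fock_killed ys0 Bm) => u Hu.
by exists (hgt l + total_ht ys); split=> //; rewrite lj nE; lia.
Qed.

(** Each step raises the least height of the vector, which is at most zero. *)
Lemma fock_reach (Q : M -> Prop) v : (forall X m, Q m -> Q (act X m)) -> Q v -> v != 0 ->
  exists u, [/\ Q u, u != 0 & lspan fock u].
Proof.
move=> Qact Qv v0; have [k] := above_exists v; elim: k v Qv v0 => [|k IH] v Qv v0 Hv.
  by exists v; split=> //; apply: above0_fock.
have [Hf|/(lower_step v0) [X [j [j0 XP Xv]]]] := boolp.EM (lspan fock v).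
  by exists v.
by apply: (IH (act X v)) => //; [apply: Qact|apply: above_act XP Hv].
Qed.

(** ** The Fock space at nonzero level *)

Lemma act_K m : act K m = lambda (cartan_K h) *: m.
Proof.
have Kl := fun X => (affine_K_central Sf X).1.
move: m; apply: vac_ind => [c m n E1 E2|X m Em||].
- by rewrite act_linear E1 E2 scalerDr !scalerA mulrC.
- move: X (affine_lspan X).
  apply: (lspan_ind (Q := fun X => act K (act X m) = _ *: act X m)) => [|c u w].
    by rewrite act0l act0 scaler0.
  move=> [k [-> _]] Ew; rewrite act_linearl act_linear Ew (act_swap (inr true) k) /=.
  rewrite [affine_lie _ _ _ _](Kl (e k)) act0l addr0 expr0 scale1r.
  by rewrite Em actZ scalerDr !scalerA mulrC.
- by rewrite act0 scaler0.
exact: (act_J (k := inr true)).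
Qed.

Lemma heisenberg_vac x n : x \in h -> 0 < n -> act (lp x n) vac = 0.
Proof.
move=> xh n0; rewrite act_lp big1 // => k _.
have [->|nz] := eqVneq (coord b k x) 0; first by rewrite scale0r.
have k0 : ht k = 0.
  by apply: (wt0_ht0 char0 tbP); have := coord_root LS tbP ((hP x).1 xh) nz => <-.
rewrite act_J ?borel_letterE /= ?k0 ?eqxx ?(ltW n0) //=.
by rewrite (gt_eqF n0) scale0r scaler0.
Qed.

Lemma heisenberg_swap x n i k v : x \in h -> ht i = 0 ->
  act (lp x n) (act (e (inl (i, k))) v) = act (e (inl (i, k))) (act (lp x n) v)
    + (if n + k == 0 then n%:~R * form x b`_i else 0) *: (lambda (cartan_K h) *: v).
Proof.
move=> xh i0.
rewrite (act_lie _ (affine_hom_loop LS n (h_even xh)) (letter_affine_hom (inl (i, k)))).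
rewrite expr0 scale1r [afl _ _](affine_loop LS Sf).
have -> : lie S x b`_i = 0.
  by have := (hP _).1 (tb_zero tbP i0) (Subvs xh); rewrite lfunE /= scale0r.
by rewrite in_loop0 add0r actZl act_K.
Qed.

Lemma class1_inl (y : letter N) : lcl y = 1%N ->
  exists i k, [/\ y = inl (i, k), ht i = 0 & k < 0].
Proof.
by move/eqP; rewrite class1E; case: y => [[i k]|] //= /andP[/eqP i0 k0]; exists i, k.
Qed.

(** Elements of [h] times positive powers of the loop parameter act on the Fock space as
    derivations which remove one creation operator. *)
Lemma annihilate (j0 : 'I_N) (n : int) x pre suf (T : M -> F) I' :
    let l0 := inl (j0, - n) : letter N in
    0 < n -> linear_form T -> x \in h -> (forall i : 'I_N, form x b`_i = (i == j0)%:R) ->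
    in_class 1 suf -> sorted_fock (pre ++ suf) ->
    (forall hs, sorted_fock hs -> T (word hs vac) = (hs == I')%:R) ->
  T (word pre (act (lp x n) (word suf vac)))
    = n%:~R * lambda (cartan_K h) * removals (fun=> 1) l0 I' pre suf.
Proof.
move=> l0 n0 lT xh xE suf1 + TE.
elim: suf suf1 pre => [_|y suf IH /andP[/eqP y1 suf1]] pre sI /=.
  by rewrite heisenberg_vac // word0 (linear_form0 lT) mulr0.
have [i [k [Ey i0 k0]]] := class1_inl y1.
rewrite Ey heisenberg_swap // -Ey wordD (linear_formD _ _ lT).
have -> : word pre (act (e y) (act (lp x n) (word suf vac))) =
    word (rcons pre y) (act (lp x n) (word suf vac)) by rewrite -cats1 word_cat.
rewrite IH ?cat_rcons // mul1r mulrDr; congr (_ + _).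
have sI' : sorted_fock (pre ++ suf).
  case/andP: sI => c1 s1; apply/andP; split.
    by move: c1; rewrite /in_class !all_cat /= => /and3P[-> _ ->].
  by apply: (subseq_sorted letter_le_trans _ s1); rewrite cat_subseq // subseq_cons.
rewrite !wordZ -word_cat !(linear_formZ _ _ lT) TE // xE Ey.
have -> : (inl (i, k) == l0) = ((n + k == 0) && (i == j0)).
  rewrite /l0 addrC addr_eq0; apply/eqP/andP => [[-> ->]|[/eqP -> /eqP -> //]].
  by rewrite !eqxx.
by case: (n + k == 0); case: (i == j0); rewrite /= ?mulr1 ?mulr0 ?mul0r ?mulr0 // mulrA.
Qed.

Definition fock_below (k : nat) (v : M) : Prop :=
  lspan (fun u => exists hs, [/\ in_class 1 hs, (size hs < k)%N & u = word hs vac]) v.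

Lemma fock_expansion v k : fock_below k v ->
  exists (W : seq (seq (letter N))) (c : _ -> F), [/\ uniq W,
    forall hs, hs \in W -> (sorted_fock hs && (size hs < k)%N) /\ c hs != 0 &
    v = \sum_(hs <- W) c hs *: word hs vac].
Proof.
move=> Hv; apply: (lspan_distinct (f := fun hs => word hs vac)).
apply: lspan_mono Hv => _ [hs [hs1 sz ->]]; exists (sort letter_le hs) => /=.
  rewrite size_sort sz andbT /sorted_fock /in_class all_sort [all _ _]hs1 sort_sorted //.
  exact: letter_le_total.
by rewrite -(fock_perm vac hs1 (hs' := sort letter_le hs)) // perm_sym perm_sort.
Qed.

Lemma annihilate_below n x k v : x \in h -> 0 < n ->
  fock_below k.+1 v -> fock_below k (act (lp x n) v).
Proof.
move=> xh n0; apply: act_lspan => _ [hs [hs1 sz ->]].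
suff : fock_below (size hs) (act (lp x n) (word hs vac)).
  apply: lspan_mono => _ [hs' [h1 sz' ->]]; exists hs'; split=> //.
  exact: leq_trans sz' sz.
elim: hs hs1 {sz} => [_|y hs IH /andP[/eqP y1 hs1]] /=.
  by rewrite heisenberg_vac //; apply: lspan0.
have [i [m [Ey i0 m0]]] := class1_inl y1; rewrite Ey heisenberg_swap // -Ey.
apply: lspanD; last first.
  by do 2!apply: lspanZ; apply: lspan_gen; exists hs.
apply: act_lspan (IH hs1) => _ [hs' [h1 sz' ->]]; apply: lspan_gen.
by exists (y :: hs'); rewrite /= y1.
Qed.

Lemma fock_below_exists v : lspan fock v -> exists k, fock_below k v.
Proof.
move: v; apply: lspan_ind => [|c u w [hs hs1 ->] [k Hk]]; first by exists 0%N; apply: lspan0.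
exists (k + size hs).+1; apply: lspanD.
  by apply/lspanZ/lspan_gen; exists hs; split=> //; rewrite ltnS leq_addl.
apply: lspan_mono Hk => _ [hs' [h1 lt_k ->]]; exists hs'; split=> //.
by rewrite ltnS (leq_trans (ltnW lt_k)) ?leq_addr.
Qed.

(** The weight of the dual vector is zero. *)
Lemma cartan_dual j0 : ht j0 = 0 ->
  exists2 x, x \in h & forall i : 'I_N, form x b`_i = (i == j0)%:R.
Proof.
move=> j00; have [x [xE rx _]] := dual_vector j0; exists x => //.
apply/hP; have -> : (0 : hdual h) = - wt j0; last by [].
apply/esym/eqP; rewrite oppr_eq0; apply/eqP/esym.
apply: (coord_root LS tbP ((hP _).1 (tb_zero tbP j00))).
by rewrite (tb_coord tbP) eqxx oner_eq0.
Qed.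

(** At nonzero level the Fock space is a simple module of the Heisenberg algebra: take a
    letter [l0] of a word in [v], and apply the derivation dual to it. The coordinate on
    the rest of the word is multiplied by the level and by the number of occurrences of
    [l0], which is not zero in characteristic zero. *)
Lemma vac_reach (Q : M -> Prop) v : lambda (cartan_K h) != 0 ->
    (forall c m n, Q m -> Q n -> Q (c *: m + n)) -> (forall X m, Q m -> Q (act X m)) ->
    Q 0 -> Q v -> v != 0 -> lspan fock v -> Q vac.
Proof.
move=> lam0 Qlin Qact Q0 + + /fock_below_exists[k]; elim: k v => [|k IH] v Qv v0 Hv.
  case/eqP: v0; have [s [Ps ->]] := Hv; case: s Ps => [|p s] Ps; first by rewrite big_nil.
  by have [hs []] := Ps p (mem_head _ _).
have [W [c [uW WP Ev]]] := fock_expansion Hv.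
have [/allP W_nil|] := boolP (all (fun hs => hs == [::]) W).
  have W0 : W != [::] by apply: contraNneq v0 => W0; rewrite Ev W0 big_nil.
  case: W W0 W_nil uW WP Ev => // hs W _ W_nil uW WP Ev.
  have hs_nil : hs = [::] by apply/eqP/W_nil/mem_head.
  have W_empty : W = [::].
    case: W W_nil uW {WP Ev} => // hs' W W_nil; rewrite /= inE hs_nil.
    have /eqP -> : hs' == [::] by apply: W_nil; rewrite !inE eqxx orbT.
    by [].
  have [_ c0] := WP _ (mem_head _ _); move: Ev; rewrite W_empty hs_nil big_seq1 /= => Ev.
  have -> : vac = (c [::])^-1 *: v + 0.
    by rewrite addr0 Ev scalerA mulVf ?scale1r // -hs_nil.
  exact: Qlin.
case/allPn => hs0 hsW hs_nil; have [/andP[/andP[h01 s0] _] c0] := WP _ hsW.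
case: hs0 hs_nil hsW h01 s0 c0 => // l0 I' _ hsW /andP[/eqP l01 I'1] s0 c0.
have [j0 [m [El j00 m0]]] := class1_inl l01.
have [x xh xE] := cartan_dual j00.
have [T [lT TE0]] := coordinate_form (I' := [::]) isT I'1.
have n0 : 0 < - m by rewrite oppr_gt0.
have TE hs : sorted_fock hs -> T (word hs vac) = (hs == I')%:R.
  case/andP=> h1 s1; rewrite (TE0 [::] hs isT h1) /=; congr (nat_of_bool _)%:R.
  apply/idP/eqP => [P|->]; last exact: perm_refl.
  apply: (sorted_eq letter_le_trans letter_le_anti) P => //.
  by move: s0 => /= /path_sorted.
apply: (IH (act (lp x (- m)) v)); [exact: Qact| |exact: annihilate_below].
apply: contraTneq c0 => Xv0; rewrite negbK.
have Tp hs : hs \in W -> T (act (lp x (- m)) (word hs vac)) =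
    (- m)%:~R * lambda (cartan_K h) * removals (fun=> 1) l0 I' [::] hs.
  move=> hW; have [/andP[sh _] _] := WP _ hW; have [h1 _] := andP sh.
  by have := annihilate (pre := [::]) n0 lT xh xE h1 sh TE; rewrite opprK -El.
have := congr1 T Xv0; rewrite (linear_form0 lT) Ev.
have -> : act (lp x (- m)) (\sum_(hs <- W) c hs *: word hs vac) =
    \sum_(hs <- W) c hs *: act (lp x (- m)) (word hs vac).
  elim/big_rec2: _ => [|hs u w _ <-]; first exact: act0.
  exact: act_linear.
rewrite form_sum // (bigD1_seq (l0 :: I')) // big_seq_cond big1 => [|hs /andP[hW nhs]].
  rewrite [LHS]addr0 Tp // => /eqP; rewrite mulf_eq0 => /orP[//|].
  rewrite !mulf_eq0 (negPf lam0) (negPf (removals_self _)); last by right.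
  by rewrite !orbF => /eqP/(int_char0 char0); lia.
rewrite Tp //; have [P|/removals_perm -> //] := boolP (perm_eq ([::] ++ hs) (l0 :: I')).
  case/negP: nhs; apply/eqP; have [/andP[/andP[_ s1] _] _] := WP _ hW.
  exact: (sorted_eq letter_le_trans letter_le_anti).
by rewrite !mulr0.
Qed.

Theorem nonzero_level (Q : M -> Prop) v : lambda (cartan_K h) != 0 ->
    (forall c m n, Q m -> Q n -> Q (c *: m + n)) -> (forall X m, Q m -> Q (act X m)) ->
    Q 0 -> Q v -> v != 0 -> forall m, Q m.
Proof.
move=> lam0 Qlin Qact Q0 Qv v0; have [u [Qu u0 uf]] := fock_reach Qact Qv v0.
by apply: vac_ind => //; apply: vac_reach Qu u0 uf.
Qed.

(** ** Level zero *)

Definition excited (v : M) : Prop :=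
  exists hs, [/\ in_class 1 hs, hs != [::] & v = word hs vac].

(** Only a central term could remove a creation operator, and it is multiplied by the
    level, that is, by zero. *)
Lemma excited_hgt0 k v : lambda (cartan_K h) = 0 -> hgt k = 0 -> excited v ->
  lspan excited (act (e k) v).
Proof.
move=> lam0 k0 [hs [hs1 hs_nil ->]].
have [k1|k1] := boolP (lcl k == 1%N).
  by apply: lspan_gen; exists (k :: hs); rewrite /= k1.
case: k k0 k1 => [[i n]|[]] /=; last first.
- move=> _ _; elim: hs hs1 hs_nil => // y hs IH /andP[y1 hs1] _ /=.
  rewrite (act_swap (inr false) y) /= expr0 scale1r.
  have [i [m [Ey i0 m0]]] := class1_inl (eqP y1).
  have -> : affine_lie S form d (e y) = - m%:~R *: e y.
    by rewrite Ey /=; apply: (affine_d_loop S form).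
  rewrite actZl; apply: lspanD; last first.
    by apply/lspanZ/lspan_gen; exists (y :: hs); rewrite /= y1.
  have [hs_nil|hs_nil] := eqVneq hs [::].
    rewrite hs_nil /= (act_J (k := inr false)) // actZ; apply/lspanZ/lspan_gen.
    by exists [:: y]; rewrite /= y1.
  apply: act_lspan (IH hs1 hs_nil) => _ [hs' [h1 _ ->]]; apply: lspan_gen.
  by exists (y :: hs'); rewrite /= y1.
- by move=> _ _; rewrite act_K lam0 scale0r; apply: lspan0.
move=> i0; rewrite class1E /= i0 eqxx /= -leNgt => n0.
elim: hs hs1 hs_nil => // y hs IH /andP[y1 hs1] _ /=.
have [i' [m [Ey i'0 m0]]] := class1_inl (eqP y1).
rewrite Ey heisenberg_swap ?(tb_zero tbP i0) // -Ey lam0 scale0r scaler0 addr0.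
have [hs_nil|hs_nil] := eqVneq hs [::].
  rewrite hs_nil /= (act_J (k := inl (i, n))); last by rewrite borel_letterE /= i0 eqxx n0 orbT.
  by rewrite actZ; apply/lspanZ/lspan_gen; exists [:: y]; rewrite /= y1.
apply: act_lspan (IH hs1 hs_nil) => _ [hs' [h1 _ ->]]; apply: lspan_gen.
by exists (y :: hs'); rewrite /= y1.
Qed.

Definition excited_submodule (v : M) : Prop :=
  lspan (fun u => exists n, lowered excited n u) v.

Lemma excited_submodule_act X v : lambda (cartan_K h) = 0 ->
  excited_submodule v -> excited_submodule (act X v).
Proof.
move=> lam0; apply: act_lspan => _ [n [ys [u [ys0 Bu _ ->]]]].
apply: act_lspanl (affine_lspan X) => k _.
apply: lspan_mono (act_lowered k _ _ ys0 Bu) => [w Hw|l m l0|l m l0].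
- by exists (hgt k + total_ht ys).
- exact: excited_hgt0.
by move=> [hs [hs1 _ ->]]; apply: fock_pos.
Qed.

(** The coordinate on the empty word vanishes on excited words. *)
Lemma excited_submodule_vac : ~ excited_submodule vac.
Proof.
have [T [lT TE]] := coordinate_form (I' := [::]) (m1 := [::]) isT isT.
move=> Hv; have := TE [::] [::] isT isT; rewrite /= (lspan_form0 lT _ Hv).
  by move=> /eqP; rewrite eq_sym oner_eq0.
move=> _ [n [ys [_ [ys0 [hs [hs1 hs_nil ->]] _ ->]]]].
apply: (lspan_form0 lT _ (sort_neg _ ys0)) => _ [I [sI _ ->]].
rewrite TE // (_ : perm_eq _ _ = false) ?andbF //.
by apply/negP => /perm_nilP E; rewrite E in hs_nil.
Qed.

Lemma excited_submodule_neq0 i : ht i = 0 ->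
  exists2 v, excited_submodule v & v != 0.
Proof.
move=> i0; pose l : letter N := inl (i, -1).
have l1 : in_class 1 [:: l] by rewrite /= class1E /= i0 eqxx.
exists (word [:: l] vac).
  by apply: lspan_gen; exists 0, [::], (word [:: l] vac); split;
    rewrite ?/total_ht ?big_nil //; exists [:: l].
have [T [lT TE]] := coordinate_form (I' := [::]) isT l1.
apply/eqP => E; have := TE [::] [:: l] isT l1; rewrite [word [::] _]E (linear_form0 lT).
by rewrite eqxx perm_refl => /eqP; rewrite eq_sym oner_eq0.
Qed.

End VermaWords.

(** * Simplicity of the Verma module *)

Section VermaSimple.
Variables (F : fieldType) (g : vectType F) (S : superBracket g).
Variables (form : g -> g -> F) (h : {vspace g}) (Sigma : seq (hdual h)).
Variables (N : nat) (b : N.-tuple g) (pa : 'I_N -> bool) (wt : 'I_N -> hdual h).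
Variables (ht : 'I_N -> int) (height : hdual h -> F).
Hypothesis char0 : forall n, n.+1%:R != 0 :> F.
Hypothesis LS : lie_superalgebra S.
Hypothesis Sf : invariant_form S form.
Hypothesis hP : forall x, x \in h <-> root_space S (0 : hdual h) x.
Hypothesis h_even : forall x, x \in h -> homog S false x.
Hypothesis tbP : triangular_basis S Sigma b pa wt ht height.
Variable lambda : 'Hom(affine_cartan h, F^o).

Local Notation AS := (affine_superalgebra S form).
Local Notation rho := (@borel_character F g S h Sigma lambda).
Local Notation M := (induced AS rho).
Local Notation act := (@induced_act F (affine g) AS rho).
Local Notation vac := (induced_pi rho (1 : enveloping AS)).
Local Notation e := (letter_elt b).

Lemma verma_word_forms (f : seq (letter N) -> F) : exists T : M -> F, linear_form T /\
  forall w, normal (letter_par pa) (letter_lt ht) (borel_letter ht) w ->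
    T (word b act w vac) = f w.
Proof.
apply: (induced_form_exists (letter_basisP form LS tbP) (letter_bracketP LS Sf tbP)
  (borel_lettersP char0 LS Sf hP h_even tbP lambda) char0).
by move=> X c Xc phi z; apply: (ext_rho char0 LS hP tbP Xc).
Qed.

Lemma verma_act_lie i j X Y (m : M) : affine_hom S i X -> affine_hom S j Y ->
  act X (act Y m) = (-1) ^+ (i && j) *: act Y (act X m) + act (lie AS X Y) m.
Proof. by move=> hX hY; apply: (induced_act_lie (S := AS) _ hX hY). Qed.

Lemma verma_act_J k : borel_letter ht k -> act (e k) vac = letter_chi b ht lambda k *: vac.
Proof. by move=> Jk; apply: induced_act_rho; apply: (rho_letter char0 tbP). Qed.

Lemma verma_word_homog w : exists i, exists2 u, env_monomial i u &
  word b act w vac = induced_pi rho u.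
Proof.
elim: w => [|k w [i [u iu E]]]; first by exists false, 1; first exact: Env_monomial1.
exists (letter_par pa k (+) i), (env_gen AS (e k) * u).
  by apply: Env_monomialM iu; apply: (letter_homog (letter_basisP form LS tbP) k).
apply: etrans (induced_act_pi rho (e k) u).
by rewrite -E.
Qed.

(** Words in letters are homogeneous. *)
Lemma excited_graded v : excited_submodule b ht act vac v -> exists v0 v1,
  [/\ excited_submodule b ht act vac v0, excited_submodule b ht act vac v1,
      induced_hom false v0, induced_hom true v1 & v = v0 + v1].
Proof.
have hom_lin i c (m n : M) : induced_hom i m -> induced_hom i n -> induced_hom i (c *: m + n).
  move=> [u hu ->] [w hw ->]; exists (c *: u + w); last by rewrite induced_pi_linear.
  by apply: lspanD => //; apply: lspanZ.
have hom0 i : induced_hom i (0 : M).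
  by exists 0; [apply: lspan0|rewrite induced_pi0].
move: v; apply: lspan_ind => [|c u w [n Hn] [v0 [v1 [E0 E1 h0 h1 ->]]]].
  by exists 0, 0; rewrite addr0; split=> //; apply: lspan0.
have Ep : excited_submodule b ht act vac u by apply: lspan_gen; exists n.
have [i hp] : exists i, induced_hom i u.
  case: Hn => [ys [_ [_ [hs [_ _ ->]] _ Ep2]]].
  have [i [z iz Ez]] := verma_word_homog (ys ++ hs).
  by exists i, z; [apply: lspan_gen|rewrite Ep2 -Ez /word foldr_cat].
case: i hp => hp.
  exists v0, (c *: u + v1); split=> //; last by rewrite addrCA.
    by apply: lspanD => //; apply: lspanZ.
  exact: hom_lin.
exists (c *: u + v0), v1; split=> //; last by rewrite addrA.
  by apply: lspanD => //; apply: lspanZ.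
exact: hom_lin.
Qed.

Theorem verma_simple_iff i0 : ht i0 = 0 ->
  simple_module (verma S form Sigma lambda) <-> lambda (cartan_K h) <> 0.
Proof.
move=> i0_0; have alin := @induced_act_linear F (affine g) AS rho.
have alinl := @induced_act_linearl F (affine g) AS rho.
have ind Q Q1 Q2 Q3 Q4 := @induced_ind F (affine g) AS rho Q Q1 Q2 Q3 Q4.
split=> [[_ simp] /eqP lam0|/eqP lam0].
  have [|Nz|Nall] := simp (excited_submodule b ht act vac).
  - split=> [|c x y Hx Hy|X x Hx|]; first exact: lspan0.
    + by apply: lspanD => //; apply: lspanZ.
    + apply: (excited_submodule_act char0 LS Sf hP h_even tbP alin alinl verma_act_lie
        verma_act_J ind) Hx; exact/eqP.
    + exact: excited_graded.
  - have [v Hv /eqP v0] := excited_submodule_neq0 char0 LS Sf hP h_even tbP lambda alinl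
      verma_act_lie verma_word_forms i0_0.
    by apply: v0; apply: Nz.
  by apply: (excited_submodule_vac char0 LS Sf hP h_even tbP lambda alin alinl verma_act_lie
    verma_word_forms); apply: Nall.
split.
  exists vac; exact: (vac_neq0 char0 LS Sf hP h_even tbP lambda alinl verma_act_lie
    verma_word_forms).
move=> Q [Q0 Qlin Qact _]; have [Qz|/boolp.existsNP[v /boolp.not_implyP[Qv /eqP v0]]] :=
  boolp.EM (forall x, Q x -> x = 0); first by left.
right; apply: (nonzero_level char0 LS Sf hP h_even tbP alin alinl verma_act_lie
  verma_act_J ind verma_word_forms) lam0 Qlin Qact Q0 Qv v0.
Qed.

End VermaSimple.

(** * Central elements of the listed superalgebras *)

Section GeneralLinearCenter.
Variables (F : fieldType) (m n : nat).
Implicit Types (X Y z : 'M[F]_(m + n)).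

Local Notation par := (@idx_parity m n).

Lemma gl_hom_entry c X i j : gl_hom c X -> par i (+) par j != c -> X i j = 0.
Proof. by move=> /matrixP/(_ i j); rewrite mxE => <- /negPf ->. Qed.

Lemma mx_part_other c X : gl_hom c X -> mx_part (~~ c) X = 0.
Proof.
move=> hX; apply/matrixP => i j; rewrite !mxE; case: eqP => // E.
by rewrite (gl_hom_entry hX) ?E //; case: (c).
Qed.

Lemma gl_lieE a b X Y : gl_hom a X -> gl_hom b Y ->
  gl_lie X Y = X *m Y - (-1) ^+ (a && b) *: (Y *m X).
Proof.
move=> hX hY; have pX := mx_part_other hX; have pY := mx_part_other hY.
rewrite /gl_lie (bigD1 a) //= (bigD1 b) //= [mx_part a X]hX [mx_part b Y]hY.
rewrite big1 ?addr0 => [|b' nb]; last first.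
  have -> : b' = ~~ b by case: (b) (b') nb => [] [].
  by rewrite pY mulmx0 mul0mx scaler0 subr0.
rewrite big1 ?addr0 // => a' na; apply: big1 => b' _.
have -> : a' = ~~ a by case: (a) (a') na => [] [].
by rewrite pX mulmx0 mul0mx scaler0 subr0.
Qed.

(** Compare the upper right blocks of [z X] and [X z], when the upper right block of [X]
    has a single entry: an even diagonal entry of [z] equals an odd one, and off-
    diagonal entries vanish. *)
Lemma even_center_scalar (P : 'M[F]_(m + n) -> Prop) z i0 j0 :
    ~~ par i0 -> par j0 -> gl_hom false z ->
    (forall i j, ~~ par i -> par j -> exists X, [/\ P X, gl_hom true X &
      forall a b, ~~ par a -> par b -> X a b = ((a == i) && (b == j))%:R]) ->
    (forall X, P X -> gl_lie z X = 0) ->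
  z = (z i0 i0)%:M.
Proof.
move=> pi0 pj0 hz exX zX.
have E i j a b : ~~ par i -> par j -> ~~ par a -> par b ->
    z a i * (b == j)%:R = (a == i)%:R * z j b.
  move=> pi pj pa pb; have [X [PX hX XE]] := exX i j pi pj.
  have := zX X PX; rewrite (gl_lieE hz hX) expr0 scale1r => /eqP.
  rewrite subr_eq0 => /eqP/matrixP/(_ a b); rewrite !mxE.
  rewrite (bigD1 i) //= big1 ?addr0; last first.
    move=> c ci; have [pc|/negPf pc] := boolP (par c).
      by rewrite (gl_hom_entry hz) ?mul0r // (negPf pa) pc.
    by rewrite XE ?pc // (negPf ci) mulr0.
  rewrite (bigD1 j) //= big1 ?addr0; last first.
    move=> c cj; have [pc|/negPf pc] := boolP (par c).
      by rewrite XE // (negPf cj) andbF mul0r.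
    by rewrite (gl_hom_entry hz) ?mulr0 // pb pc.
  by rewrite !XE // !eqxx andbT.
have diag i j : ~~ par i -> par j -> z i i = z j j.
  by move=> pi pj; have := E i j i j pi pj pi pj; rewrite !eqxx mulr1 mul1r.
apply/matrixP => a b; rewrite mxE; have [<-|ab] := eqVneq a b.
  rewrite mulr1n; have [pa|pa] := boolP (par a); first by rewrite (diag i0 a).
  by rewrite (diag a j0) // -(diag i0 j0).
rewrite mulr0n; have [pab|pab] := eqVneq (par a (+) par b) false; last first.
  exact: gl_hom_entry hz pab.
have [pa|pa] := boolP (par a).
  have pb : par b by move: pab; rewrite pa; case: (par b).
  have := E i0 a i0 b pi0 pa pi0 pb; rewrite eqxx mul1r => <-.
  by rewrite eq_sym (negPf ab) mulr0.
have pb : ~~ par b by move: pab; rewrite (negPf pa) /=; case: (par b).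
have := E b j0 a j0 pb pj0 pa pj0; rewrite eqxx mulr1 => ->.
by rewrite (negPf ab) mul0r.
Qed.

Hypothesis char0 : forall n, n.+1%:R != 0 :> F.

Lemma gl_lie_even X Y : gl_hom false X -> gl_hom false Y -> gl_hom false (gl_lie X Y).
Proof.
move=> hX hY; rewrite (gl_lieE hX hY) expr0 scale1r; apply/matrixP => i j; rewrite !mxE.
have [//|nij] := eqVneq (par i (+) par j) false.
rewrite mulr0n; apply/esym/eqP; rewrite subr_eq0; apply/eqP.
rewrite !big1 // => l _.
  have [jl|jl] := eqVneq (par l (+) par j) false; last first.
    by rewrite (gl_hom_entry hX jl) mulr0.
  rewrite (gl_hom_entry hY) ?mul0r //.
  by apply: contra nij => /eqP E; move: jl E; case: (par i) (par j) (par l) => [] [] [].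
have [jl|jl] := eqVneq (par l (+) par j) false; last first.
  by rewrite (gl_hom_entry hY jl) mulr0.
rewrite (gl_hom_entry hX) ?mul0r //.
by apply: contra nij => /eqP E; move: jl E; case: (par i) (par j) (par l) => [] [] [].
Qed.

(** A commutator of even matrices has trace zero, so it vanishes when it is scalar. *)
Lemma even_commutator_center (P : 'M[F]_(m + n) -> Prop) e f X1 :
    gl_hom false e -> gl_hom false f -> gl_hom true X1 -> X1 != 0 ->
    (forall i j, ~~ par i -> par j -> exists X, [/\ P X, gl_hom true X &
      forall a b, ~~ par a -> par b -> X a b = ((a == i) && (b == j))%:R]) ->
    (forall X, P X -> gl_lie (gl_lie e f) X = 0) ->
  gl_lie e f = 0.
Proof.
move=> he hf hX1 X1_nz exX zX.
have [i0 [j0 [pi0 pj0]]] : exists i0 j0, ~~ par i0 /\ par j0.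
  apply: contrapT => no; case/eqP: X1_nz; apply/matrixP => a b; rewrite [RHS]mxE.
  have [pab|pab] := eqVneq (par a (+) par b) true; last exact: gl_hom_entry hX1 pab.
  case: no; move: pab; case pa: (par a) => /= pb; last by exists a, b; rewrite pa pb.
  by exists b, a; rewrite pa; split=> //; rewrite pb.
have Ez := even_center_scalar pi0 pj0 (gl_lie_even he hf) exX zX.
set c := (gl_lie e f) i0 i0 in Ez.
have := congr1 mxtrace Ez; rewrite {1}(gl_lieE he hf) expr0 scale1r mxtrace_scalar.
rewrite linearB /= mxtrace_mulC subrr => /esym/eqP; rewrite -mulr_natr mulf_eq0.
have mn : (0 < m + n)%N by apply: leq_ltn_trans (ltn_ord i0).
have nz : (m + n)%:R != 0 :> F by have := char0 (m + n).-1; rewrite prednK.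
by rewrite (negPf nz) orbF => /eqP c0; rewrite Ez c0 raddf0.
Qed.

End GeneralLinearCenter.

Lemma gl_hom_delta (F : fieldType) m n (i j : 'I_(m + n)) :
  gl_hom (idx_parity i (+) idx_parity j) (delta_mx i j : 'M[F]_(m + n)).
Proof.
apply/matrixP => a b; rewrite !mxE; case: (a =P i) => [->|_] /=; last exact: mul0rn.
by case: (b =P j) => [->|_] /=; [rewrite eqxx | exact: mul0rn].
Qed.

Lemma supertrace_delta (F : fieldType) m n (i j : 'I_(m + n)) : i != j ->
  supertrace (delta_mx i j : 'M[F]_(m + n)) = 0.
Proof.
move=> ij; apply: big1 => a _; rewrite mxE.
case: (a =P i) => [->|_]; last by rewrite mulr0.
by rewrite (negPf ij) mulr0.
Qed.

Section Orthosymplectic.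
Variables (F : fieldType) (m k : nat).
Implicit Types (X : 'M[F]_(m + (k + k))).

Local Notation J := (block_mx 0 1%:M (- 1%:M) 0 : 'M[F]_(k + k)).
Local Notation par := (@idx_parity m (k + k)).

Lemma par_lshift (i : 'I_m) : par (lshift (k + k) i) = false.
Proof. by rewrite /idx_parity /= leqNgt ltn_ord. Qed.

Lemma par_rshift (i : 'I_(k + k)) : par (rshift m i) = true.
Proof. by rewrite /idx_parity /= leq_addr. Qed.

Lemma symplecticM : J *m J = - 1%:M.
Proof.
rewrite mulmx_block !mulmx0 !mul0mx !mulmx1 !addr0 !add0r !mulmxN !mulmx1.
by rewrite scalar_mx_block opp_block_mx !oppr0 ?mulNmx ?mul1mx.
Qed.

Lemma symplectic_tr : J^T = - J.
Proof. by rewrite tr_block_mx opp_block_mx !trmx0 !oppr0 opprK trmx1 linearN /= trmx1. Qed.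

Lemma gl_hom_odd_block (B : 'M[F]_(m, k + k)) C : gl_hom true (block_mx 0 B C 0).
Proof.
apply/matrixP => a b; rewrite mxE.
case: (split_ordP a) => a' ->; case: (split_ordP b) => b' ->;
  rewrite ?(block_mxEul, block_mxEur, block_mxEdl, block_mxEdr) ?par_lshift ?par_rshift //;
  by rewrite mxE mul0rn.
Qed.

Lemma gl_hom_even_block (A : 'M[F]_m) (D : 'M[F]_(k + k)) :
  gl_hom false (block_mx A 0 0 D).
Proof.
apply/matrixP => a b; rewrite mxE.
case: (split_ordP a) => a' ->; case: (split_ordP b) => b' ->;
  rewrite ?(block_mxEul, block_mxEur, block_mxEdl, block_mxEdr) ?par_lshift ?par_rshift //;
  by rewrite mxE mul0rn.
Qed.

(** The upper right block of an odd element is arbitrary and determines the lower left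
    one. *)
Lemma osp_odd (B : 'M[F]_(m, k + k)) : in_osp (block_mx 0 B (- (J *m B^T)) 0).
Proof.
set X := block_mx _ _ _ _; have hX : gl_hom true X by apply: gl_hom_odd_block.
move=> [] i j; last by rewrite (mx_part_other hX) trmx0 mul0mx mulmx0 !mxE mulr0 addr0.
rewrite hX /X /osp_gram tr_block_mx !mulmx_block !trmx0 !mulmx0 !mul0mx.
rewrite !mulmx1 !mul1mx !addr0 !add0r linearN /= trmx_mul trmxK symplectic_tr mulmxN.
rewrite opprK -mulmxA symplecticM mulmxN mulmx1 mulmxN mulmxA symplecticM mulNmx mul1mx.
rewrite opprK; case: (split_ordP i) => i' ->; case: (split_ordP j) => j' ->;
  rewrite ?(block_mxEul, block_mxEur, block_mxEdl, block_mxEdr) ?par_lshift ?par_rshift /=.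
- by rewrite !mxE mulr0 addr0.
- by rewrite mxE expr0 mul1r addNr.
- by rewrite expr1 mulN1r addrN.
- by rewrite !mxE mulr0 addr0.
Qed.

Lemma osp_even (A : 'M[F]_m) (D : 'M[F]_(k + k)) :
  A^T + A = 0 -> D^T *m J + J *m D = 0 -> in_osp (block_mx A 0 0 D).
Proof.
move=> HA HD; set X := block_mx _ _ _ _.
have hX : gl_hom false X by apply: gl_hom_even_block.
move=> [] i j; first by rewrite (mx_part_other hX) trmx0 mul0mx mulmx0 !mxE mulr0 addr0.
rewrite hX expr0 mul1r /X /osp_gram tr_block_mx !mulmx_block !trmx0 !mulmx0 !mul0mx.
rewrite !mulmx1 !mul1mx !addr0 !add0r.
have := add_block_mx A^T 0 0 (D^T *m J) A 0 0 (J *m D).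
by rewrite HA HD !addr0 => /matrixP/(_ i j); rewrite mxE => ->; rewrite block_mx0 mxE.
Qed.

End Orthosymplectic.

Lemma seq_mx_null (F : fieldType) r s (c : 'rV[F]_r.+1) : c *m seq_mx r.+1 s = 0 ->
  exists x : nat -> F,
    (forall j, (j < r.+1)%N -> \sum_(i < r.+1) x i * nth 0 (nth [::] s i) j = 0) /\
    ((forall i, (i < r.+1)%N -> x i = 0) -> c = 0).
Proof.
move=> /rowP E; exists (fun k => c 0 (inord k)); split=> [j jr|x0].
  have := E (Ordinal jr); rewrite !mxE => sum0; apply: etrans sum0.
  by apply: eq_bigr => i _; rewrite mxE inord_val.
by apply/rowP => i; rewrite mxE -(inord_val i); apply: x0 (ltn_ord i).
Qed.

Section ListedCenter.
Variables (F : fieldType) (g : vectType F) (S : superBracket g).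
Hypothesis char0 : forall n, n.+1%:R != 0 :> F.
Hypothesis LS : lie_superalgebra S.

Lemma iso_commutator_center m n (P : 'M[F]_(m + n) -> Prop) e f x1 :
    iso_subalgebra S (gl F m n) P ->
    (forall i j : 'I_(m + n), ~~ idx_parity i -> idx_parity j ->
      exists X, [/\ P X, gl_hom true X &
        forall a b, ~~ idx_parity a -> idx_parity b -> X a b = ((a == i) && (b == j))%:R]) ->
    homog S false e -> homog S false f -> homog S true x1 -> x1 != 0 ->
    (forall x, lie S (lie S e f) x = 0) ->
  lie S e f = 0.
Proof.
move=> [phi [inj Pphi phiM phiH]] exX he hf hx nz zx; apply: (inj); rewrite linear0 phiM.
apply: (even_commutator_center char0 (proj1 (phiH _ _) he) (proj1 (phiH _ _) hf)
  (proj1 (phiH _ _) hx) _ exX).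
  by apply: contra nz => /eqP E; apply/eqP; apply: (inj); rewrite linear0.
move=> X /Pphi[x <-]; have := congr1 phi (zx x); rewrite linear0 phiM => <-.
by congr (gl_lie _ _); rewrite phiM.
Qed.

Lemma iso_neq0 (L' : lmodType F) (T : superBracket L') (P : L' -> Prop) y :
  iso_subalgebra S T P -> P y -> y != 0 -> exists x : g, x != 0.
Proof.
move=> [phi [_ Pphi _ _]] /Pphi[x <-] nz; exists x; apply: contra nz => /eqP->.
by rewrite linear0.
Qed.

(** The line spanned by a central element is an ideal, hence meets the span of the
    coroots; a central combination of coroots is a left null vector of the Cartan
    matrix. *)
Lemma contragredient_center r (A : 'M[F]_r) tau z :
    contragredient S A tau -> (forall c : 'rV_r, c *m A = 0 -> c = 0) ->
    (forall x, lie S z x = 0) -> (forall x, lie S x z = 0) ->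
  z = 0.
Proof.
move=> [e [f [hh [[_ _ _ hfree] [_ ef he _] _ maxI]]]] kerA zl zr.
have ideal : lie_ideal S <[z]>.
  move=> x y /vlineP[c ->]; rewrite (lieZ LS) (lieZl LS) zl zr scaler0.
  by split; apply: mem0v.
have cap0 : (<[z]> :&: <<[seq hh i | i <- enum 'I_r]>>)%VS = 0%VS.
  apply/eqP; rewrite -subv0; apply/subvP => w; rewrite memv_cap memv0 => /andP[wz wh].
  have wl x : lie S w x = 0.
    by have /vlineP[c ->] := wz; rewrite (lieZl LS) zl scaler0.
  have sz : size [seq hh i | i <- enum 'I_r] = r by rewrite size_map size_enum_ord.
  pose X : r.-tuple g := Tuple (introT eqP sz).
  have XE (i : 'I_r) : X`_i = hh i.
    by rewrite /= (nth_map i) ?size_enum_ord // nth_ord_enum.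
  have wE : w = \sum_i coord X i w *: hh i.
    by rewrite {1}(coord_span (X := X) wh); apply: eq_bigr => i _; rewrite XE.
  have e_nz j : e j != 0.
    apply/eqP => e0; have := ef j j; rewrite e0 (lie0l LS) eqxx => h0.
    have : hh j \in [seq hh i | i <- enum 'I_r] by apply: map_f; rewrite mem_enum.
    by move/(free_not0 hfree); rewrite -h0 eqxx.
  have c0 : \row_i coord X i w = 0.
    apply: kerA; apply/rowP => j; rewrite !mxE.
    have := wl (e j); rewrite {1}wE.
    have -> : lie S (\sum_i coord X i w *: hh i) (e j)
        = \sum_i (coord X i w * A i j) *: e j.
      elim/big_rec2: _ => [|i y u _ IH]; first exact: lie0l LS _.
      by rewrite (lie_linearl LS) IH he scalerA.
    rewrite -scaler_suml => /eqP; rewrite scaler_eq0 (negPf (e_nz j)) orbF => /eqP sum0.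
    by apply: etrans sum0; apply: eq_bigr => i _; rewrite mxE.
  rewrite wE big1 // => i _; have := congr1 (fun v : 'rV_r => v 0 i) c0.
  by rewrite !mxE => ->; rewrite scale0r.
have := maxI _ ideal cap0 => z0.
by apply/eqP; rewrite -memv0 -z0 memv_line.
Qed.

Lemma contragredient_neq0 r (A : 'M[F]_r.+1) tau :
  contragredient S A tau -> exists x : g, x != 0.
Proof.
move=> [_ [_ [hh [[_ _ _ hfree] _ _ _]]]]; exists (hh ord0).
by apply: (free_not0 hfree); apply: map_f; rewrite mem_enum.
Qed.

(** Trace in the matrix algebras; in the three others, the Cartan matrix is invertible.
    *)
Lemma listed_commutator_center e f x1 : listed S ->
    homog S false e -> homog S false f -> homog S true x1 -> x1 != 0 ->
    (forall x, lie S (lie S e f) x = 0) ->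
  lie S e f = 0.
Proof.
move=> Hl he hf hx nz zl; set z := lie S e f in zl *.
have hz : homog S false z by apply: (lie_hom LS he hf).
have zr x : lie S x z = 0.
  have [x0 [y1 [h0 h1 ->]]] := hom_sum LS x.
  have E i u : homog S i u -> lie S u z = 0.
    by move=> hu; rewrite (lie_skew LS hu hz) zl scaler0 oppr0.
  by rewrite -[x0]scale1r (lie_linearl LS) (E _ _ h0) (E _ _ h1) scaler0 addr0.
have two0 : 2%:R != 0 :> F := char0 1.
case: Hl => [m n _ iso|m n _ _ iso|m k _ iso|a a0 a1 con|con|con].
- apply: (iso_commutator_center iso) he hf hx nz zl => i j pi pj.
  exists (delta_mx i j); split=> //; last by move=> a b _ _; rewrite mxE.
  by have := gl_hom_delta F i j; rewrite (negPf pi) pj.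
- apply: (iso_commutator_center iso) he hf hx nz zl => i j pi pj.
  exists (delta_mx i j); split; last by move=> a b _ _; rewrite mxE.
    by apply: supertrace_delta; apply: contraNneq pi => ->.
  by have := gl_hom_delta F i j; rewrite (negPf pi) pj.
- apply: (iso_commutator_center iso) he hf hx nz zl => i j.
  case: (split_ordP i) => i' ->; rewrite ?par_lshift ?par_rshift // => _.
  case: (split_ordP j) => j' ->; rewrite ?par_lshift ?par_rshift // => _.
  exists (block_mx 0 (delta_mx i' j') (- (block_mx 0 1%:M (- 1%:M) 0 *m (delta_mx i' j')^T)) 0).
  split; [exact: osp_odd | exact: gl_hom_odd_block|] => a b.
  case: (split_ordP a) => a' ->; rewrite ?par_lshift ?par_rshift // => _.
  case: (split_ordP b) => b' ->; rewrite ?par_lshift ?par_rshift // => _.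
  by rewrite block_mxEur mxE (inj_eq (@lshift_inj _ _)) (inj_eq (@rshift_inj _ _)).
- apply: (contragredient_center con) zl zr => c /seq_mx_null[x [E]]; apply.
  have E0 := E 0 isT; have E1 := E 1 isT; have {E} E2 := E 2 isT; move: E0 E1 E2.
  rewrite !big_ord_recl !big_ord0 /=; set c0 := x _; set c1 := x _; set c2 := x _.
  rewrite !mulr0 !addr0 !mulrN !mulr1 !add0r => E0 E1 E2.
  have x1E : c1 = - c2 by apply/eqP; rewrite -subr_eq0 opprK -oppr_eq0 opprD E0.
  have x0E : c0 = 2%:R * c2 by move: E1; rewrite x1E => E1; apply/eqP; rewrite -subr_eq0 -E1; apply/eqP; ring.
  have x20 : c2 = 0.
    have : (2%:R * (a + 1)) * c2 = 0 by rewrite -E2 x0E; ring.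
    by move=> /eqP; rewrite !mulf_eq0 (negPf two0) addr_eq0 (negPf a1) => /eqP.
  by case=> [|[|[|//]]] _; [rewrite -/c0 x0E x20 mulr0 | rewrite -/c1 x1E x20 oppr0 |].
- apply: (contragredient_center con) zl zr => c /seq_mx_null[x [E]]; apply.
  have E0 := E 0 isT; have E1 := E 1 isT; have {E} E2 := E 2 isT; move: E0 E1 E2.
  rewrite !big_ord_recl !big_ord0 /=; set c0 := x _; set c1 := x _; set c2 := x _.
  rewrite !mulr0 !addr0 !add0r !mulrN !mulr1 => /eqP; rewrite oppr_eq0 => /eqP x10.
  rewrite x10 !mul0r oppr0 !add0r ?oppr0 ?addr0 ?add0r => x02 /eqP.
  rewrite mulf_eq0 (negPf two0) orbF => /eqP x20.
  move: x02; rewrite x20 subr0 => x00.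
  by case=> [|[|[|//]]] _.
- apply: (contragredient_center con) zl zr => c /seq_mx_null[x [E]]; apply.
  have E0 := E 0 isT; have E1 := E 1 isT; have E2 := E 2 isT; have {E} E3 := E 3 isT.
  move: E0 E1 E2 E3; rewrite !big_ord_recl !big_ord0 /=.
  set c0 := x _; set c1 := x _; set c2 := x _; set c3 := x _.
  rewrite !mulr0 !addr0 !add0r !mulrN !mulr1 => /eqP; rewrite oppr_eq0 => /eqP x10.
  rewrite x10 !mul0r oppr0 !add0r => x02 E2 E3.
  have x20 : c2 = 0.
    have : 3%:R * c2 = 0 by rewrite -[RHS](addr0 0) -{2}E3 -(mulr0 2%:R) -E2; ring.
    by move=> /eqP; rewrite mulf_eq0 (negPf (char0 2)) => /eqP.
  have x30 : c3 = 0.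
    move: E3; rewrite x20 oppr0 add0r => /eqP.
    by rewrite mulf_eq0 (negPf two0) orbF => /eqP.
  move: x02; rewrite x20 ?subr0 ?oppr0 ?addr0 => x00.
  by case=> [|[|[|[|//]]]] _.
Qed.

Lemma listed_neq0 : listed S -> exists x : g, x != 0.
Proof.
case=> [m n mn iso|m n mn lt1 iso|m k lt1 iso|a a0 a1 con|con|con]; first 3 last.
- exact: contragredient_neq0 con.
- exact: contragredient_neq0 con.
- exact: contragredient_neq0 con.
- have i : 'I_(m + n) := Ordinal mn.
  apply: (iso_neq0 iso (y := delta_mx i i)) => //.
  by apply/eqP => /matrixP/(_ i i); rewrite !mxE !eqxx => /eqP; rewrite oner_eq0.
- pose i : 'I_(m + n) := Ordinal (ltnW lt1); pose j : 'I_(m + n) := Ordinal lt1.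
  apply: (iso_neq0 iso (y := delta_mx i j)); first exact: supertrace_delta.
  by apply/eqP => /matrixP/(_ i j); rewrite !mxE !eqxx => /eqP; rewrite oner_eq0.
- case: k iso lt1 => [|k] iso lt1.
    rewrite !addn0 in lt1; pose i : 'I_m := Ordinal (ltnW lt1); pose j : 'I_m := Ordinal lt1.
    apply: (iso_neq0 iso (y := block_mx (delta_mx i j - delta_mx j i) 0 0 0)).
      apply: osp_even; last by rewrite trmx0 mul0mx mulmx0 addr0.
      by rewrite linearB /= !trmx_delta addrC addrA subrK subrr.
    apply/eqP => /matrixP/(_ (lshift _ i) (lshift _ j)); rewrite block_mxEul !mxE !eqxx.
    by rewrite subr0 => /eqP; rewrite oner_eq0.
  apply: (iso_neq0 iso (y := block_mx 0 0 0 (block_mx 0 1%:M 0 0))).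
    apply: osp_even; first by rewrite trmx0 addr0.
    rewrite tr_block_mx !mulmx_block !trmx0 !trmx1 !mulmx0 !mul0mx ?mulmx1 ?mul1mx.
    by rewrite !addr0 add_block_mx !addr0 addrN block_mx0.
  apply/eqP => /matrixP/(_ (rshift _ (lshift _ ord0)) (rshift _ (rshift _ ord0))).
  by rewrite block_mxEdr block_mxEur !mxE eqxx => /eqP; rewrite oner_eq0.
Qed.

End ListedCenter.

(** * Root spaces of the finite-dimensional superalgebra *)

Section RootSpaces.
Variables (F : fieldType) (g : vectType F) (S : superBracket g).
Variables (form : g -> g -> F) (h : {vspace g}).
Hypothesis char0 : forall n, n.+1%:R != 0 :> F.
Hypothesis LS : lie_superalgebra S.
Hypothesis Sf : invariant_form S form.
Hypothesis h_even : forall x, x \in h -> homog S false x.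
Hypothesis RD : root_decomposition S h.
Implicit Types (alpha beta : hdual h) (eta : subvs_of h).

Let hP : forall x, x \in h <-> root_space S (0 : hdual h) x := proj1 RD.

Lemma lieD x y z : lie S x (y + z) = lie S x y + lie S x z.
Proof. by rewrite -[y]scale1r (lie_linearr LS) !scale1r. Qed.

Lemma hdual_neq0 alpha : alpha != 0 -> exists eta, (alpha eta : F) != 0.
Proof.
move=> nz; apply: contrapT => no; case/eqP: nz; apply/lfunP => eta; rewrite lfunE /=.
by apply/eqP/negPn/negP => ?; apply: no; exists eta.
Qed.

Lemma eigenvectors_independent eta (u : nat -> g) (c : nat -> F) n :
    injective c -> (forall i, lie S (vsval eta) (u i) = c i *: u i) ->
    (forall i, u i != 0) ->
  forall a : nat -> F, \sum_(i < n) a i *: u i = 0 -> forall i, (i < n)%N -> a i = 0.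
Proof.
move=> c_inj uE u_nz; elim: n => // n IH a sum0.
have low i : (i < n)%N -> a i = 0.
  move=> lt_in; have : a i * (c i - c n) = 0.
    apply: (IH (fun i => a i * (c i - c n))) lt_in.
    have E : lie S (vsval eta) (\sum_(i < n.+1) a i *: u i) = 0 by rewrite sum0 (lie0 LS).
    have := congr1 (fun z => lie S (vsval eta) (\sum_(i < n.+1) a i *: u i) - c n *: z) sum0.
    rewrite scaler0 subr0 {2}E (lie_sumr LS) scaler_sumr -sumrB big_ord_recr /=.
    rewrite (lieZ LS) uE scalerA scalerA [a n * _]mulrC subrr addr0 => sum1.
    by apply: etrans sum1; apply: eq_bigr => j _; rewrite (lieZ LS) uE !scalerA -scalerBl mulrBr [c n * _]mulrC.
  move=> /eqP; rewrite mulf_eq0 subr_eq0 (inj_eq c_inj) (ltn_eqF lt_in) orbF => /eqP.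
  exact.
move=> i; rewrite ltnS leq_eqVlt => /predU1P[->|/low//].
move: sum0; rewrite big_ord_recr /= big1 ?add0r => [/eqP|j _]; last first.
  by rewrite low ?scale0r.
by rewrite scaler_eq0 (negPf (u_nz n)) orbF => /eqP.
Qed.

(** In an infinite string, some [eta] in [h] would have infinitely many distinct
    eigenvalues. *)
Lemma root_string_finite alpha gamma (u : nat -> g) : alpha != 0 ->
    (forall n, root_space S (gamma + alpha *+ n : hdual h) (u n)) ->
  exists n, u n = 0.
Proof.
move=> /hdual_neq0[eta nz] ru; apply: contrapT => no.
have u_nz i : u i != 0 by apply/eqP => E; apply: no; exists i.
pose c i : F := (gamma + alpha *+ i) eta.
have cE i : c i = (gamma eta : F) + (alpha eta : F) *+ i.
  rewrite /c lfunE /=; congr (_ + _).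
  by elim: i => [|i IH]; rewrite ?mulr0n ?lfunE // !mulrS lfunE /= IH.
have c_inj : injective c.
  move=> i j; rewrite !cE => /addrI; rewrite -[in LHS]mulr_natr -[in RHS]mulr_natr.
  move=> /(mulfI nz) /eqP; rewrite -[_ == _]/(i%:~R == j%:~R :> F) => /eqP.
  by move/(int_inj_char0 char0) => [].
pose n := (\dim {:g}).+1; pose X := mkseq u n.
have sX : size X == n by rewrite size_mkseq.
have : free (Tuple sX).
  apply/freeP => k sum0 i.
  pose a m := if insub m is Some j then k j else 0.
  have aE (j : 'I_n) : a j = k j by rewrite /a valK.
  rewrite -aE; apply: (eigenvectors_independent (n := n) c_inj (fun i => ru i eta) u_nz).
    apply: etrans sum0; apply: eq_bigr => j _; rewrite aE; congr (_ *: _).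
    by rewrite nth_mkseq.
  exact: ltn_ord.
rewrite /free [size _](eqP sX) => /eqP dimX.
by have := dimvS (subvf <<Tuple sX>>); rewrite dimX ltnn.
Qed.

Lemma homog_root_parts alpha x0 x1 : homog S false x0 -> homog S true x1 ->
  root_space S alpha (x0 + x1) -> root_space S alpha x0 /\ root_space S alpha x1.
Proof.
move=> h0 h1 rx.
have E eta : lie S (vsval eta) x0 - (alpha eta : F) *: x0
    = (alpha eta : F) *: x1 - lie S (vsval eta) x1.
  have := rx eta; rewrite lieD scalerDr => E; apply/eqP.
  by rewrite subr_eq addrAC eq_sym subr_eq addrC eq_sym E addrC.
have hB i c (x y : g) : homog S i x -> homog S i y -> homog S i (x - c *: y).
  by move=> hx hy; rewrite addrC -scaleNr; apply: (homP LS).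
have he eta := h_even (valP eta).
have A0 eta : lie S (vsval eta) x0 - (alpha eta : F) *: x0 = 0.
  apply: (hom_direct LS); first exact: hB (lie_hom LS (he eta) h0) h0.
  rewrite E -[lie _ _ _]scale1r -scaleN1r scalerA addrC; apply: (homP LS).
    exact: (lie_hom LS (he eta) h1).
  by rewrite -[_ *: _]addr0; apply: (homP LS) => //; apply: (hom0 LS).
split=> eta; apply/eqP; first by rewrite -subr_eq0 A0.
by rewrite eq_sym -subr_eq0 -E A0.
Qed.

(** The form pairs opposite root spaces: decompose a vector which pairs non-trivially
    with [x]. *)
Lemma root_pairing i alpha x : alpha != 0 -> homog S i x -> root_space S alpha x -> x != 0 ->
  exists y, [/\ homog S i y, root_space S (- alpha : hdual h) y & form x y = 1].
Proof.
move=> al_nz hx rx x_nz.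
have [y xy] : exists y, form x y != 0.
  apply: contrapT => no; case/eqP: x_nz; apply: (form_nondegenerate Sf) => y.
  by apply/eqP/negPn/negP => ?; apply: no; exists y.
have fD u v : form x (u + v) = form x u + form x v.
  by rewrite -[u]scale1r (form_linearr Sf) mul1r scale1r.
have [z rz xz] : exists2 z, root_space S (- alpha : hdual h) z & form x z != 0.
  have [z0 [D [zs [z0h zsP yE]]]] := (proj2 RD) y.
  have opp beta z : root_space S beta z -> form x z != 0 -> root_space S (- alpha : hdual h) z.
    move=> rz xz; have := form_root LS Sf h_even rx rz xz => /eqP.
    by rewrite addrC addr_eq0 => /eqP <-.
  have [x0|] := eqVneq (form x z0) 0; last by exists z0 => //; apply: opp (proj1 (hP z0) z0h) _.
  apply: contrapT => no; case/eqP: xy; rewrite yE fD x0 add0r big_seq.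
  elim/big_rec: _ => [|beta w bD w0]; first exact: (form_zeror Sf).
  rewrite fD w0 addr0; apply/eqP/negPn/negP => nz; apply: no.
  by exists (zs beta) => //; apply: opp (proj2 (zsP beta bD)) nz.
have [z0 [z1 [h0 h1 zE]]] := hom_sum LS z.
rewrite zE in rz xz; have [r0 r1] := homog_root_parts h0 h1 rz.
have [w [hw rw xw]] : exists w, [/\ homog S i w, root_space S (- alpha : hdual h) w & form x w != 0].
  rewrite fD in xz; case: i hx => hx; [exists z1|exists z0]; split=> //; move: xz.
    by rewrite (form_even Sf hx h0) // add0r.
  by rewrite (form_even Sf hx h1) // addr0.
exists ((form x w)^-1 *: w); split.
- by rewrite -[_ *: _]addr0; apply: (homP LS) => //; apply: (hom0 LS).
- by move=> eta; rewrite (lieZ LS) rw !scalerA mulrC.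
rewrite -[_ *: _]addr0 (form_linearr Sf) (form_zeror Sf) addr0.
exact: mulVf.
Qed.

Section Strings.
Variables (alpha : hdual h) (e f : g).
Hypothesis al_nz : alpha != 0.
Hypothesis he : homog S false e.
Hypothesis hf : homog S false f.
Hypothesis re : root_space S alpha e.
Hypothesis rf : root_space S (- alpha : hdual h) f.

Local Notation t := (lie S e f).
Local Notation tv := (vsproj h t).

Lemma coroot_in_h : t \in h.
Proof. by apply/hP; have := root_spaceD LS h_even he re rf; rewrite subrr. Qed.

Lemma coroot_act beta v : root_space S beta v -> lie S t v = (beta tv : F) *: v.
Proof. by move=> rv; rewrite -rv vsprojK // coroot_in_h. Qed.

(** The usual [sl2] computation: [f e^(n+1) v] is a multiple of [e^n v], by the sum of
    the first [n+1] values of the coroot along the string. *)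
Lemma string_up beta v : lie S f v = 0 -> root_space S beta v ->
    (forall n, (beta tv : F) *+ n.+1 + (alpha tv : F) *+ 'C(n.+1, 2) != 0) ->
  v = 0.
Proof.
move=> fv rv c_nz; pose u n := iter n (lie S e) v.
have ru n : root_space S (beta + alpha *+ n : hdual h) (u n).
  elim: n => [|n IH]; first by rewrite mulr0n addr0.
  by have := root_spaceD LS h_even he re IH; rewrite addrCA -mulrS.
have val_root n : ((beta + alpha *+ n) tv : F) = (beta tv : F) + (alpha tv : F) *+ n.
  rewrite lfunE /=; congr (_ + _).
  by elim: n => [|n IH]; rewrite ?mulr0n ?lfunE // !mulrS lfunE /= IH.
have fu n : lie S f (u n.+1)
    = - ((beta tv : F) *+ n.+1 + (alpha tv : F) *+ 'C(n.+1, 2)) *: u n.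
  have step m : lie S f (u m.+1) = - (lie S t (u m)) + lie S e (lie S f (u m)).
    rewrite /= (lie_jacobi LS _ hf he) expr0 scale1r; congr (_ + _).
    rewrite (lie_skew LS hf he) expr0 scale1r -scaleN1r (lieZl LS).
    by rewrite scaleN1r.
  elim: n => [|n IH]; rewrite step (coroot_act (ru _)) val_root.
    by rewrite [u 0%N]/= fv (lie0 LS) !mulr0n !addr0 scaleNr.
  rewrite IH (lieZ LS) -[lie S e (u n)]/(u n.+1) -scaleNr -scalerDl; congr (_ *: _).
  rewrite -opprD; congr (- _).
  have -> : 'C(n.+2, 2) = ('C(n.+1, 2) + n.+1)%N by rewrite binS bin1.
  by rewrite [_ *+ n.+2]mulrS [_ *+ (_ + n.+1)]mulrnDr addrACA; congr (_ + _); rewrite addrC.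
have [n un] := root_string_finite al_nz ru.
elim: n un => // n IH un; apply: IH; have := fu n; rewrite un (lie0 LS) => /esym/eqP.
by rewrite scaler_eq0 oppr_eq0 (negPf (c_nz n)) => /eqP.
Qed.

Lemma string_bottom beta v : v != 0 -> root_space S beta v ->
  exists n w, [/\ w != 0, root_space S (beta - alpha *+ n : hdual h) w & lie S f w = 0].
Proof.
move=> v_nz rv; pose u n := iter n (lie S f) v.
have ru n : root_space S (beta + (- alpha) *+ n : hdual h) (u n).
  elim: n => [|n IH]; first by rewrite mulr0n addr0.
  by have := root_spaceD LS h_even hf rf IH; rewrite addrCA -mulrS.
have nal_nz : - alpha != 0 by rewrite oppr_eq0.
have ex : exists n, u n == 0 by have [n /eqP un] := root_string_finite nal_nz ru; exists n.
case: (ex_minnP ex) => [[|n] /eqP un min]; first by case/eqP: v_nz.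
exists n, (u n); split; [|by have := ru n; rewrite mulNrn|exact: un].
by apply/negP => /min; rewrite ltnn.
Qed.

End Strings.

Hypothesis LST : listed S.

(** If [e] is even and [e1] is odd in the same root space, take [f] even with
    [(e|f) = 1].  The coroot [[e,f]] represents [alpha], so it is not zero.  If it does
    not vanish on [alpha], the string through [e1] never ends, since [f] maps [e1] to
    the odd part of [h].  If it vanishes on [alpha], every root vanishes on it, since
    the string through a lowest vector would not end either: the coroot is a non-zero
    central commutator of even elements. *)
Lemma no_mixed alpha e e1 : alpha != 0 -> homog S false e -> homog S true e1 ->
  root_space S alpha e -> root_space S alpha e1 -> e != 0 -> e1 != 0 -> False.
Proof.
move=> al_nz he h1 re r1 e_nz e1_nz.
have [f [hf rf ef]] := root_pairing al_nz he re e_nz.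
have t_eta eta : form (lie S e f) (vsval eta) = alpha eta.
  rewrite (form_invariant Sf) (lie_h_skew LS h_even f (valP eta)) rf -scaleNr lfunE /= opprK.
  by rewrite -[_ *: f]addr0 (form_linearr Sf) ef (form_zeror Sf) addr0 mulr1.
have t_h : lie S e f \in h := coroot_in_h he re rf.
have [at0|at_nz] := eqVneq (alpha (vsproj h (lie S e f)) : F) 0; last first.
  case/eqP: e1_nz; apply: (string_up al_nz he hf re rf _ r1) => [|n].
    apply: (hom_direct LS); last exact: (lie_hom LS hf h1).
    by apply/h_even/hP; have := root_spaceD LS h_even hf rf r1; rewrite addNr.
  have := mulf_neq0 (char0 ('C(n.+2, 2)).-1) at_nz.
  rewrite prednK ?bin_gt0 // mulr_natl binS bin1 mulrnDr addrC.
  by rewrite binS.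
have root0 beta x : root_space S beta x -> lie S (lie S e f) x = 0.
  move=> rx; have [->|x_nz] := eqVneq x 0; first exact: (lie0 LS).
  rewrite (coroot_act he re rf rx).
  have [n [w [w_nz rw fw]]] := string_bottom al_nz hf rf x_nz rx.
  have [->|bt_nz] := eqVneq (beta (vsproj h (lie S e f)) : F) 0; first exact: scale0r.
  case/eqP: w_nz; apply: (string_up al_nz he hf re rf fw rw) => k.
  have -> : ((beta - alpha *+ n) (vsproj h (lie S e f)) : F) = beta (vsproj h (lie S e f)).
    rewrite lfunE /= lfunE /=.
    suff -> : ((alpha *+ n) (vsproj h (lie S e f)) : F) = 0 by rewrite subr0.
    by elim: (n) => [|m IH]; rewrite ?mulr0n ?lfunE // mulrS lfunE /= IH at0 addr0.
  by rewrite at0 mul0rn addr0 -mulr_natr mulf_neq0.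
have central x : lie S (lie S e f) x = 0.
  have [x0 [D [xs [x0h xsP ->]]]] := (proj2 RD) x.
  rewrite lieD (root0 _ _ (proj1 (hP _) x0h)) add0r (lie_sumr LS) big_seq.
  by rewrite big1 // => beta bD; apply: root0 (proj2 (xsP beta bD)).
have t0 := listed_commutator_center char0 LS LST he hf h1 e1_nz central.
by case/eqP: al_nz; apply/lfunP => eta; rewrite lfunE /= -t_eta t0 (form_zerol Sf).
Qed.

Lemma root_vector_homog alpha x : alpha != 0 -> root_space S alpha x -> exists i, homog S i x.
Proof.
move=> al_nz; have [x0 [x1 [h0 h1 ->]]] := hom_sum LS x => rx.
have [r0 r1] := homog_root_parts h0 h1 rx.
have [->|x0_nz] := eqVneq x0 0; first by exists true; rewrite add0r.
have [->|x1_nz] := eqVneq x1 0; first by exists false; rewrite addr0.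
by case: (no_mixed al_nz h0 h1 r0 r1 x0_nz x1_nz).
Qed.

End RootSpaces.

(** * Existence of a triangular basis *)

(** Take a linearly independent family in [P] of maximal size. *)
Lemma free_family_in (F : fieldType) (g : vectType F) (P : g -> Prop) :
  exists X : seq g, [/\ free X, forall v, v \in X -> P v & forall v, P v -> v \in <<X>>%VS].
Proof.
pose Q n := `[< exists X : seq g, [/\ free X, forall v, v \in X -> P v & size X = n] >].
have Q0 : exists n, Q n by exists 0%N; apply/asboolP; exists [::]; split; rewrite ?nil_free.
have ub n : Q n -> (n <= \dim {:g})%N.
  by move=> /asboolP[X [/eqP <- _ <-]]; apply: dimvS (subvf _).
case: (ex_maxnP Q0 ub) => n /asboolP[X [fX XP sX]] max; exists X; split=> // v Pv.
apply: contraT => vX; have : Q n.+1.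
  apply/asboolP; exists (v :: X); split; [by rewrite free_cons vX| |by rewrite /= sX].
  by move=> w; rewrite inE => /predU1P[->//|/XP].
by move=> /max; rewrite ltnn.
Qed.

Lemma sub_behead (T : eqType) (x : T) (s A : seq T) :
  {subset x :: s <= A} -> {subset s <= A}.
Proof. by move=> sub y ys; apply: sub; rewrite inE ys orbT. Qed.

Section TriangularBasisExists.
Variables (F : fieldType) (g : vectType F) (S : superBracket g).
Variables (h : {vspace g}) (Sigma : seq (hdual h)).
Hypothesis LS : lie_superalgebra S.
Hypothesis h_even : forall x, x \in h -> homog S false x.
Hypothesis hP : forall x, x \in h <-> root_space S (0 : hdual h) x.

(** Iterated brackets; only non-empty words are meaningful. *)
Fixpoint nest (x : hdual h -> g) (s : seq (hdual h)) : g :=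
  match s with
  | [::] => 0
  | [:: sigma] => x sigma
  | sigma :: s' => lie S (x sigma) (nest x s')
  end.

Lemma nest_cons x sigma s : s != [::] -> nest x (sigma :: s) = lie S (x sigma) (nest x s).
Proof. by case: s. Qed.

(** Applied to the positive and to the negative generators. *)
Definition nest_or_h (x : hdual h -> g) (v : g) : Prop :=
  v \in h \/ exists s, [/\ s != [::], {subset s <= Sigma} & v = nest x s].

Lemma nest_homog x (hx : forall sigma, sigma \in Sigma -> exists i, homog S i (x sigma)) s :
  {subset s <= Sigma} -> exists i, homog S i (nest x s).
Proof.
elim: s => [|sigma s IH] sub; first by exists false; apply: (hom0 LS).
have [i hi] := hx sigma (sub _ (mem_head _ _)).
have [|j hj] := IH; first exact: sub_behead sub.
case: s {IH sub} hj => [|r s] hj; first by exists i.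
by exists (i (+) j); apply: (lie_hom LS).
Qed.

Lemma nest_root x (w : hdual h -> hdual h)
    (hx : forall sigma, sigma \in Sigma -> exists i, homog S i (x sigma))
    (rx : forall sigma, sigma \in Sigma -> root_space S (w sigma) (x sigma)) s :
  {subset s <= Sigma} -> root_space S (\sum_(sigma <- s) w sigma : hdual h) (nest x s).
Proof.
elim: s => [|sigma s IH] sub; first by move=> eta; rewrite (lie0 LS) scaler0.
have sg := sub _ (mem_head _ _); have [i hi] := hx sigma sg.
have {}IH : root_space S (\sum_(sigma <- s) w sigma : hdual h) (nest x s).
  by apply: IH; apply: sub_behead sub.
case: s {sub} IH => [|r s] IH; first by rewrite big_seq1; apply: rx.
by rewrite big_cons; apply: (root_spaceD LS h_even hi (rx _ sg) IH).
Qed.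

Lemma lie_span u (P : g -> Prop) (V : {vspace g}) (X : seq g) :
    (forall v, v \in X -> P v) -> (forall v, P v -> lie S u v \in V) ->
  forall v, v \in <<X>>%VS -> lie S u v \in V.
Proof.
move=> XP PV v vX; rewrite (coord_span (X := in_tuple X) vX) (lie_sumr LS).
apply: memv_suml => i _; rewrite (lieZ LS); apply: memvZ; apply: PV; apply: XP.
exact: mem_nth.
Qed.

Lemma lspan_lie u (P Q : g -> Prop) : (forall v, P v -> lspan Q (lie S u v)) ->
  forall v, lspan P v -> lspan Q (lie S u v).
Proof.
move=> PQ; apply: (lspan_ind (Q := fun v => lspan Q (lie S u v))) => [|c w v Pw Qv].
  by rewrite (lie0 LS); apply: lspan0.
by rewrite (lie_linearr LS); apply: lspanD => //; apply/lspanZ/PQ.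
Qed.

Section Opposite.
Variables (x y : hdual h -> g) (wy : hdual h -> hdual h).
Hypothesis hx : forall sigma, sigma \in Sigma -> exists i, homog S i (x sigma).
Hypothesis hy : forall sigma, sigma \in Sigma -> exists i, homog S i (y sigma).
Hypothesis ry : forall sigma, sigma \in Sigma -> root_space S (wy sigma) (y sigma).
Hypothesis xy : forall sigma tau, sigma \in Sigma -> tau \in Sigma ->
  lie S (x sigma) (y tau) \in h.

Lemma lie_h_nest eta s : eta \in h -> {subset s <= Sigma} ->
  exists c : F, lie S eta (nest y s) = c *: nest y s.
Proof.
move=> eh sub; exists ((\sum_(sigma <- s) wy sigma) (vsproj h eta) : F).
by rewrite -(nest_root hy ry sub) vsprojK.
Qed.

Lemma raise_nest tau v : tau \in Sigma -> nest_or_h y v -> lspan (nest_or_h y) (lie S (y tau) v).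
Proof.
move=> tS; have sub1 : {subset [:: tau] <= Sigma} by move=> r; rewrite inE => /eqP->.
case=> [vh|[s [s0 sub ->]]].
  rewrite (lie_h_skew LS h_even _ vh) -scaleN1r; apply: lspanZ.
  have [c E] := lie_h_nest vh sub1; rewrite [lie _ _ _]E; apply: lspanZ.
  by apply: lspan_gen; right; exists [:: tau].
apply: lspan_gen; right; exists (tau :: s); rewrite nest_cons //; split=> //.
by move=> r; rewrite inE => /predU1P[->//|/sub].
Qed.

(** By the Jacobi identity: the bracket of opposite generators lies in [h], which acts
    on the rest of the word by a scalar. *)
Lemma lower_nest sigma s : sigma \in Sigma -> s != [::] -> {subset s <= Sigma} ->
  lspan (nest_or_h y) (lie S (x sigma) (nest y s)).
Proof.
move=> sS; elim: s => // tau s IH _ sub; have tS := sub _ (mem_head _ _).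
have [s0|s_nz] := eqVneq s [::].
  by rewrite s0 /=; apply: lspan_gen; left; apply: xy.
have sub' : {subset s <= Sigma} := sub_behead sub.
rewrite nest_cons //; have [i hi] := hx sS; have [j hj] := hy tS.
rewrite (lie_jacobi LS _ hi hj); apply: lspanD.
  have [c ->] := lie_h_nest (xy sS tS) sub'; apply: lspanZ.
  by apply: lspan_gen; right; exists s.
by apply: lspanZ; apply: lspan_lie (IH s_nz sub') => v; apply: raise_nest.
Qed.

End Opposite.

Lemma nest_stable x (V : {vspace g}) :
    (forall sigma, sigma \in Sigma -> exists i, homog S i (x sigma)) ->
    (forall sigma, sigma \in Sigma -> forall v, v \in V -> lie S (x sigma) v \in V) ->
  forall s, {subset s <= Sigma} -> forall v, v \in V -> lie S (nest x s) v \in V.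
Proof.
move=> hx xV; elim=> [|sigma s IH] sub v vV; first by rewrite (lie0l LS) mem0v.
have sS := sub _ (mem_head _ _).
have [->|s_nz] := eqVneq s [::]; first exact: xV.
have {}sub : {subset s <= Sigma} := sub_behead sub.
rewrite nest_cons //; have [i hi] := hx sigma sS; have [j hj] := nest_homog hx sub.
have := lie_jacobi LS v hi hj => /eqP; rewrite -subr_eq => /eqP <-.
apply: memvB; first by apply: xV => //; apply: IH.
by apply: memvZ; apply: IH => //; apply: xV.
Qed.

End TriangularBasisExists.

Section TriangularBasis.
Variables (F : fieldType) (g : vectType F) (S : superBracket g).
Variables (form : g -> g -> F) (h : {vspace g}) (Sigma : seq (hdual h)).
Hypothesis char0 : forall n, n.+1%:R != 0 :> F.
Hypothesis LS : lie_superalgebra S.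
Hypothesis Sf : invariant_form S form.
Hypothesis h_even : forall x, x \in h -> homog S false x.
Hypothesis RD : root_decomposition S h.
Hypothesis LST : listed S.
Hypothesis base : is_base S Sigma.

Let hP : forall x, x \in h <-> root_space S (0 : hdual h) x := proj1 RD.

Definition base_height (alpha : hdual h) : F := \sum_j coord (in_tuple Sigma) j alpha.

Lemma base_heightD alpha beta :
  base_height (alpha + beta) = base_height alpha + base_height beta.
Proof. by rewrite /base_height -big_split; apply: eq_bigr => j _; rewrite linearD. Qed.

Lemma base_height0 : base_height 0 = 0.
Proof. by rewrite /base_height big1 // => j _; rewrite linear0. Qed.

Lemma base_heightN alpha : base_height (- alpha) = - base_height alpha.
Proof. by rewrite /base_height -sumrN; apply: eq_bigr => j _; rewrite linearN. Qed.

Lemma base_heightMn alpha n : base_height (alpha *+ n) = base_height alpha *+ n.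
Proof.
elim: n => [|n IH]; first by rewrite !mulr0n base_height0.
by rewrite !mulrS base_heightD IH.
Qed.

Lemma base_height_simple sigma : sigma \in Sigma -> base_height sigma = 1.
Proof.
case: base => fS _ _ /(nthP 0)[i iS <-]; rewrite /base_height.
rewrite (bigD1 (Ordinal iS)) //= big1 ?addr0 => [|j nj].
  by rewrite (coord_free (X := in_tuple Sigma) (Ordinal iS) (Ordinal iS) fS) eqxx.
rewrite (coord_free (X := in_tuple Sigma) (Ordinal iS) j fS).
by rewrite eq_sym (negPf nj).
Qed.

Lemma base_height_word s : {subset s <= Sigma} ->
  base_height (\sum_(sigma <- s) sigma) = (size s)%:R.
Proof.
elim: s => [|sigma s IH] sub; first by rewrite big_nil base_height0.
rewrite big_cons base_heightD base_height_simple ?sub ?mem_head // IH ?mulrS //.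
exact: sub_behead sub.
Qed.

Lemma base_height_positive alpha : positive_root S Sigma alpha ->
  exists n, base_height alpha = n.+1%:R.
Proof.
move=> [[al_nz _] [c alE]].
have E : base_height alpha = (\sum_i c i)%:R.
  rewrite alE natr_sum; elim/big_rec2: _ => [|i u v _ IH]; first exact: base_height0.
  by rewrite base_heightD IH base_heightMn base_height_simple // mem_nth.
have [c0|c_nz] := posnP (\sum_i c i); last by exists (\sum_i c i).-1; rewrite E prednK.
case/eqP: al_nz; rewrite alE big1 // => i _.
have /eqP := c0; rewrite sum_nat_eq0 => /forallP/(_ i)/eqP ->.
exact: mulr0n.
Qed.

Lemma word_multiplicities s : {subset s <= Sigma} ->
  exists c : 'I_(size Sigma) -> nat,
    \sum_(sigma <- s) sigma = \sum_(i < size Sigma) Sigma`_i *+ c i.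
Proof.
elim: s => [|sigma s IH] sub.
  by exists (fun=> 0%N); rewrite big_nil big1.
have [|c E] := IH; first exact: sub_behead sub.
have /(nthP 0)[i iS iE] := sub _ (mem_head _ _).
exists (fun j => (j == Ordinal iS) + c j)%N; rewrite big_cons E.
have -> : \sum_(j < size Sigma) Sigma`_j *+ ((j == Ordinal iS) + c j)
    = \sum_(j < size Sigma) Sigma`_j *+ (j == Ordinal iS)
      + \sum_(j < size Sigma) Sigma`_j *+ c j.
  by rewrite -big_split; apply: eq_bigr => j _; rewrite mulrnDr.
congr (_ + _); rewrite (bigD1 (Ordinal iS)) //= eqxx big1 ?addr0 ?iE //.
by move=> j /negPf ->; rewrite mulr0n.
Qed.

(** The words in the positive generators, the words in the negative generators and [h]
    span a subspace containing the generators, stable under bracketing with each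
    generator, hence by the Jacobi identity with each word; so it is everything. *)
Lemma triangular_span (x y : hdual h -> g) (X : seq g) :
    (forall sigma, sigma \in Sigma ->
       root_space S sigma (x sigma) /\ root_space S (- sigma : hdual h) (y sigma)) ->
    (forall V, lie_subalgebra S V -> (h <= V)%VS ->
       (forall sigma, sigma \in Sigma -> x sigma \in V /\ y sigma \in V) -> V = fullv) ->
    (forall sigma tau, sigma \in Sigma -> tau \in Sigma -> sigma != tau ->
       lie S (x sigma) (y tau) = 0) ->
    (forall sigma, sigma \in Sigma -> exists i, homog S i (x sigma)) ->
    (forall sigma, sigma \in Sigma -> exists i, homog S i (y sigma)) ->
    (forall v, v \in X -> nest_or_h S Sigma x v \/ nest_or_h S Sigma y v) ->
    (forall v, nest_or_h S Sigma x v \/ nest_or_h S Sigma y v -> v \in <<X>>%VS) ->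
  <<X>>%VS = fullv.
Proof.
move=> rxy gen xy0 hx hy XP PX.
have rx s : s \in Sigma -> root_space S (id s) (x s) by case/rxy.
have ry s : s \in Sigma -> root_space S (- s : hdual h) (y s) by case/rxy.
have xyh s u : s \in Sigma -> u \in Sigma -> lie S (x s) (y u) \in h.
  move=> sS uS; have [<-|su] := eqVneq s u; last by rewrite xy0 // mem0v.
  have [i hi] := hx s sS.
  by apply/hP; have := root_spaceD LS h_even hi (rx s sS) (ry s sS); rewrite subrr.
have yxh s u : s \in Sigma -> u \in Sigma -> lie S (y s) (x u) \in h.
  move=> sS uS; have [i hi] := hy s sS; have [j hj] := hx u uS.
  by rewrite (lie_skew LS hi hj) memvN memvZ // xyh.
have spanV z : (forall v, nest_or_h S Sigma z v -> v \in <<X>>%VS) ->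
    forall v, lspan (nest_or_h S Sigma z) v -> v \in <<X>>%VS.
  move=> zV v [l [lP ->]]; rewrite big_seq; apply: memv_suml => p pl.
  by apply: memvZ; apply: zV (lP p pl).
have spanVx := spanV x (fun v vx => PX v (or_introl vx)).
have spanVy := spanV y (fun v vy => PX v (or_intror vy)).
have xV s : s \in Sigma -> forall v, v \in <<X>>%VS -> lie S (x s) v \in <<X>>%VS.
  move=> sS; apply: (lie_span LS XP) => v [vx|[vh|[l [l0 sub ->]]]].
  - by apply: spanVx; apply: (raise_nest LS h_even hx rx sS vx).
  - by apply: spanVx; apply: (raise_nest LS h_even hx rx sS (or_introl vh)).
  - by apply: spanVy; apply: (lower_nest LS h_even hx hy ry xyh sS l0 sub).
have yV s : s \in Sigma -> forall v, v \in <<X>>%VS -> lie S (y s) v \in <<X>>%VS.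
  move=> sS; apply: (lie_span LS XP) => v [[vh|[l [l0 sub ->]]]|vy].
  - by apply: spanVy; apply: (raise_nest LS h_even hy ry sS (or_introl vh)).
  - by apply: spanVx; apply: (lower_nest LS h_even hy hx rx yxh sS l0 sub).
  - by apply: spanVy; apply: (raise_nest LS h_even hy ry sS vy).
have hV u : u \in h -> forall v, v \in <<X>>%VS -> lie S u v \in <<X>>%VS.
  move=> uh; have hhV v : v \in h -> lie S u v \in <<X>>%VS.
    by move=> /hP rv; rewrite -[u](vsprojK uh) rv lfunE scale0r mem0v.
  apply: (lie_span LS XP) => v [[/hhV//|[l [l0 sub ->]]]|[/hhV//|[l [l0 sub ->]]]].
    have [c ->] := lie_h_nest LS h_even hx rx uh sub; apply: memvZ.
    by apply: PX; left; right; exists l.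
  have [c ->] := lie_h_nest LS h_even hy ry uh sub; apply: memvZ.
  by apply: PX; right; right; exists l.
apply: gen => [u v uX vX| |s sS].
- rewrite (coord_span (X := in_tuple X) uX).
  elim/big_rec: _ => [|i w _ wV]; first by rewrite (lie0l LS) mem0v.
  rewrite (lie_linearl LS) memvD // memvZ //.
  have [[]|[]] := XP _ (mem_nth 0 (ltn_ord i)).
  - by move/hV; apply.
  - by move=> [l [_ sub ->]]; apply: (nest_stable LS hx xV sub).
  - by move/hV; apply.
  - by move=> [l [_ sub ->]]; apply: (nest_stable LS hy yV sub).
- by apply/subvP => v vh; apply: PX; left; left.
- have sub1 : {subset [:: s] <= Sigma} by move=> r; rewrite inE => /eqP->.
  split; apply: PX; [left|right]; by right; exists [:: s].
Qed.

Lemma triangular_basis_exists : exists (N : nat) (b : N.-tuple g) (pa : 'I_N -> bool)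
    (wt : 'I_N -> hdual h) (ht : 'I_N -> int),
  triangular_basis S Sigma b pa wt ht base_height.
Proof.
have [fS rS [x [y [rxy gen xy0]]]] := base.
have homog_root := root_vector_homog char0 LS Sf h_even RD LST.
have hx s : s \in Sigma -> exists i, homog S i (x s).
  by move=> sS; apply: homog_root (proj1 (rS s sS)) (proj1 (rxy s sS)).
have hy s : s \in Sigma -> exists i, homog S i (y s).
  move=> sS; apply: homog_root _ (proj2 (rxy s sS)).
  by rewrite oppr_eq0; apply: proj1 (rS s sS).
have rx s : s \in Sigma -> root_space S (id s) (x s) by case/rxy.
have ry s : s \in Sigma -> root_space S (- s : hdual h) (y s) by case/rxy.
have [X [fX XP PX]] := free_family_in (fun v => nest_or_h S Sigma x v \/ nest_or_h S Sigma y v).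
have Xfull := triangular_span rxy gen xy0 hx hy XP PX.
pose good v (d : bool * hdual h * int) := [/\ homog S d.1.1 v, root_space S d.1.2 v,
  d.2 = 0 -> v \in h, 0 < d.2 -> positive_root S Sigma d.1.2 &
  base_height d.1.2 = d.2%:~R].
have h_good v : v \in h -> exists d, good v d.
  move=> vh; exists (false, 0, 0); split=> //=; [exact: h_even|exact/hP|].
  exact: base_height0.
have ex (i : 'I_(size X)) : exists d, good X`_i d.
  have iX : X`_i \in X := mem_nth 0 (ltn_ord i).
  have [[/h_good//|[s [s0 sub vE]]]|[/h_good//|[s [s0 sub vE]]]] := XP _ iX.
    have [j hj] := nest_homog LS hx sub.
    have [c cE] := word_multiplicities sub.
    have rv := nest_root LS h_even hx rx sub.
    exists (j, \sum_(sigma <- s) sigma, (size s)%:Z); split=> /=.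
    - by rewrite vE.
    - by rewrite vE.
    - by case: (s) s0.
    - move=> _; split; last by exists c.
      split; last by exists X`_i; [exact: free_not0 fX iX | rewrite vE].
      apply/eqP => s_0; have := base_height_word sub; rewrite s_0 base_height0.
      by case: (s) s0 => // a r _ /eqP; rewrite eq_sym (negPf (char0 _)).
    - exact: base_height_word.
  have [j hj] := nest_homog LS hy sub.
  have rv := nest_root LS h_even hy ry sub.
  exists (j, \sum_(sigma <- s) - sigma, - (size s)%:Z); split=> /=.
  - by rewrite vE.
  - by rewrite vE.
  - by case: (s) s0.
  - by rewrite oppr_gt0.
  - by rewrite sumrN base_heightN base_height_word // mulrNz.
have [d dP] := fin_all_exists ex.
exists (size X), (in_tuple X), (fun i => (d i).1.1), (fun i => (d i).1.2), (fun i => (d i).2).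
split.
- by rewrite /basis_of /= Xfull eqxx.
- by move=> i; case: (dP i).
- by move=> i; case: (dP i).
- by move=> i; case: (dP i).
- by move=> i; case: (dP i).
- by move=> i; case: (dP i).
- exact: base_heightD.
- exact: base_height_positive.
Qed.

(** If [h] were zero, all of [g] would have weight zero, hence lie in [h]. *)
Lemma triangular_basis_height0 N (b : N.-tuple g) pa wt ht height :
  triangular_basis S Sigma b pa wt ht height -> exists i, ht i = 0.
Proof.
move=> tbP; have [eta [eh eta_nz]] : exists eta, eta \in h /\ eta != 0.
  apply: contrapT => no; have [v /eqP v_nz] := listed_neq0 LST.
  have h0 u : u \in h -> u = 0.
    by move=> uh; apply/eqP/negPn/negP => nz; apply: no; exists u.
  case: v_nz; apply/h0/hP => eta.
  by rewrite (h0 _ (valP eta)) (lie0l LS) lfunE scale0r.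
have [i nz] : exists i, coord b i eta != 0.
  apply: contrapT => no; case/eqP: eta_nz; rewrite (tb_sum tbP eta) big1 // => i _.
  have [->|nz] := eqVneq (coord b i eta) 0; first exact: scale0r.
  by case: no; exists i.
exists i; apply: (wt0_ht0 char0 tbP).
by rewrite -(coord_root LS tbP (proj1 (hP eta) eh) nz).
Qed.

End TriangularBasis.

Theorem corollary6p11 (R : realType) (g : vectType (complex R))
    (S : superBracket g) (form : g -> g -> complex R) (h : {vspace g})
    (Sigma : seq (hdual h))
    (lambda : 'Hom(affine_cartan h, ((complex R)^o)%type)) :
  lie_superalgebra S ->
  listed S ->
  invariant_form S form ->
  cartan_subalgebra S h ->
  root_decomposition S h ->
  is_base S Sigma ->
  simple_module (verma S form Sigma lambda) <->
  lambda (cartan_K h) <> 0%R.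
Proof.
move=> LS LST Sf [h_even _ _ _] RD base.
have char0 n : n.+1%:R != 0 :> complex R by rewrite pnatr_eq0.
have [N [b [pa [wt [ht tbP]]]]] := triangular_basis_exists char0 LS Sf h_even RD LST base.
have [i ht0] := triangular_basis_height0 char0 LS RD LST tbP.
exact: (verma_simple_iff char0 LS Sf (proj1 RD) h_even tbP lambda ht0).
Qed.
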